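(* Let $T\sim\{X_n\}_{n=1}^\infty$ be a random weighted shift, $\Gamma=\operatorname{essran}X_1$ and $\Gamma_1=\Gamma\setminus\{0\}$. (i) If $0\notin\Gamma$ and $\operatorname{card}\Gamma>1$, then $\mathbb P^2\{(\omega_1,\omega_2)\in\Omega^2:T(\omega_1)\approx T(\omega_2)\}=0$; indeed, $\mathbb P(T\approx A)=0$ for any deterministic operator $A$. (ii) If $0\in\Gamma$, then $\mathbb P^2\{(\omega_1,\omega_2)\in\Omega^2:T(\omega_1)\approx T(\omega_2)\}=1$; indeed, there exists a deterministic operator $A$ such that $T\approx A$ a.s. (iii) If $0$ is an accumulation point of $\Gamma$ and $A$ is a (unilateral or bilateral) weighted shift, then $T\approx A$ a.s. if and only if $\Sigma_n(A)=\Gamma^n$ for all $n\ge1$. (iv) If $0$ is an isolated point of $\Gamma$ and $A$ is a unilateral weighted shift with nonnegative weights $\{a_i\}_{i=1}^\infty$, then $T\approx A$ a.s. if and only if $\Sigma_1(A)\subset\Gamma$ and one of the following three holds: (a) $a_1=0$ and $\{0\}\times\Gamma_1^n\times\{0\}\subset\Sigma_{n+2}(A)$ for all $n\ge1$; (b) $a_1\ne0$ and $\{0\}\times\Gamma_1^n\times\{0\}\subset\Sigma_{n+2}(A)$ for all $n\ge0$; (c) there exists $m\ge1$ such that $(a_1,\dots,a_{m+1})\in\Gamma_1^m\times\{0\}$, $\{0\}\times\big[\Gamma_1^m\setminus\{(a_1,\dots,a_m)\}\big]\times\{0\}\subset\Sigma_{m+2}(A)$, and $\{0\}\times\Gamma_1^n\times\{0\}\subset\Sigma_{n+2}(A)$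 for all $n\ge0$, $n\ne m$. (v) If $0$ is an isolated point of $\Gamma$ and $A$ is a bilateral weighted shift, then $T\approx A$ a.s. if and only if $\Sigma_1(A)\subset\Gamma$ and $\{0\}\times\Gamma_1^n\times\{0\}\subset\Sigma_{n+2}(A)$ for all $n\ge0$.
   Context: $\mathcal H$ is a complex separable infinite-dimensional Hilbert space with orthonormal basis $\{e_n\}_{n=1}^\infty$. $\{X_n\}_{n=1}^\infty$ are nonnegative, bounded, i.i.d. random variables on a probability space $(\Omega,\mathcal F,\mathbb P)$; $\mathbb P^2$ is the product measure on $\Omega^2$. Writing $T\sim\{X_n\}$ means that $T=T(\omega)$ is the random unilateral weighted shift $T(\omega)e_n=X_n(\omega)e_{n+1}$, $n\ge1$. $\operatorname{essran}X_1$ is the essential range of $X_1$ (closed support of its law). Operators are bounded and linear on Hilbert spaces. $C^*(A)$ is the $C^*$-algebra generated by $A$ and the identity; $A\approx B$ (algebraic equivalence) means there is a $*$-isomorphism of $C^*(A)$ onto $C^*(B)$ carrying $A$ to $B$. Weighted shifts act by $Af_i=a_if_{i+1}$ on an orthonormal basis $\{f_i\}$ indexed by $i\ge1$ (unilateral) or $i\in\mathbb Z$ (bilateral), with bounded nonnegative weights. The $n$-spectrum $\Sigma_n(A)$ is the closure in $\mathbb R^n$ of $\{(|a_i|,|a_{i+1}|,\dots,|a_{i+n-1}|)\}$, with $i$ ranging over $i\ge1$ in the unilateral case and $i\in\mathbb Z$ in the bilateral case. For $n=0$, $\{0\}\times\Gamma_1^0\times\{0\}=\{(0,0)\}$. 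*)

(* Defs.v *)
From mathcomp Require Import all_boot all_order all_algebra.
From mathcomp Require Import all_classical all_reals all_analysis.
From mathcomp Require Export complex.
From mathcomp Require Export sesquilinear.

Set Implicit Arguments.
Unset Strict Implicit.
Unset Printing Implicit Defensive.

Import Order.TTheory GRing.Theory Num.Theory.
Import numFieldNormedType.Exports.

Local Open Scope classical_set_scope.
Local Open Scope complex_scope.
Local Open Scope ring_scope.

(* The inner product is linear in its first argument and conjugate-linear in
   its second one. *)
Record hilbertType (R : realType) := HilbertType {
  hilbert_sort :> completeNormedModType R[i];
  hdot : {dot hilbert_sort for (@Num.conj R[i])};
  hdot_norm : forall x : hilbert_sort, hdot x x = `|x| ^+ 2 }.

Definition orthonormal_basis (R : realType) (H : hilbertType R) (I : eqType)
    (e : I -> H) : Prop :=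
  (forall i j, hdot H (e i) (e j) = (i == j)%:R) /\
  closure [set x : H | exists n (s : 'I_n -> I) (c : 'I_n -> R[i]),
                         x = \sum_(k < n) c k *: e (s k)] = [set: H].

Definition bounded_operator (R : realType) (H : hilbertType R) (T : H -> H)
    : Prop :=
  linear T /\ exists M : R, forall x, `|T x| <= M%:C * `|x|.

Definition is_adjoint (R : realType) (H : hilbertType R) (T T' : H -> H)
    : Prop :=
  forall x y, hdot H (T x) y = hdot H x (T' y).

(* Unital C*-subalgebras of B(H); the last condition is closedness for the
   operator norm, |S - T| <= eps being spelled out pointwise. *)
Definition cstar_subalgebra (R : realType) (H : hilbertType R)
    (B : set (H -> H)) : Prop :=
  [/\ B `<=` @bounded_operator R H,
      B id,
      forall (c : R[i]) S T, B S -> B T -> B (fun x => c *: S x + T x) &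
      forall S T, B S -> B T -> B (S \o T)] /\
  (forall S S', B S -> is_adjoint S S' -> B S') /\
  (forall T, bounded_operator T ->
     (forall eps : R, 0 < eps ->
        exists2 S, B S & forall x, `|S x - T x| <= eps%:C * `|x|) ->
     B T).

Definition cstar_generated (R : realType) (H : hilbertType R) (A : H -> H)
    : set (H -> H) :=
  smallest (@cstar_subalgebra R H) [set A].

(* Meaningful for bounded operators A and B. The map phi is only relevant on
   C*(A). *)
Definition algebraically_equivalent (R : realType) (H K : hilbertType R)
    (A : H -> H) (B : K -> K) : Prop :=
  exists phi : (H -> H) -> (K -> K),
  [/\ set_bij (cstar_generated A) (cstar_generated B) phi,
      forall (c : R[i]) S T, cstar_generated A S -> cstar_generated A T ->
        phi (fun x => c *: S x + T x) = (fun y => c *: phi S y + phi T y),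
      forall S T, cstar_generated A S -> cstar_generated A T ->
        phi (S \o T) = phi S \o phi T,
      forall S S', cstar_generated A S -> is_adjoint S S' ->
        is_adjoint (phi S) (phi S') &
      phi A = B].

(* Weighted shifts over an index type I with successor map next: I = nat for
   the unilateral case and I = int for the bilateral one. Unilateral indices
   start at 0, so that a i is the weight usually written a_{i+1}. *)
Definition weighted_shift (R : realType) (H : hilbertType R) (I : eqType)
    (next : I -> I) (f : I -> H) (a : I -> R) (A : H -> H) : Prop :=
  [/\ orthonormal_basis f,
      forall i, 0 <= a i,
      bounded_operator A &
      forall i, A (f i) = (a i)%:C *: f (next i)].

Definition next_int (i : int) : int := i + 1.

Definition unilateral_shift (R : realType) (H : hilbertType R)
    (f : nat -> H) (a : nat -> R) (A : H -> H) : Prop :=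
  weighted_shift succn f a A.

Definition bilateral_shift (R : realType) (H : hilbertType R)
    (f : int -> H) (a : int -> R) (A : H -> H) : Prop :=
  weighted_shift next_int f a A.

Definition n_spectrum (R : realType) (I : Type) (next : I -> I) (a : I -> R)
    (n : nat) : set 'rV[R]_n :=
  closure (range (fun i : I => \row_(j < n) `|a (iter j next i)|)).
Arguments n_spectrum {R I} next a n _.

Definition set_power (R : realType) (G : set R) (n : nat) : set 'rV[R]_n :=
  [set v : 'rV[R]_n | forall j, G (v 0 j)].
Arguments set_power {R} G n _.

(* {0} x E x {0} *)
Definition zero_flanked (R : realType) (n : nat) (E : set 'rV[R]_n)
    : set 'rV[R]_n.+2 :=
  [set w : 'rV[R]_n.+2 |
    [/\ w 0 ord0 = 0,
        E (\row_(j < n) w 0 (lift ord0 (widen_ord (leqnSn n) j))) &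
        w 0 ord_max = 0]].

Definition mutually_independent (d : measure_display) (Omega : measurableType d)
    (R : realType) (P : probability Omega R) (X : nat -> {RV P >-> R}) : Prop :=
  forall (J : seq nat) (B : nat -> set R), uniq J ->
    (forall j, measurable (B j)) ->
    P (\bigcap_(j in [set` J]) (X j @^-1` B j)) =
    (\prod_(j <- J) P (X j @^-1` B j))%E.

Definition identically_distributed (d : measure_display)
    (Omega : measurableType d) (R : realType) (P : probability Omega R)
    (X : nat -> {RV P >-> R}) : Prop :=
  forall n (B : set R), measurable B ->
    distribution P (X n) B = distribution P (X 0%N) B.

Definition essran (d : measure_display) (Omega : measurableType d)
    (R : realType) (P : probability Omega R) (X : {RV P >-> R}) : set R :=
  [set x | forall U : set R, open U -> U x -> (0 < distribution P X U)%E].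

(* The event T ~~ A for T ~ {X_n}. If each X_n is bounded but the bounds are not
   uniform in n, T(omega) is a bounded operator only for almost every omega;
   the other omega are left out of the event. *)
Definition equiv_event (R : realType) (H : hilbertType R) (e : nat -> H)
    (Omega : Type) (X : nat -> Omega -> R) (K : hilbertType R) (A : K -> K)
    : set Omega :=
  [set w | exists2 T : H -> H, unilateral_shift e (X^~ w) T &
             algebraically_equivalent T A].

Definition equiv_event2 (R : realType) (H : hilbertType R) (e : nat -> H)
    (Omega : Type) (X : nat -> Omega -> R) : set (Omega * Omega) :=
  [set w | exists T1 T2 : H -> H,
             [/\ unilateral_shift e (X^~ w.1) T1,
                 unilateral_shift e (X^~ w.2) T2 &
                 algebraically_equivalent T1 T2]].

(* Main.v *)
Require Import Defs.
From mathcomp Require Import all_boot all_order all_algebra.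
From mathcomp Require Import all_classical all_reals all_analysis.
From mathcomp Require Import measurable_realfun.
From mathcomp Require Import ring lra zify.

Import Order.TTheory GRing.Theory Num.Theory.
Import numFieldNormedType.Exports.

(** Why the theorem holds.

    Algebraic equivalence is a statement about norms: A and B are algebraically
    equivalent if and only if p(A, A^* ) and p(B, B^* ) have the same norm for all
    *-polynomials p, and Gaussian rational coefficients suffice
    ([equiv_rational_norms]).  One direction says that a *-isomorphism is
    isometric.  This is obtained without spectral theory: if the norm N of phi(S)
    exceeded the norm of S, then 1 - N^-2 S^*S would have an inverse in the algebra,
    given by its Neumann series, while 1 - N^-2 phi(S)^*phi(S) is not bounded below.
    In the other direction the correspondence of *-polynomials is isometric and
    extends to the closures by completeness.

    For a weighted shift, the norm of p applied to a finite combination of basis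
    vectors is an explicit polynomial in finitely many weights ([sqn_vec]).  Hence
    the events of the theorem are given by countably many inequalities between
    measurable functions, which makes them measurable, and the norms only depend
    on which finite windows of weights occur approximately, the weights of a
    unilateral shift being extended by zeros.

    If 0 is in Gamma, then almost surely all weights are in Gamma and every finite
    word over Gamma occurs approximately among consecutive weights
    ([ae_in_essran], [ae_windows]).  The norm of p(T) is then the supremum over all
    finitely supported sequences of weights in Gamma ([generic_universal]), a
    deterministic quantity; this gives (ii).  A shift A is equivalent to T exactly
    when it realizes the same suprema.  Weights in Gamma give one inequality, by
    truncation.  For the other one it is enough that A contains all windows over
    Gamma, or, when 0 is isolated in Gamma, all blocks of nonzero elements of Gamma
    between two zeros, since every operator p(A, A^* ) splits at a vanishing weight
    ([windows_lower], [blocks_lower]).  These conditions are necessary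
    because the diagonal operator sum_k (A^*k A^k - c_k)^2, to which A A^* is added
    when a zero on the left is prescribed, is not bounded below exactly when the
    pattern of weights encoded by the c_k, whose elements are nonzero except
    possibly the last one, occurs approximately ([pattern_transfer]).  The conditions (iii)-(v) are restatements in
    terms of n-spectra; in (iv) the initial segment of a unilateral shift is a block
    whose left zero is not a weight of the shift ([unilateral_blocksP]).

    If 0 is not in Gamma, then the weights are almost surely bounded below, the
    powers of 1 - W^-2 A A^* converge to the projection on the first basis vector,
    and the norms of A^n (1 - W^-2 A A^* )^k determine the products of the first
    n weights.  An equivalence class contains at most one such sequence of weights
    ([equiv_rigid]), and a sequence of values has probability zero as soon as Gamma
    has two points ([sequence_null]); this gives (i), the
    measure of a set of pairs being the integral of the measures of its sections. *)

Set Implicit Arguments.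
Unset Strict Implicit.
Unset Printing Implicit Defensive.

Local Open Scope classical_set_scope.
Local Open Scope ring_scope.
Local Open Scope complex_scope.

(** * Real norms and inner products *)

Section RealNorm.
Context {R : realType}.

Definition cnorm (c : R[i]) : R := complex.Re `|c|.

Lemma cnormE (c : R[i]) : `|c| = (cnorm c)%:C.
Proof. by rewrite /cnorm RRe_real // normr_real. Qed.

Lemma cnorm_ge0 c : 0 <= cnorm c.
Proof. by rewrite -(@lecR R) -cnormE /= normr_ge0. Qed.

Lemma cnormM c c' : cnorm (c * c') = cnorm c * cnorm c'.
Proof. by apply: (@complexI R); rewrite -cnormE normrM !cnormE rmorphM. Qed.

Lemma cnorm_real (a : R) : cnorm a%:C = `|a|.
Proof.
apply: (@complexI R); rewrite -cnormE normc_def /= expr0n addr0.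
by rewrite sqrtr_sqr.
Qed.

Lemma cnorm0 : cnorm 0 = 0.
Proof. by rewrite /cnorm normr0. Qed.

Lemma cnormD c c' : cnorm (c + c') <= cnorm c + cnorm c'.
Proof. by rewrite -(@lecR R) rmorphD -!cnormE ler_normD. Qed.

Lemma cnorm_eq0 c : cnorm c = 0 -> c = 0.
Proof. by move=> h; apply/eqP; rewrite -normr_eq0 cnormE h. Qed.

End RealNorm.

Section Hilbert.
Context {R : realType} {H : hilbertType R}.
Implicit Types x y z : H.

(** The norm of a complex normed space is a nonnegative element of R[i]; the real
    version is the one to which ordered-field tactics apply. *)
Definition nrm x : R := complex.Re `|x|.

Lemma nrmE x : `|x| = (nrm x)%:C.
Proof. by rewrite /nrm RRe_real // normr_real. Qed.

Lemma nrm_ge0 x : 0 <= nrm x.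
Proof. by rewrite -(@lecR R) -nrmE /= normr_ge0. Qed.

Lemma nrm0 : nrm 0 = 0. Proof. by rewrite /nrm normr0. Qed.

Lemma nrm_eq0 x : nrm x = 0 -> x = 0.
Proof. by move=> h; apply/eqP; rewrite -normr_eq0 nrmE h. Qed.

Lemma nrmN x : nrm (- x) = nrm x. Proof. by rewrite /nrm normrN. Qed.

Lemma nrmD x y : nrm (x + y) <= nrm x + nrm y.
Proof. by have := ler_normD x y; rewrite !nrmE -rmorphD lecR. Qed.

Lemma nrmZ c x : nrm (c *: x) = cnorm c * nrm x.
Proof. by apply: (@complexI R); rewrite rmorphM /= -cnormE -!nrmE normrZ. Qed.

Lemma nrm_distC x y : nrm (x - y) = nrm (y - x).
Proof. by rewrite -nrmN opprB. Qed.

Lemma nrm_tri z x y : nrm (x - y) <= nrm (x - z) + nrm (z - y).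
Proof. by apply: le_trans (nrmD _ _); rewrite addrA subrK. Qed.

Lemma le_complex_nrm x M y : (`|x| <= M%:C * `|y|) = (nrm x <= M * nrm y).
Proof. by rewrite !nrmE -rmorphM lecR. Qed.

Lemma dot_nrm x : hdot H x x = (nrm x ^+ 2)%:C.
Proof. by rewrite hdot_norm nrmE rmorphXn. Qed.

Lemma dotC x y : hdot H y x = Num.conj (hdot H x y).
Proof. by rewrite hermC expr0 mul1r. Qed.

Lemma dotDl x y z : hdot H (x + y) z = hdot H x z + hdot H y z.
Proof. exact: linearDl. Qed.
Lemma dotZl c x z : hdot H (c *: x) z = c * hdot H x z.
Proof. exact: linearZl_LR. Qed.
Lemma dotDr x y z : hdot H z (x + y) = hdot H z x + hdot H z y.
Proof. exact: linearDr. Qed.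
Lemma dotZr c x z : hdot H z (c *: x) = Num.conj c * hdot H z x.
Proof. exact: linearZr_LR. Qed.
Lemma dot0l z : hdot H 0 z = 0. Proof. exact: linear0l. Qed.
Lemma dot0r z : hdot H z 0 = 0. Proof. exact: linear0r. Qed.
Lemma dotBl x y z : hdot H (x - y) z = hdot H x z - hdot H y z.
Proof. exact: linearBl. Qed.
Lemma dotBr x y z : hdot H z (x - y) = hdot H z x - hdot H z y.
Proof. exact: linearBr. Qed.

Lemma dot_suml I (r : seq I) (F : I -> H) z :
  hdot H (\sum_(i <- r) F i) z = \sum_(i <- r) hdot H (F i) z.
Proof. by elim: r => [|i r IH]; rewrite ?big_nil ?dot0l // !big_cons dotDl IH. Qed.

Lemma dot_sumr I (r : seq I) (F : I -> H) z :
  hdot H z (\sum_(i <- r) F i) = \sum_(i <- r) hdot H z (F i).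
Proof. by elim: r => [|i r IH]; rewrite ?big_nil ?dot0r // !big_cons dotDr IH. Qed.

Lemma Cauchy_Schwarz x y : cnorm (hdot H x y) <= nrm x * nrm y.
Proof.
have [->|y0] := eqVneq y 0; first by rewrite dot0r cnorm0 nrm0 mulr0.
have n0 : 0 < nrm y ^+ 2.
  rewrite exprn_even_gt0 //=; apply: contra y0 => /eqP h.
  by apply/eqP; apply: nrm_eq0.
set d := hdot H x y.
have hd : Num.conj d * d = (cnorm d ^+ 2)%:C.
  by rewrite mulrC -normCK cnormE -rmorphXn.
pose b : R[i] := ((nrm y ^+ 2)^-1)%:C.
have hb : Num.conj b = b by apply: conj_Creal; apply/complex_realP; eexists.
have hby : b * hdot H y y = 1.
  by rewrite dot_nrm -rmorphM /= mulVf ?gt_eqF.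
have := dot_nrm (x - (d * b) *: y).
rewrite dotBl !dotBr !dotZl !dotZr (dotC x y) -/d rmorphM /= hb !dot_nrm.
rewrite dot_nrm in hby.
have -> : (nrm x ^+ 2)%:C - Num.conj d * b * d -
   (d * b * Num.conj d - d * b * (Num.conj d * b * (nrm y ^+ 2)%:C)) =
   (nrm x ^+ 2)%:C - (Num.conj d * d) * b + d * Num.conj d * b * (b * (nrm y ^+ 2)%:C - 1).
  by ring.
rewrite hby subrr mulr0 addr0 hd -rmorphM -rmorphB => /(@complexI R) h.
rewrite -(@ler_pXn2r _ 2) ?nnegrE ?cnorm_ge0 ?mulr_ge0 ?nrm_ge0 //.
rewrite exprMn -ler_pdivrMr // -subr_ge0 h.
exact: sqr_ge0.
Qed.

Lemma dot_ext x y : (forall z, hdot H x z = hdot H y z) -> x = y.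
Proof.
move=> h; apply/eqP; rewrite -subr_eq0; apply/eqP/nrm_eq0.
have : hdot H (x - y) (x - y) = 0 by rewrite dotBl h subrr.
rewrite dot_nrm => /(@complexI R (_ ^+ 2) 0) /eqP.
by rewrite sqrf_eq0 => /eqP.
Qed.

Lemma complete_nrm (u : nat -> H) :
  (forall e : R, 0 < e ->
     exists N, forall m n, (N <= m)%N -> (N <= n)%N -> nrm (u m - u n) < e) ->
  exists l, forall e : R, 0 < e ->
     exists N, forall n, (N <= n)%N -> nrm (u n - l) < e.
Proof.
move=> uC.
have cu : cauchy (u @ \oo).
  apply/cauchyP => e e0.
  have re : e = (complex.Re e)%:C by rewrite RRe_real // gtr0_real.
  move: e0; rewrite re (@ltcR R 0) => e0.
  have [N hN] := uC _ e0; exists (u N).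
  exists N => // n /= Nn.
  by rewrite -ball_normE /= nrmE ltcR; apply: hN.
have /cvg_ex [l /= ul] : cvg (u @ \oo) by exact: cauchy_cvg.
exists l => e e0.
have := ul => /cvgrPdist_lt /(_ e%:C); rewrite (@ltcR R 0) => /(_ e0) [N _ hN].
by exists N => n Nn; have := hN n Nn; rewrite /= nrmE ltcR nrm_distC.
Qed.

End Hilbert.

(** * Bounded operators and their limits *)

Section Operators.
Context {R : realType} {H : hilbertType R}.
Implicit Types (S T U : H -> H) (x y z : H).

(** Estimates are pointwise, with explicit constants, so that no supremum has to be
    shown finite. *)
Definition obd S (M : R) := forall x, nrm (S x) <= M * nrm x.

Lemma bopP T : bounded_operator T <-> linear T /\ exists2 M, 0 <= M & obd T M.
Proof.
split=> -[lT [M hM]]; split=> //.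
  exists `|M| => // x; have := hM x; rewrite le_complex_nrm => h.
  by apply: le_trans h _; rewrite ler_wpM2r ?nrm_ge0 ?ler_norm.
by exists M => x; rewrite le_complex_nrm.
Qed.

Lemma bop_lin T : bounded_operator T -> linear T. Proof. by case. Qed.

Lemma lin0 T : linear T -> T 0 = 0.
Proof.
move=> lT; have := lT (-1) 0 0; rewrite scaler0 addr0 scaleN1r => {1}->.
by rewrite addNr.
Qed.

Lemma linD T x y : linear T -> T (x + y) = T x + T y.
Proof. by move=> lT; have := lT 1 x y; rewrite !scale1r. Qed.

Lemma linZ T c x : linear T -> T (c *: x) = c *: T x.
Proof. by move=> lT; have := lT c x 0; rewrite (lin0 lT) !addr0. Qed.

Lemma linB T x y : linear T -> T (x - y) = T x - T y.
Proof. by move=> lT; rewrite linD // -scaleN1r linZ // scaleN1r. Qed.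

Lemma lin_sum T I (r : seq I) (F : I -> H) : linear T ->
  T (\sum_(i <- r) F i) = \sum_(i <- r) T (F i).
Proof.
move=> lT; elim: r => [|i r IH]; first by rewrite !big_nil lin0.
by rewrite !big_cons linD // IH.
Qed.

Lemma bop_id : bounded_operator (id : H -> H).
Proof. by apply/bopP; split=> //; exists 1 => // x; rewrite mul1r. Qed.

Lemma bop_comp S T : bounded_operator S -> bounded_operator T ->
  bounded_operator (S \o T).
Proof.
move=> /bopP[lS [M M0 hM]] /bopP[lT [N N0 hN]]; apply/bopP; split.
  by move=> c x y /=; rewrite lT lS.
exists (M * N); first exact: mulr_ge0.
by move=> x /=; apply: le_trans (hM _) _; rewrite -mulrA ler_wpM2l.
Qed.

Lemma bop_comb c S T : bounded_operator S -> bounded_operator T ->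
  bounded_operator (fun x => c *: S x + T x).
Proof.
move=> /bopP[lS [M M0 hM]] /bopP[lT [N N0 hN]]; apply/bopP; split.
  move=> d x y; rewrite lS lT !scalerDr !scalerA (mulrC c d) -!addrA.
  by congr (_ + _); rewrite addrCA.
exists (cnorm c * M + N); first by rewrite addr_ge0 // mulr_ge0 // cnorm_ge0.
move=> x; apply: le_trans (nrmD _ _) _; rewrite mulrDl lerD //.
by rewrite nrmZ -mulrA ler_wpM2l ?cnorm_ge0.
Qed.

Lemma bop0 : bounded_operator (fun _ : H => 0 : H).
Proof.
apply/bopP; split; first by move=> c x y; rewrite scaler0 addr0.
by exists 0 => // x; rewrite nrm0 mul0r.
Qed.

Lemma adj_sym S S' : is_adjoint S S' -> is_adjoint S' S.
Proof. by move=> h x y; rewrite dotC -h -dotC. Qed.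

Lemma adj_unique S S1 S2 : is_adjoint S S1 -> is_adjoint S S2 -> S1 = S2.
Proof.
move=> h1 h2; apply/funext => y; apply: dot_ext => z.
by rewrite dotC -h1 h2 -dotC.
Qed.

Lemma adj_comp S S' T T' : is_adjoint S S' -> is_adjoint T T' ->
  is_adjoint (S \o T) (T' \o S').
Proof. by move=> hS hT x y /=; rewrite hS hT. Qed.

Lemma adj_lin S S' : is_adjoint S S' -> linear S'.
Proof.
move=> h c x y; apply: dot_ext => z.
by rewrite dotC -h dotDr dotZr !h -dotZr -dotDr -dotC.
Qed.

Lemma nrm_le_dot y (d : R) : 0 <= d -> complex.Re (hdot H y y) <= d * nrm y ->
  nrm y <= d.
Proof.
rewrite dot_nrm /= expr2 => d0 h.
have [->|y0] := eqVneq (nrm y) 0; first by [].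
by rewrite -(ler_pM2r (x := nrm y)) // lt_def y0 nrm_ge0.
Qed.

Lemma Re_le_cnorm (c : R[i]) : complex.Re c <= cnorm c.
Proof.
rewrite /cnorm normc_def /=; apply: le_trans (ler_norm _) _.
by rewrite -sqrtr_sqr; apply: ler_wsqrtr; rewrite lerDl sqr_ge0.
Qed.

Definition opclose S T (e : R) := forall x, nrm (S x - T x) <= e * nrm x.

Lemma opclose_sym S T e : opclose S T e -> opclose T S e.
Proof. by move=> h x; rewrite nrm_distC. Qed.

Lemma opclose_tri U S T d e :
  opclose S U d -> opclose U T e -> opclose S T (d + e).
Proof.
move=> h1 h2 x; apply: le_trans (nrm_tri (U x) _ _) _.
by rewrite mulrDl lerD.
Qed.

Lemma opclose_le S T d e : d <= e -> opclose S T d -> opclose S T e.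
Proof.
by move=> de h x; apply: le_trans (h x) _; rewrite ler_wpM2r ?nrm_ge0.
Qed.

Lemma opclose_refl S e : 0 <= e -> opclose S S e.
Proof. by move=> e0 x; rewrite subrr nrm0 mulr_ge0 ?nrm_ge0. Qed.

Lemma opclose_eq S T : (forall e, 0 < e -> opclose S T e) -> S = T.
Proof.
move=> h; apply/funext => x; apply/eqP; rewrite -subr_eq0; apply/eqP/nrm_eq0.
apply/le_anti; rewrite nrm_ge0 andbT; apply/ler_addgt0Pr => e e0.
have x0 : 0 < nrm x + 1 by rewrite ltr_wpDl ?nrm_ge0.
rewrite add0r; apply: le_trans (h (e / (nrm x + 1)) (divr_gt0 _ _) x) _ => //.
by rewrite mulrAC ler_pdivrMr // ler_wpM2l ?lerDl ?(ltW e0).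
Qed.

Lemma opclose_bd S T d M : obd T M -> opclose S T d -> obd S (d + M).
Proof.
move=> bT h x; rewrite -[S x](subrK (T x)); apply: le_trans (nrmD _ _) _.
by rewrite mulrDl lerD.
Qed.

Lemma opclose_comb c P Q S T d e : opclose P S d -> opclose Q T e ->
  opclose (fun x => c *: P x + Q x) (fun x => c *: S x + T x)
    (cnorm c * d + e).
Proof.
move=> h1 h2 x.
have -> : c *: P x + Q x - (c *: S x + T x) = c *: (P x - S x) + (Q x - T x).
  by rewrite scalerBr opprD addrACA.
apply: le_trans (nrmD _ _) _; rewrite mulrDl lerD // nrmZ -mulrA.
by rewrite ler_wpM2l ?cnorm_ge0.
Qed.

Lemma opclose_comp P Q S T d MS MT : linear S -> obd S MS -> obd T MT ->
  0 <= MS -> 0 <= d ->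
  opclose P S d -> opclose Q T d -> opclose (P \o Q) (S \o T) (d * (d + (MT + MS))).
Proof.
move=> lS bS bT MS0 d0 h1 h2 x /=.
apply: le_trans (nrm_tri (S (Q x)) _ _) _.
have hQ := opclose_bd bT h2 x.
rewrite -linB // addrA mulrDr mulrDl lerD //.
  by apply: le_trans (h1 _) _; rewrite -mulrA ler_wpM2l.
apply: le_trans (bS _) _; rewrite mulrC [d * MS]mulrC -mulrA mulrC.
by rewrite ler_wpM2l.
Qed.

Lemma comp_modulus (M e : R) : 0 <= M -> 0 < e -> exists2 d, 0 < d & d * (d + M) <= e.
Proof.
move=> M0 e0; exists (Num.min 1 (e / (1 + M))).
  by rewrite lt_min ltr01 divr_gt0 // ltr_pwDl.
have M1 : 0 < 1 + M by rewrite ltr_pwDl.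
set d := Num.min _ _.
have d1 : d <= 1 by rewrite ge_min lexx.
have d2 : d <= e / (1 + M) by rewrite ge_min lexx orbT.
have d0 : 0 <= d by rewrite le_min ler01 divr_ge0 // ltW.
rewrite ler_pdivlMr // in d2; apply: le_trans d2.
by rewrite ler_wpM2l // lerD2r.
Qed.

(** An operator and its adjoint have the same norm; applied to a difference. *)
Lemma opclose_adj P P' S S' d : 0 <= d -> is_adjoint P P' -> is_adjoint S S' ->
  opclose P S d -> opclose P' S' d.
Proof.
move=> d0 hP hS h y; set z := P' y - S' y.
apply: nrm_le_dot; first by rewrite mulr_ge0 // nrm_ge0.
apply: le_trans (Re_le_cnorm _) _.
have -> : hdot H z z = hdot H (P z - S z) y by rewrite dotBl hP hS -dotBr.
apply: le_trans (Cauchy_Schwarz _ _) _.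
by rewrite mulrAC ler_wpM2r ?nrm_ge0.
Qed.

Lemma obd_opclose S M : obd S M <-> opclose S (fun=> 0) M.
Proof. by split=> h x; have := h x; rewrite subr0. Qed.

Lemma adj0 : is_adjoint (fun _ : H => 0 : H) (fun=> 0).
Proof. by move=> x y; rewrite dot0l dot0r. Qed.

Lemma adj_obd S S' M : 0 <= M -> is_adjoint S S' -> obd S M -> obd S' M.
Proof.
move=> M0 hS /obd_opclose h; apply/obd_opclose.
exact: (opclose_adj M0 hS adj0).
Qed.

Lemma adj_bop S S' : is_adjoint S S' -> bounded_operator S -> bounded_operator S'.
Proof.
move=> h /bopP[_ [M M0 hM]]; apply/bopP; split; first exact: adj_lin h.
by exists M => //; apply: adj_obd h hM.
Qed.

(** Convergence and Cauchy conditions carry real tolerances, for the same reason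
    as [nrm] is real. *)
Definition ncvg (u : nat -> H) l := forall e : R, 0 < e ->
  exists N, forall n, (N <= n)%N -> nrm (u n - l) < e.

Definition cauchy_nrm (u : nat -> H) := forall e : R, 0 < e ->
  exists N, forall m n, (N <= m)%N -> (N <= n)%N -> nrm (u m - u n) < e.

Lemma ncvg_comb c u v k l : ncvg u k -> ncvg v l ->
  ncvg (fun n => c *: u n + v n) (c *: k + l).
Proof.
move=> hu hv e e0.
have c0 : 0 < cnorm c + 1 by rewrite ltr_wpDl ?cnorm_ge0.
have [M hM] := hu (e / 2 / (cnorm c + 1)) ltac:(by rewrite !divr_gt0).
have [N hN] := hv (e / 2) ltac:(by rewrite !divr_gt0).
exists (maxn M N) => n; rewrite geq_max => /andP[/hM h1 /hN h2].
have -> : c *: u n + v n - (c *: k + l) = c *: (u n - k) + (v n - l).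
  by rewrite scalerBr opprD addrACA.
apply: le_lt_trans (nrmD _ _) _; rewrite nrmZ [e in _ < e](splitr e).
apply: ler_ltD => //.
rewrite ltr_pdivlMr // in h1; apply: le_trans (ltW h1).
by rewrite mulrC ler_wpM2l ?nrm_ge0 // lerDl.
Qed.

Lemma ncvg_unique u k l : ncvg u k -> ncvg u l -> k = l.
Proof.
move=> hk hl; apply/eqP; rewrite -subr_eq0; apply/eqP/nrm_eq0.
apply/le_anti; rewrite nrm_ge0 andbT; apply/ler_addgt0Pr => e e0; rewrite add0r.
have [M hM] := hk (e / 2) ltac:(by rewrite !divr_gt0).
have [N hN] := hl (e / 2) ltac:(by rewrite !divr_gt0).
apply: le_trans (nrm_tri (u (maxn M N)) _ _) _.
rewrite (splitr e) lerD // ?ltW //; last by apply: hN; rewrite leq_maxr.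
by rewrite nrm_distC; apply: hM; rewrite leq_maxl.
Qed.

Lemma nrm_ncvg u l y (C : R) : ncvg u l -> (exists N, forall n, (N <= n)%N -> nrm (u n - y) <= C) ->
  nrm (l - y) <= C.
Proof.
move=> hu [M hM]; apply/ler_addgt0Pr => e e0.
have [N hN] := hu e e0.
apply: le_trans (nrm_tri (u (maxn M N)) _ _) _.
rewrite addrC lerD //; first by apply: hM; rewrite leq_maxl.
by rewrite nrm_distC ltW // hN // leq_maxr.
Qed.

(** A uniformly bounded sequence of operators that is Cauchy at each vector has a
    bounded limit; no convergence in operator norm is asked for, so that this
    also applies to the partial sums of a weighted shift. *)
Lemma limit_operator (S : nat -> H -> H) (M : R) :
  (forall n, linear (S n)) -> (forall n, obd (S n) M) ->
  (forall x, cauchy_nrm (S ^~ x)) ->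
  exists L, [/\ linear L, obd L M & forall x, ncvg (S ^~ x) (L x)].
Proof.
move=> lS bS cS.
have /choice[L hL] : forall x, exists l, ncvg (S ^~ x) l.
  by move=> x; apply: complete_nrm; apply: cS.
exists L; split => //.
  move=> c x y; apply: (ncvg_unique (hL _)).
  move=> e e0; have [N hN] := ncvg_comb c (hL x) (hL y) e0.
  by exists N => n /hN; rewrite lS.
move=> x; rewrite -[L x]subr0; apply: nrm_ncvg (hL x) _.
by exists 0%N => n _; rewrite subr0; apply: bS.
Qed.

Lemma limit_adjoint (S S' : nat -> H -> H) L L' :
  (forall n, is_adjoint (S n) (S' n)) ->
  (forall x, ncvg (S ^~ x) (L x)) -> (forall x, ncvg (S' ^~ x) (L' x)) ->
  is_adjoint L L'.
Proof.
move=> hS hL hL' x y; apply/eqP; rewrite -subr_eq0; apply/eqP/cnorm_eq0.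
apply/le_anti; rewrite cnorm_ge0 andbT; apply/ler_addgt0Pr => e e0; rewrite add0r.
have x0 : 0 < nrm x + 1 by rewrite ltr_wpDl ?nrm_ge0.
have y0 : 0 < nrm y + 1 by rewrite ltr_wpDl ?nrm_ge0.
have [M hM] := hL x (e / 2 / (nrm y + 1)) ltac:(by rewrite !divr_gt0).
have [N hN] := hL' y (e / 2 / (nrm x + 1)) ltac:(by rewrite !divr_gt0).
set n := maxn M N.
have -> : hdot H (L x) y - hdot H x (L' y) =
  hdot H (L x - S n x) y + hdot H x (S' n y - L' y).
  by rewrite dotBl dotBr (hS n) addrA subrK.
apply: le_trans (cnormD _ _) _; rewrite (splitr e) lerD //.
  apply: le_trans (Cauchy_Schwarz _ _) _; rewrite nrm_distC.
  have := hM n (leq_maxl _ _); rewrite ltr_pdivlMr // => h; apply: le_trans (ltW h).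
  by rewrite ler_wpM2l ?nrm_ge0 // lerDl.
apply: le_trans (Cauchy_Schwarz _ _) _; rewrite mulrC.
have := hN n (leq_maxr _ _); rewrite ltr_pdivlMr // => h; apply: le_trans (ltW h).
by rewrite ler_wpM2l ?nrm_ge0 // lerDl.
Qed.

(** Completeness of B(H) for the operator norm, with an explicit modulus r. *)
Lemma limit_opclose (S : nat -> H -> H) (r : nat -> R) :
  (forall n, bounded_operator (S n)) ->
  (forall n, 0 <= r n) -> (forall e, 0 < e -> exists n, r n < e) ->
  (forall n m, (n <= m)%N -> opclose (S m) (S n) (r n)) ->
  exists L, bounded_operator L /\ forall n, opclose L (S n) (r n).
Proof.
move=> bS rge0 r0 hS.
have /bopP[l0 [M M0 hM]] := bS 0%N.
have [|//|x e e0|L [lL bL cL]] := @limit_operator S (r 0%N + M).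
- by move=> n; case: (bS n).
- by move=> n; apply: opclose_bd hM _; apply: hS.
- have x0 : 0 < nrm x + 1 by rewrite ltr_wpDl ?nrm_ge0.
  have [N hN] := r0 (e / 2 / (nrm x + 1)) ltac:(by rewrite !divr_gt0).
  have hk k : (N <= k)%N -> nrm (S k x - S N x) < e / 2.
    move=> Nk; apply: le_lt_trans (hS _ _ Nk x) _.
    rewrite ltr_pdivlMr // in hN; apply: le_lt_trans hN.
    by rewrite ler_wpM2l // lerDl.
  exists N => m n Nm Nn; apply: le_lt_trans (nrm_tri (S N x) _ _) _.
  rewrite (splitr e) ltrD ?hk // nrm_distC; exact: hk.
exists L; split.
  by apply/bopP; split=> //; exists (r 0%N + M) => //; apply: addr_ge0.
move=> n x; apply: nrm_ncvg (cL x) _; exists n => m nm; exact: hS.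
Qed.

End Operators.

(** * *-Polynomials and the C*-algebra they generate *)

Section StarPolynomials.
Context {R : realType}.

(** Letters of a word: true stands for the operator, false for its adjoint. *)
Definition spoly := seq (R[i] * seq bool).

Definition pmul (p q : spoly) : spoly :=
  flatten [seq [seq (s.1 * t.1, s.2 ++ t.2) | t <- q] | s <- p].
Definition pscale (c : R[i]) (p : spoly) : spoly := [seq (c * t.1, t.2) | t <- p].
Definition padj (p : spoly) : spoly :=
  [seq (Num.conj t.1, rev (map negb t.2)) | t <- p].
Definition pvar : spoly := [:: (1, [:: true])].
Definition pone : spoly := [:: (1, [::])].

Section Eval.
Context {H : hilbertType R}.
Variables A A' : H -> H.

Fixpoint wev (m : seq bool) : H -> H :=
  if m is b :: m' then (if b then A else A') \o wev m' else id.

Definition ev (p : spoly) (x : H) : H := \sum_(t <- p) t.1 *: wev t.2 x.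

Lemma ev_nil : ev [::] = fun=> 0.
Proof. by apply/funext => x; rewrite /ev big_nil. Qed.

Lemma ev_cons t p : ev (t :: p) = fun x => t.1 *: wev t.2 x + ev p x.
Proof. by apply/funext => x; rewrite /ev big_cons. Qed.

Lemma ev_cat p q x : ev (p ++ q) x = ev p x + ev q x.
Proof. by rewrite /ev big_cat. Qed.

Lemma ev_pscale c p x : ev (pscale c p) x = c *: ev p x.
Proof.
rewrite /ev big_map scaler_sumr; apply: eq_bigr => t _ /=.
by rewrite scalerA.
Qed.

Lemma ev_pvar : ev pvar = A.
Proof. by apply/funext => x; rewrite /ev big_seq1 /= scale1r. Qed.

Lemma ev_pone : ev pone = id.
Proof. by apply/funext => x; rewrite /ev big_seq1 /= scale1r. Qed.

Lemma wev_cat m m' : wev (m ++ m') = wev m \o wev m'.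
Proof. by elim: m => //= b m ->. Qed.

Hypotheses (bA : bounded_operator A) (hA : is_adjoint A A').

Lemma bop_letter (b : bool) : bounded_operator (if b then A else A').
Proof. by case: b => //; apply: adj_bop hA bA. Qed.

Lemma wev_bop m : bounded_operator (wev m).
Proof.
by elim: m => [|b m IH] /=; [exact: bop_id | apply: bop_comp; first exact: bop_letter].
Qed.

Lemma ev_bop p : bounded_operator (ev p).
Proof.
elim: p => [|t p IH]; first by rewrite ev_nil; exact: bop0.
by rewrite ev_cons; apply: bop_comb => //; exact: wev_bop.
Qed.

Lemma ev_pmul p q : ev (pmul p q) = ev p \o ev q.
Proof.
apply/funext => x; elim: p => [|s p IH] /=; first by rewrite /ev !big_nil.
have -> : pmul (s :: p) q = [seq (s.1 * t.1, s.2 ++ t.2) | t <- q] ++ pmul p q by [].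
rewrite ev_cat IH /= [in RHS]ev_cons; congr (_ + _).
rewrite /ev big_map (lin_sum _ _ (bop_lin (wev_bop _))) scaler_sumr.
apply: eq_bigr => t _ /=.
by rewrite wev_cat (linZ _ _ (bop_lin (wev_bop _))) scalerA.
Qed.

Lemma wev_adj m : is_adjoint (wev m) (wev (rev (map negb m))).
Proof.
elim: m => [|b m IH] //=; rewrite rev_cons -cats1 wev_cat.
by apply: adj_comp => //=; case: (b) => //=; apply: adj_sym.
Qed.

Lemma ev_padj p : is_adjoint (ev p) (ev (padj p)).
Proof.
move=> x y; elim: p => [|t p IH]; first by rewrite !ev_nil dot0l dot0r.
rewrite /padj /= !ev_cons dotDl dotDr IH dotZl dotZr conjCK.
by rewrite wev_adj.
Qed.

Definition polyclosure : set (H -> H) :=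
  [set S | bounded_operator S /\ forall e, 0 < e -> exists p, opclose (ev p) S e].

Lemma polyclosure_ev p : polyclosure (ev p).
Proof.
split; first exact: ev_bop.
by move=> e e0; exists p; apply: opclose_refl; exact: ltW.
Qed.

(** The C*-operations are continuous for the operator norm, so they pass from the
    *-polynomials to their limits. *)
Lemma polyclosure_cstar : cstar_subalgebra polyclosure.
Proof.
split; first split.
- by move=> S [].
- by rewrite -ev_pone; exact: polyclosure_ev.
- move=> c S T [bS hS] [bT hT]; split; first exact: bop_comb.
  move=> e e0.
  have c0 : 0 < cnorm c + 1 by rewrite ltr_wpDl ?cnorm_ge0.
  have [p hp] := hS (e / 2 / (cnorm c + 1)) ltac:(by rewrite !divr_gt0).
  have [q hq] := hT (e / 2) ltac:(by rewrite !divr_gt0).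
  exists (pscale c p ++ q).
  have -> : ev (pscale c p ++ q) = (fun x => c *: ev p x + ev q x).
    by apply/funext => x; rewrite ev_cat ev_pscale.
  apply: opclose_le (opclose_comb c hp hq).
  rewrite [leRHS](splitr e) lerD2r mulrCA ger_pMr ?divr_gt0 //.
  by rewrite ler_pdivrMr // mul1r lerDl.
- move=> S T [bS hS] [bT hT]; split; first exact: bop_comp.
  move=> e e0; have /bopP[lS [M M0 hM]] := bS; have /bopP[lT [N N0 hN]] := bT.
  have [d d0 hd] := comp_modulus (addr_ge0 N0 M0) e0.
  have [p hp] := hS _ d0; have [q hq] := hT _ d0.
  exists (pmul p q); rewrite ev_pmul; apply: opclose_le hd _.
  exact: (opclose_comp lS hM hN M0 (ltW d0) hp hq).
- split.
    move=> S S' [bS hS] hSS'; split; first exact: adj_bop hSS' bS.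
    move=> e e0; have [p hp] := hS e e0; exists (padj p).
    by apply: (opclose_adj (ltW e0) _ hSS' hp); exact: ev_padj.
  move=> T bT hT; split=> // e e0.
  have [S [bS hS] hST] := hT (e / 2) ltac:(by rewrite !divr_gt0).
  have [p hp] := hS (e / 2) ltac:(by rewrite !divr_gt0).
  exists p; rewrite (splitr e); apply: opclose_tri hp _.
  by move=> x; rewrite -le_complex_nrm.
Qed.

Lemma cstar_word (B : set (H -> H)) m : cstar_subalgebra B -> B A -> B (wev m).
Proof.
move=> [[_ B1 _ BM] [BA _]] hB; elim: m => [|b m IH] //=.
by apply: BM IH; case: b => //; apply: BA hA.
Qed.

Lemma cstar_ev (B : set (H -> H)) p : cstar_subalgebra B -> B A -> B (ev p).
Proof.
move=> cB hB; elim: p => [|t p IH].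
  have [[_ B1 BD _] _] := cB.
  have := BD (-1) _ _ B1 B1; congr B; apply/funext => x.
  by rewrite ev_nil scaleN1r addNr.
by rewrite ev_cons; case: (cB) => -[_ _ BD _] _; apply: BD => //; apply: cstar_word.
Qed.

(** Gives access to the elements of the C*-algebra, which is defined as an
    intersection, as limits of *-polynomials. *)
Lemma cstar_generatedE : cstar_generated A = polyclosure.
Proof.
apply/seteqP; split.
  apply: smallest_sub; first exact: polyclosure_cstar.
  by move=> _ ->; rewrite -ev_pvar; exact: polyclosure_ev.
move=> S [bS hS] B [cB hB]; case: (cB) => _ [_]; apply => // e e0.
have [p hp] := hS e e0; exists (ev p); first by apply: cstar_ev => //; apply: hB.
by move=> x; rewrite le_complex_nrm.
Qed.

End Eval.
End StarPolynomials.

(** * Isomorphisms of C*-algebras are isometric *)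

Section Neumann.
Context {R : realType} {H : hilbertType R}.

(** The series sum_k (mu^-1 S^*S)^k converges in operator norm to the inverse of
    1 - mu^-1 S^*S and its partial sums belong to every C*-algebra containing S. *)
Lemma neumann (B : set (H -> H)) S S' (m mu : R) : cstar_subalgebra B -> B S ->
  is_adjoint S S' -> 0 <= m -> obd S m -> m ^+ 2 < mu ->
  exists2 V, B V & V \o (fun x => (- mu^-1)%:C *: S' (S x) + x) = id.
Proof.
move=> [[Bb B1 Bc BM] [Badj Bcl]] BS hS m0 hm mmu.
have mu0 : 0 < mu by apply: le_lt_trans mmu; exact: sqr_ge0.
have BS' := Badj _ _ BS hS.
pose c : R[i] := (mu^-1)%:C; pose h := S' \o S.
have Bh : B h by exact: BM.
have hh : obd h (m ^+ 2).
  move=> x; apply: le_trans (adj_obd m0 hS hm _) _.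
  by rewrite expr2 -mulrA ler_wpM2l.
(* partial sums of the Neumann series, in Horner form *)
pose V := fix V n : H -> H := if n is k.+1 then (fun x => c *: (V k \o h) x + id x)
   else id.
have BV n : B (V n) by elim: n => [|n IH]; [exact: B1 | apply: Bc => //; exact: BM].
pose r := m ^+ 2 / mu.
have r0 : 0 <= r by rewrite divr_ge0 ?sqr_ge0 // ltW.
have r1 : r < 1 by rewrite ltr_pdivrMr // mul1r.
have cm x : cnorm c * nrm (h x) <= r * nrm x.
  rewrite cnorm_real ger0_norm ?invr_ge0 ?(ltW mu0) // /r [_ / mu]mulrC -mulrA.
  by rewrite ler_wpM2l ?hh // invr_ge0 (ltW mu0).
have step n : opclose (V n.+1) (V n) (r ^+ n.+1).
  elim: n => [|n IH] x /=.
    by rewrite addrK nrmZ expr1.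
  have -> : c *: (c *: V n (h (h x)) + h x) + x - (c *: V n (h x) + x) =
      c *: (V n.+1 (h x) - V n (h x)).
    by rewrite scalerBr /= opprD addrACA subrr addr0.
  rewrite nrmZ; apply: le_trans (_ : cnorm c * (r ^+ n.+1 * nrm (h x)) <= _).
    by rewrite ler_wpM2l ?cnorm_ge0 //; exact: IH.
  by rewrite mulrCA [in leRHS]exprSr -mulrA ler_wpM2l ?exprn_ge0.
pose q n : R := r ^+ n.+1 / (1 - r).
have r1' : 0 < 1 - r by rewrite subr_gt0.
have q0 n : 0 <= q n by rewrite divr_ge0 ?exprn_ge0 // ltW.
have hq n m' : (n <= m')%N -> opclose (V m') (V n) (q n).
  move=> nm; have [k ->] : exists k, m' = (k + n)%N by exists (m' - n)%N; rewrite subnK.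
  elim: k n {nm} => [|k IH] n; first exact: opclose_refl.
  rewrite addSnnS.
  have -> : q n = q n.+1 + r ^+ n.+1.
    rewrite /q [in RHS]exprS -[X in _ = _ + X](mulfK (lt0r_neq0 r1')) -mulrDl.
    by congr (_ / _); ring.
  exact: opclose_tri (IH _) (step n).
have qlim e : 0 < e -> exists n, q n < e.
  move=> e0.
  have /cvgrPdist_lt /(_ (e * (1 - r)) ltac:(by rewrite mulr_gt0)) [N _ hN] :=
    @cvg_expr R r ltac:(by rewrite ger0_norm).
  exists N; have := hN N.+1 (leqnSn _); rewrite sub0r normrN ger0_norm ?exprn_ge0 //.
  by rewrite /q ltr_pdivrMr.
have [L [bL hL]] := limit_opclose (fun n => Bb _ (BV n)) q0 qlim hq.
exists L.
  apply: Bcl => // e e0; have [n hn] := qlim e e0.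
  exists (V n) => // x; rewrite le_complex_nrm.
  by apply: opclose_sym; apply: opclose_le (hL n); exact: ltW.
have oc : (- mu^-1)%:C = - c by rewrite rmorphN.
apply: opclose_eq => e e0 x /=; set y := _ + x.
have hy : nrm y <= (r + 1) * nrm x.
  apply: le_trans (nrmD _ _) _; rewrite mulrDl mul1r lerD2r oc nrmZ.
  rewrite -mulN1r cnormM -(rmorphN1 (real_complex R)) cnorm_real normrN1 mul1r.
  exact: cm.
have r2 : 0 < r + 1 + 1 by lra.
have [n hn] := qlim (e / (r + 1 + 1)) (divr_gt0 e0 r2).
have lV : linear (V n) by apply: bop_lin; exact: Bb.
have hV : V n y - x = - (V n.+1 x - V n x).
  rewrite /y oc linD // linZ //= scaleNr /h /=.
  by rewrite !opprD opprK addrAC.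
have qr : r ^+ n.+1 <= q n.
  by rewrite /q ler_pdivlMr // ler_piMr ?exprn_ge0 // gerBl.
apply: le_trans (nrm_tri (V n y) _ _) _.
apply: le_trans (_ : q n * ((r + 1) * nrm x) + q n * nrm x <= _).
  rewrite lerD //; first by apply: le_trans (hL n y) _; rewrite ler_wpM2l.
  by rewrite hV nrmN; apply: le_trans (step n x) _; rewrite ler_wpM2r ?nrm_ge0.
rewrite -mulrDr -[X in _ + X]mul1r -mulrDl mulrA ler_wpM2r ?nrm_ge0 //.
by rewrite -ler_pdivlMr // ltW.
Qed.

End Neumann.

Section OperatorNorm.
Context {R : realType} {H : hilbertType R}.

Lemma obd_le (S : H -> H) M N : M <= N -> obd S M -> obd S N.
Proof.
by move=> MN h x; apply: le_trans (h x) _; rewrite ler_wpM2r ?nrm_ge0.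
Qed.

Lemma obd_lim (S : H -> H) M : (forall e : R, 0 < e -> obd S (M + e)) -> obd S M.
Proof.
move=> h x; apply/ler_addgt0Pr => e e0.
have x0 : 0 < nrm x + 1 by rewrite ltr_wpDl ?nrm_ge0.
apply: le_trans (h _ (divr_gt0 e0 x0) x) _.
rewrite mulrDl lerD2l mulrAC ler_pdivrMr // ler_wpM2l ?lerDl //.
exact: ltW.
Qed.

Lemma opnorm_exists (Q : H -> H) : bounded_operator Q ->
  exists N : R, [/\ 0 <= N, obd Q N & forall M, 0 <= M -> obd Q M -> N <= M].
Proof.
move=> /bopP[_ [M0 hM0 bM0]].
pose E := [set M : R | 0 <= M /\ obd Q M].
have iE : has_inf E by split; [exists M0 | exists 0 => M []].
exists (inf E); split.
- by apply: lb_le_inf; [exists M0 | move=> M []].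
- apply: obd_lim => e e0.
  have [M [_ hM] Mlt] := inf_adherent e0 iE.
  exact: obd_le (ltW Mlt) hM.
- by move=> M m0 hM; apply: ge_inf => //; case: iE.
Qed.

(** There are unit vectors y with |Q y| close to the norm N of Q; on them Q^*Q y is
    close to N^2 y, so 1 - N^-2 Q^*Q is not bounded below. *)
Lemma norm_no_inverse (Q Q' V : H -> H) (N : R) : bounded_operator V ->
  is_adjoint Q Q' -> 0 < N -> obd Q N -> (forall M, 0 <= M -> obd Q M -> N <= M) ->
  V \o (fun x => (- (N ^+ 2)^-1)%:C *: Q' (Q x) + x) = id -> False.
Proof.
move=> /bopP[_ [c c0 hc]] hQ N0 hN Nmin hV.
have N2 : 0 < N ^+ 2 by exact: exprn_gt0.
have c1 : 0 < (c + 1) ^+ 2 by rewrite exprn_gt0 // ltr_wpDl.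
pose k : R := 1 - ((c + 1) ^+ 2)^-1.
have k1 : k < 1 by rewrite gtrBl invr_gt0.
have k0 : 0 <= k by rewrite subr_ge0 invf_le1 // exprn_ege1 // lerDr.
(* a left inverse of norm at most c bounds |Q y|^2 by N^2 k |y|^2, and k < 1 *)
have : N <= N * Num.sqrt k.
  apply: Nmin; first by rewrite mulr_ge0 ?sqrtr_ge0 // ltW.
  move=> y; pose a : R := - (N ^+ 2)^-1.
  set z := a%:C *: Q' (Q y) + y.
  have hy : nrm y <= (c + 1) * nrm z.
    have -> : y = V z by rewrite -[LHS]/(id y) -hV.
    apply: le_trans (hc z) _; first by rewrite ler_wpM2r ?nrm_ge0 // lerDl.
  have aC : Num.conj (a%:C) = a%:C :> R[i].
    by apply: conj_Creal; apply/complex_realP; eexists.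
  have nz : nrm z ^+ 2 = a ^+ 2 * nrm (Q' (Q y)) ^+ 2 + 2 * a * nrm (Q y) ^+ 2 + nrm y ^+ 2.
    apply: (@complexI R); rewrite -dot_nrm /z dotDl !dotDr !dotZl !dotZr aC.
    have hyw : hdot H y (Q' (Q y)) = (nrm (Q y) ^+ 2)%:C by rewrite -hQ dot_nrm.
    rewrite (dotC y) hyw dot_nrm conj_Creal; last by apply/complex_realP; eexists.
    rewrite (dot_nrm y) !expr2 !rmorphD /= !rmorphM /= rmorphD /= rmorph1; ring.
  have hw : nrm (Q' (Q y)) ^+ 2 <= N ^+ 2 * nrm (Q y) ^+ 2.
    rewrite -exprMn ler_pXn2r ?nnegrE ?mulr_ge0 ?nrm_ge0 ?(ltW N0) //.
    exact: (adj_obd (ltW N0) hQ hN).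
  have hz : nrm z ^+ 2 <= nrm y ^+ 2 - (N ^+ 2)^-1 * nrm (Q y) ^+ 2.
    rewrite nz.
    have : a ^+ 2 * nrm (Q' (Q y)) ^+ 2 <= a ^+ 2 * (N ^+ 2 * nrm (Q y) ^+ 2).
      by rewrite ler_wpM2l ?sqr_ge0.
    have -> : a ^+ 2 * (N ^+ 2 * nrm (Q y) ^+ 2) = (N ^+ 2)^-1 * nrm (Q y) ^+ 2.
      by rewrite /a; field; rewrite gt_eqF.
    by rewrite /a; lra.
  rewrite -(@ler_pXn2r _ 2) ?nnegrE ?mulr_ge0 ?nrm_ge0 ?sqrtr_ge0 ?(ltW N0) //.
  rewrite !exprMn sqr_sqrtr // -mulrA -ler_pdivrMl //.
  have hy2 : ((c + 1) ^+ 2)^-1 * nrm y ^+ 2 <= nrm z ^+ 2.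
    rewrite ler_pdivrMl // -exprMn ler_pXn2r ?nnegrE ?mulr_ge0 ?nrm_ge0 //.
    by rewrite addr_ge0.
  by rewrite /k mulrBl mul1r; lra.
rewrite -[leLHS]mulr1 ler_pM2l // leNgt => /negP; apply.
by rewrite -[ltRHS]sqrtr1 ltr_sqrt.
Qed.

End OperatorNorm.

(** If left invertibility of 1 - mu^-1 S^*S passes from S to Q, then the norm of Q
    is at most the norm of S.  Stated for two arbitrary operators because it is
    applied to an isomorphism and to its inverse. *)
Lemma obd_transfer (R : realType) (H K : hilbertType R) (B : set (H -> H)) (S S' : H -> H) (Q Q' : K -> K) (m : R) :
  cstar_subalgebra B -> B S -> is_adjoint S S' ->
  bounded_operator Q -> is_adjoint Q Q' ->
  (forall mu : R, forall V, B V -> V \o (fun x => (- mu^-1)%:C *: S' (S x) + x) = id ->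
     exists2 W, bounded_operator W &
       W \o (fun x => (- mu^-1)%:C *: Q' (Q x) + x) = id) ->
  0 <= m -> obd S m -> obd Q m.
Proof.
move=> cB BS hS bQ hQ tr m0 hm.
have [N [N0 hN Nmin]] := opnorm_exists bQ.
have [Nm|mN] := leP N m; first exact: obd_le hN.
have [V BV hV] : exists2 V, B V &
    V \o (fun x => (- (N ^+ 2)^-1)%:C *: S' (S x) + x) = id.
  apply: neumann hm _ => //; rewrite ltr_pXn2r ?nnegrE //.
have [W bW hW] := tr _ _ BV hV.
exfalso; apply: norm_no_inverse hW => //.
exact: le_lt_trans mN.
Qed.

Section Equivalence.
Context {R : realType} {H K : hilbertType R}.

Variables (A A' : H -> H) (B B' : K -> K).
Hypotheses (bA : bounded_operator A) (hA : is_adjoint A A').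
Hypotheses (bB : bounded_operator B) (hB : is_adjoint B B').

(** Isomorphisms preserve the *-polynomials and the invertibility of
    1 - mu^-1 S^*S. *)
Lemma equiv_isometric : algebraically_equivalent A B ->
  forall p m, 0 <= m -> obd (ev A A' p) m <-> obd (ev B B' p) m.
Proof.
case=> phi [[phiF phiI phiS] phiL phiM phiA phiAB] p m m0.
have cA := polyclosure_cstar bA hA; have cB := polyclosure_cstar bB hB.
rewrite !(cstar_generatedE bA hA) in phiF phiI phiS phiL phiM phiA.
rewrite !(cstar_generatedE bB hB) in phiF phiS.
have PA q := polyclosure_ev bA hA q.
have PB q := polyclosure_ev bB hB q.
have PvA : polyclosure A A' A by have := PA pvar; rewrite ev_pvar.
have P1 : polyclosure A A' id by rewrite -(ev_pone A A').
have phi1 : phi id = id.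
  have [S PS hS] := phiS id ltac:(by rewrite -(ev_pone B B'); exact: PB).
  by rewrite -[LHS]/(phi id \o id) -hS -phiM.
have phiA' : phi A' = B'.
  apply: adj_unique hB; rewrite -phiAB; exact: phiA.
have Pw w : polyclosure A A' (wev A A' w).
  by apply: (cstar_word hA).
have phiw w : phi (wev A A' w) = wev B B' w.
  elim: w => [|b w IH] //=.
  rewrite phiM //; first by rewrite IH; case: b; rewrite ?phiAB ?phiA'.
  case: b => //.
  by have := Pw [:: false].
have P0 : polyclosure A A' (fun=> 0) by rewrite -(ev_nil A A').
have phi0 : phi (fun=> 0) = fun=> 0.
  have := phiL (-1) id id P1 P1; rewrite phi1.
  have -> : (fun x => -1 *: id x + id x) = (fun=> 0 : H).
    by apply/funext => x; rewrite scaleN1r addNr.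
  by move=> ->; apply/funext => x; rewrite scaleN1r addNr.
have phip q : phi (ev A A' q) = ev B B' q.
  elim: q => [|t q IH]; first by rewrite !ev_nil.
  by rewrite !ev_cons phiL // IH phiw.
set S := ev A A' p; set S' := ev A A' (padj p).
have hS : is_adjoint S S' := ev_padj hA p.
have hQ : is_adjoint (ev B B' p) (ev B B' (padj p)) := ev_padj hB p.
have phie (c : R[i]) : phi (fun x => c *: S' (S x) + x) =
    fun y => c *: ev B B' (padj p) (ev B B' p y) + y.
  have := phiL c (S' \o S) id; rewrite phi1 phiM; try exact: PA.
  by rewrite !phip => -> //; rewrite -(ev_pmul bA hA).
have PE (c : R[i]) : polyclosure A A' (fun x => c *: S' (S x) + x).
  case: cA => -[_ _ Pc _] _; apply: (Pc c (S' \o S) id) => //.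
  by rewrite -(ev_pmul bA hA).
split.
  apply: (obd_transfer cA (PA p) hS (ev_bop bB hB p) hQ) => //.
  move=> mu V PV hV; exists (phi V); first by case: (phiF _ PV).
  by rewrite -phie -phiM // hV phi1.
apply: (obd_transfer cB (PB p) hQ (ev_bop bA hA p) hS) => //.
move=> mu V PV hV.
have [W PW hW] := phiS V PV; exists W; first by case: PW.
apply: phiI; rewrite ?inE //.
  by case: cA => -[_ _ _ PM] _; apply: (PM W).
by rewrite phiM // hW phie phi1.
Qed.

End Equivalence.

(** * Isometric correspondences extend to C*-algebras *)

Lemma opclose_lim (R : realType) (H : hilbertType R) (S T : H -> H) d :
  (forall e, 0 < e -> opclose S T (d + e)) -> opclose S T d.
Proof. exact: (@obd_lim _ _ (fun x => S x - T x)). Qed.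

Section Limits.
Context {R : realType} {H K : hilbertType R}.
Variables (A A' : H -> H) (B B' : K -> K).
Hypotheses (bA : bounded_operator A) (hA : is_adjoint A A').
Hypotheses (bB : bounded_operator B) (hB : is_adjoint B B').

(** The graph of the isomorphism to be constructed: the same *-polynomials
    approximate S and T.  The relation is symmetric in A and B, so bijectivity
    follows from existence and uniqueness. *)
Definition joint_limit (S : H -> H) (T : K -> K) :=
  [/\ polyclosure A A' S, polyclosure B B' T &
      forall e : R, 0 < e -> exists p, opclose (ev A A' p) S e /\ opclose (ev B B' p) T e].

Hypothesis iso : forall p m, 0 <= m -> obd (ev A A' p) m -> obd (ev B B' p) m.

Lemma ev_sub_obd (L : hilbertType R) (D D' : L -> L) p q e :
  opclose (ev D D' p) (ev D D' q) e <-> obd (ev D D' (p ++ pscale (-1) q)) e.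
Proof. by split=> h x; have := h x; rewrite ev_cat ev_pscale scaleN1r. Qed.

Lemma iso_opclose p q e : 0 <= e ->
  opclose (ev A A' p) (ev A A' q) e -> opclose (ev B B' p) (ev B B' q) e.
Proof. by move=> e0 /ev_sub_obd h; apply/ev_sub_obd; apply: iso. Qed.

Lemma joint_limit_exists S : polyclosure A A' S -> exists T, joint_limit S T.
Proof.
move=> PS; have [bS hS] := PS.
have /choice[p hp] : forall n : nat, exists p, opclose (ev A A' p) S n.+1%:R^-1.
  by move=> n; apply: hS; rewrite invr_gt0.
pose r n : R := n.+1%:R^-1 + n.+1%:R^-1.
have r0 n : 0 <= r n by rewrite addr_ge0 // invr_ge0.
have pe n m : (n <= m)%N -> opclose (ev A A' (p m)) S n.+1%:R^-1.
  by move=> nm; apply: opclose_le (hp m); rewrite lef_pV2 ?posrE // ler_nat.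
have rlim (e : R) : 0 < e -> exists n, n.+1%:R^-1 <= e / 2 :> R.
  move=> e0; have e2 : 0 < e / 2 by lra.
  by have [n hn] := ltr_add_invr e2; exists n; rewrite add0r in hn; exact: ltW.
have bE n : bounded_operator (ev B B' (p n)) by exact: ev_bop.
have rl (e : R) : 0 < e -> exists n, r n < e.
  move=> e0; have e2 : 0 < e / 2 by lra.
  have [n hn] := rlim _ e2; exists n; rewrite /r; move: hn; set x := _^-1 => hn; lra.
have hE n m : (n <= m)%N -> opclose (ev B B' (p m)) (ev B B' (p n)) (r n).
  move=> nm; apply: iso_opclose => //.
  by apply: opclose_tri (pe _ _ nm) _; apply: opclose_sym; exact: pe.
have [T [bT hT]] := limit_opclose bE r0 rl hE.
exists T.
have he (e : R) : 0 < e -> exists p, opclose (ev A A' p) S e /\ opclose (ev B B' p) T e.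
  move=> e0; have [n hn] := rlim e e0; exists (p n); split.
    by apply: opclose_le (hp n); apply: le_trans hn _; lra.
  by apply: opclose_sym; apply: opclose_le (hT n); rewrite /r [leRHS](splitr e) lerD.
split=> //; split=> // e e0; have [q [_ hq]] := he e e0; by exists q.
Qed.

(** The approximation of T can be tested on any *-polynomial that approximates S;
    uniqueness and compatibility with adjoints both reduce to this. *)
Lemma joint_limit_close S T p d : joint_limit S T -> 0 <= d ->
  opclose (ev A A' p) S d -> opclose (ev B B' p) T d.
Proof.
move=> [_ _ h] d0 hp; apply: opclose_lim => e e0.
have [q [qS qT]] := h (e / 2) ltac:(by rewrite divr_gt0).
rewrite [e in d + e](splitr e) addrA; apply: opclose_tri qT.
apply: iso_opclose; first by rewrite addr_ge0 // divr_ge0 // ltW.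
by apply: opclose_tri hp _; exact: opclose_sym.
Qed.

Lemma joint_limit_unique S T T' : joint_limit S T -> joint_limit S T' -> T = T'.
Proof.
move=> hT hT'; apply: opclose_eq => e e0.
have [_ _ h] := hT; have [q [qS qT]] := h (e / 2) ltac:(by rewrite divr_gt0).
rewrite (splitr e); apply: opclose_tri (opclose_sym qT) _.
by apply: joint_limit_close qS => //; rewrite divr_ge0 // ltW.
Qed.

Lemma joint_limit_ev p : joint_limit (ev A A' p) (ev B B' p).
Proof.
split; [exact: polyclosure_ev | exact: polyclosure_ev |] => e e0.
by exists p; split; apply: opclose_refl; exact: ltW.
Qed.

Lemma joint_limit_comb c S T S1 T1 : joint_limit S T -> joint_limit S1 T1 ->
  joint_limit (fun x => c *: S x + S1 x) (fun x => c *: T x + T1 x).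
Proof.
move=> [PS PT h] [PS1 PT1 h1]; split.
- by case: (polyclosure_cstar bA hA) => -[_ _ Pc _] _; apply: Pc.
- by case: (polyclosure_cstar bB hB) => -[_ _ Pc _] _; apply: Pc.
move=> e e0.
have c0 : 0 < cnorm c + 1 by rewrite ltr_wpDl ?cnorm_ge0.
have [p [pS pT]] := h (e / 2 / (cnorm c + 1)) ltac:(by rewrite !divr_gt0).
have [q [qS qT]] := h1 (e / 2) ltac:(by rewrite !divr_gt0).
have E (L : hilbertType R) (D D' : L -> L) :
    ev D D' (pscale c p ++ q) = (fun x => c *: ev D D' p x + ev D D' q x).
  by apply/funext => x; rewrite ev_cat ev_pscale.
have le_e : cnorm c * (e / 2 / (cnorm c + 1)) + e / 2 <= e.
  rewrite [leRHS](splitr e) lerD2r mulrCA ger_pMr ?divr_gt0 //.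
  by rewrite ler_pdivrMr // mul1r lerDl.
by exists (pscale c p ++ q); split; rewrite E; apply: opclose_le le_e _; apply: opclose_comb.
Qed.

Lemma joint_limit_comp S T S1 T1 : joint_limit S T -> joint_limit S1 T1 ->
  joint_limit (S \o S1) (T \o T1).
Proof.
move=> [PS PT h] [PS1 PT1 h1]; split.
- by case: (polyclosure_cstar bA hA) => -[_ _ _ PM] _; apply: PM.
- by case: (polyclosure_cstar bB hB) => -[_ _ _ PM] _; apply: PM.
move=> e e0.
have /bopP[lS [M M0 hM]] := PS.1; have /bopP[lT [N N0 hN]] := PT.1.
have /bopP[_ [M1 M10 hM1]] := PS1.1; have /bopP[_ [N1 N10 hN1]] := PT1.1.
have [d d0 hd] := comp_modulus (addr_ge0 (addr_ge0 M10 M0) (addr_ge0 N10 N0)) e0.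
have d0' := ltW d0.
have [p [pS pT]] := h _ d0; have [q [qS qT]] := h1 _ d0.
exists (pmul p q); rewrite !ev_pmul //; split.
  apply: opclose_le (opclose_comp lS hM hM1 M0 d0' pS qS).
  by apply: le_trans hd; rewrite ler_wpM2l // lerD2l lerDl addr_ge0.
apply: opclose_le (opclose_comp lT hN hN1 N0 d0' pT qT).
by apply: le_trans hd; rewrite ler_wpM2l // lerD2l lerDr addr_ge0.
Qed.

Lemma joint_limit_adj S T S' T' : joint_limit S T -> joint_limit S' T' ->
  is_adjoint S S' -> is_adjoint T T'.
Proof.
move=> [_ _ h] hS' SS' x y; apply/eqP; rewrite -subr_eq0; apply/eqP/cnorm_eq0.
apply/le_anti; rewrite cnorm_ge0 andbT; apply/ler_addgt0Pr => e e0; rewrite add0r.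
pose c := nrm x * nrm y + 1.
have c0 : 0 < c by rewrite ltr_wpDl // mulr_ge0 ?nrm_ge0.
have d0 : 0 < e / 2 / c by rewrite !divr_gt0.
have [p [pS pT]] := h _ d0.
have pT' : opclose (ev B B' (padj p)) T' (e / 2 / c).
  apply: (joint_limit_close hS' (ltW d0)).
  exact: (opclose_adj (ltW d0) (ev_padj hA p) SS' pS).
have -> : hdot K (T x) y - hdot K x (T' y) =
    - hdot K (ev B B' p x - T x) y + hdot K x (ev B B' (padj p) y - T' y).
  by rewrite dotBl dotBr (ev_padj hB) opprB addrA subrK.
have cN z : cnorm (- z) = cnorm z :> R by rewrite /cnorm normrN.
apply: le_trans (cnormD _ _) _; rewrite cN (splitr e).
have hc : e / 2 / c * (nrm x * nrm y) <= e / 2.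
  rewrite mulrAC ler_pdivrMr // ler_wpM2l ?lerDl // divr_ge0 //; exact: ltW.
apply: lerD.
  apply: le_trans (Cauchy_Schwarz _ _) _; apply: le_trans hc.
  by rewrite mulrA ler_wpM2r ?nrm_ge0.
apply: le_trans (Cauchy_Schwarz _ _) _; apply: le_trans hc.
by rewrite mulrCA ler_wpM2l ?nrm_ge0.
Qed.

End Limits.

Lemma joint_limit_swap (R : realType) (H K : hilbertType R) (A A' : H -> H) (B B' : K -> K) S T :
  joint_limit A A' B B' S T -> joint_limit B B' A A' T S.
Proof.
move=> [PS PT h]; split => // e e0; have [p [h1 h2]] := h e e0; by exists p.
Qed.

Section IsometricEquivalence.
Context {R : realType} {H K : hilbertType R}.
Variables (A A' : H -> H) (B B' : K -> K).
Hypotheses (bA : bounded_operator A) (hA : is_adjoint A A').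
Hypotheses (bB : bounded_operator B) (hB : is_adjoint B B').

(** The isomorphism is the extension of p(A, A^* ) |-> p(B, B^* ) to the closures. *)
Lemma isometric_equiv :
  (forall p m, 0 <= m -> obd (ev A A' p) m <-> obd (ev B B' p) m) ->
  algebraically_equivalent A B.
Proof.
move=> iso.
have iso1 p m : 0 <= m -> obd (ev A A' p) m -> obd (ev B B' p) m by move=> /iso->.
have iso2 p m : 0 <= m -> obd (ev B B' p) m -> obd (ev A A' p) m by move=> /iso->.
have /choice[phi hphi] : forall S, exists T, polyclosure A A' S -> joint_limit A A' B B' S T.
  move=> S; have [PS|nPS] := pselect (polyclosure A A' S).
    by have [T hT] := joint_limit_exists bB hB iso1 PS; exists T.
  by exists (fun=> 0).
have U S T : joint_limit A A' B B' S T -> phi S = T.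
  move=> hT; apply: (joint_limit_unique iso1 _ hT); apply: hphi; by case: hT.
have cA := polyclosure_cstar bA hA.
exists phi; rewrite (cstar_generatedE bA hA) (cstar_generatedE bB hB); split.
- split.
  + by move=> S /hphi[].
  + move=> S S'; rewrite !inE => /hphi/joint_limit_swap hS /hphi/joint_limit_swap hS' e.
    by apply: (joint_limit_unique iso2 hS); rewrite e.
  + move=> T PT; have [S /joint_limit_swap hS] := joint_limit_exists bA hA iso2 PT.
    by exists S; [case: hS | exact: U].
- move=> c S T PS PT; apply: U.
  by apply: (joint_limit_comb bA hA bB hB); exact: hphi.
- move=> S T PS PT; apply: U.
  by apply: (joint_limit_comp bA hA bB hB); exact: hphi.
- move=> S S' PS SS'; apply: (joint_limit_adj hA hB iso1 (hphi _ PS) _ SS').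
  by apply: hphi; case: cA => _ [Padj _]; exact: Padj SS'.
- by apply: U; have := joint_limit_ev bA hA bB hB pvar; rewrite !ev_pvar.
Qed.

End IsometricEquivalence.

(** * Gaussian rational coefficients *)

Section RationalPolynomials.
Context {R : realType}.

Definition gauss (c : rat[i]) : R[i] := ratr (complex.Re c) +i* ratr (complex.Im c).

Definition embed (p : seq (rat[i] * seq bool)) : spoly :=
  [seq (gauss t.1, t.2) | t <- p].

Lemma cnorm_le_sum (a b : R) : cnorm (a +i* b) <= `|a| + `|b|.
Proof.
have -> : a +i* b = a%:C + 'i%C * b%:C by rewrite [LHS]complexE.
apply: le_trans (cnormD _ _) _; rewrite cnormM !cnorm_real.
by rewrite /cnorm normc_def /= expr0n expr1n add0r sqrtr1 mul1r.
Qed.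

Lemma rat_dense (x e : R) : 0 < e -> exists q : rat, `|ratr q - x| < e.
Proof.
move=> e0; have [q hq] : exists q : rat, ratr q \in `](x - e), (x + e)[.
  by apply: rat_in_itvoo; rewrite ltrD2l gtrN.
exists q; move: hq; rewrite in_itv /= => /andP[h1 h2].
by rewrite ltr_norml; apply/andP; split; lra.
Qed.

Lemma gauss_dense (c : R[i]) e : 0 < e -> exists q, cnorm (c - gauss q) <= e.
Proof.
case: c => a b e0; have e2 : 0 < e / 2 by lra.
have [q hq] := rat_dense a e2; have [r hr] := rat_dense b e2.
exists (q +i* r); rewrite /gauss /=.
apply: le_trans (cnorm_le_sum _ _) _; rewrite distrC [`|b - _|]distrC (splitr e).
by rewrite lerD // ltW.
Qed.

Section Density.
Context {H K : hilbertType R}.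
Variables (A A' : H -> H) (B B' : K -> K).
Hypotheses (bA : bounded_operator A) (hA : is_adjoint A A').
Hypotheses (bB : bounded_operator B) (hB : is_adjoint B B').

(** One rational *-polynomial serves for both operators, so that bounds can be
    moved from one to the other. *)
Lemma embed_dense p (e : R) : 0 < e -> exists q,
  opclose (ev A A' p) (ev A A' (embed q)) e /\
  opclose (ev B B' p) (ev B B' (embed q)) e.
Proof.
elim: p e => [|t p IH] e e0.
  by exists [::]; split; apply: opclose_refl; exact: ltW.
have e2 : 0 < e / 2 by lra.
have [q [hqA hqB]] := IH _ e2.
have /bopP[_ [M M0 hM]] := wev_bop bA hA t.2.
have /bopP[_ [N N0 hN]] := wev_bop bB hB t.2.
have MN : 0 < M + N + 1 by lra.
have [c hc] := gauss_dense t.1 (divr_gt0 e2 MN).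
exists ((c, t.2) :: q); rewrite /embed /= -/(embed q).
have key (L : hilbertType R) (D D' : L -> L) M1 : 0 <= M1 -> M1 <= M + N + 1 ->
    obd (wev D D' t.2) M1 -> opclose (ev D D' p) (ev D D' (embed q)) (e / 2) ->
    opclose (ev D D' (t :: p)) (ev D D' ((gauss c, t.2) :: embed q)) e.
  move=> M10 M1le bw hp x; rewrite !ev_cons /=.
  rewrite opprD addrACA -scalerBl (splitr e) mulrDl.
  apply: le_trans (nrmD _ _) _; apply: lerD; last exact: hp.
  rewrite nrmZ; apply: le_trans (_ : cnorm (t.1 - gauss c) * (M1 * nrm x) <= _).
    by rewrite ler_wpM2l ?cnorm_ge0.
  rewrite mulrA ler_wpM2r ?nrm_ge0 //.
  apply: le_trans (_ : e / 2 / (M + N + 1) * M1 <= _); first by rewrite ler_wpM2r.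
  by rewrite mulrAC ler_pdivrMr // ler_wpM2l // ltW.
by split; [apply: (key _ _ _ M) => // | apply: (key _ _ _ N) => //]; lra.
Qed.

Definition sqbd (L : hilbertType R) (S : L -> L) (M : R) :=
  forall x, nrm (S x) ^+ 2 <= M * nrm x ^+ 2.

Lemma sqbd_obd (L : hilbertType R) (S : L -> L) m : 0 <= m ->
  sqbd S (m ^+ 2) <-> obd S m.
Proof.
move=> m0; split=> h x; have := h x; rewrite -exprMn.
  by rewrite ler_pXn2r ?nnegrE ?mulr_ge0 ?nrm_ge0.
by move=> ?; rewrite ler_pXn2r ?nnegrE ?mulr_ge0 ?nrm_ge0.
Qed.

Lemma rational_isometric_half :
  (forall q (r : rat), 0 <= r ->
     obd (ev A A' (embed q)) (ratr r) -> obd (ev B B' (embed q)) (ratr r)) ->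
  forall p m, 0 <= m -> obd (ev A A' p) m -> obd (ev B B' p) m.
Proof.
move=> hq p m m0 hm; apply: obd_lim => e e0.
have e3 : 0 < e / 3 by lra.
have [q [qA qB]] := embed_dense p e3.
have bq : obd (ev A A' (embed q)) (m + e / 3).
  by rewrite addrC; exact: opclose_bd hm (opclose_sym qA).
have [r hr] : exists r : rat, ratr r \in `](m + e / 3), (m + e / 3 + e / 3)[.
  by apply: rat_in_itvoo; lra.
move: hr; rewrite in_itv /= => /andP[h1 h2].
have r0 : 0 <= r by rewrite -(ler0q R); lra.
have bqB : obd (ev B B' (embed q)) (m + e / 3 + e / 3).
  by apply: obd_le (ltW h2) _; apply: hq r0 _; apply: obd_le (ltW h1) _.
have -> : m + e = e / 3 + (m + e / 3 + e / 3) by lra.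
exact: opclose_bd bqB qB.
Qed.

End Density.
End RationalPolynomials.

(** Countably many conditions on norms characterize algebraic equivalence; this is
    what makes the events of equivalence measurable. *)
Theorem equiv_rational_norms (R : realType) (H K : hilbertType R)
    (A A' : H -> H) (B B' : K -> K) :
  bounded_operator A -> is_adjoint A A' -> bounded_operator B -> is_adjoint B B' ->
  (algebraically_equivalent A B <->
   forall q (r : rat), 0 <= r ->
     obd (ev A A' (embed q)) (ratr r) <-> obd (ev B B' (embed q)) (ratr r)).
Proof.
move=> bA hA bB hB; split=> [eqv q r r0|eqv].
  by apply: (equiv_isometric bA hA bB hB eqv); rewrite ler0q.
by apply: isometric_equiv => // p m m0; split;
  apply: rational_isometric_half => // q r r0; rewrite eqv.
Qed.

(** * *-Polynomials in weighted shifts, on finite vectors *)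

Section FiniteVectors.
Context {R : realType}.
Implicit Types (w : int -> R) (p : @spoly R) (m : seq bool) (n : int).

(** A word m maps the basis vector n of a weighted shift to the multiple
    wcoef w m n of the basis vector n + wshift m. *)
Fixpoint wshift m : int :=
  if m is b :: m' then wshift m' + (if b then 1 else -1) else 0.

Fixpoint wcoef w m n : R :=
  if m is b :: m' then wcoef w m' n * w (if b then n + wshift m' else n + wshift m' - 1)
  else 1.

Definition fvec := seq (rat[i] * int).

Definition gram p w (s s' : rat[i] * int) : R :=
  \sum_(t <- p) \sum_(t' <- p)
    (s.2 + wshift t.2 == s'.2 + wshift t'.2)%:R * (wcoef w t.2 s.2 * wcoef w t'.2 s'.2) *
    complex.Re (gauss s.1 * t.1 * Num.conj (gauss s'.1 * t'.1)).

(** For a weighted shift with weights w, the squared norm of p applied to the finite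
    vector v ([sqn_vec]): a polynomial in finitely many weights. *)
Definition sqn p w (v : fvec) : R := \sum_(s <- v) \sum_(s' <- v) gram p w s s'.

(** The polynomial 1 acts as the identity for all weights, so this is the squared
    norm of the vector itself. *)
Definition sqn1 (v : fvec) : R := sqn pone (fun=> 0) v.

Definition supported (D : pred int) (v : fvec) := all (fun s => D s.2) v.

Definition bnd p w (D : pred int) (M : R) :=
  forall v, supported D v -> sqn p w v <= M * sqn1 v.

Lemma sqn_pone w v : sqn pone w v = sqn1 v.
Proof.
apply: eq_bigr => s _; apply: eq_bigr => s' _.
by rewrite /gram !big_seq1.
Qed.

Definition translate (j : int) (v : fvec) : fvec := [seq (s.1, s.2 + j) | s <- v].

Lemma wcoef_translate w m n j : wcoef (fun z => w (z + j)) m n = wcoef w m (n + j).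
Proof.
elim: m => //= b m ->; congr (_ * w _).
by case: b; lia.
Qed.

Lemma sqn_translate p w j v : sqn p (fun z => w (z + j)) v = sqn p w (translate j v).
Proof.
rewrite /sqn big_map; apply: eq_bigr => s _; rewrite big_map; apply: eq_bigr => s' _.
apply: eq_bigr => t _; apply: eq_bigr => t' _ /=.
rewrite !wcoef_translate; congr (_%:R * _ * _).
by rewrite ![_ + j + _]addrAC (inj_eq (addIr j)).
Qed.

Lemma sqn1_translate j v : sqn1 (translate j v) = sqn1 v.
Proof. by rewrite -(sqn_pone (fun=> 0)) -sqn_translate sqn_pone. Qed.

Lemma wcoef_cvg (w_ : nat -> int -> R) w m n :
  (forall z, (w_ k z) @[k --> \oo] --> w z) ->
  (wcoef (w_ k) m n) @[k --> \oo] --> wcoef w m n.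
Proof.
move=> hw; elim: m => [|b m IH] /=; first exact: cvg_cst.
exact: cvgM.
Qed.

Lemma cvg_sumr I (r : seq I) (f : nat -> I -> R) (l : I -> R) :
  (forall i, (f k i) @[k --> \oo] --> l i) ->
  (\sum_(i <- r) f k i) @[k --> \oo] --> \sum_(i <- r) l i.
Proof.
move=> hf; elim: r => [|i r IH].
  by rewrite big_nil; under eq_fun do rewrite big_nil; exact: cvg_cst.
rewrite big_cons; under eq_fun do rewrite big_cons.
exact: cvgD.
Qed.

Lemma sqn_cvg (w_ : nat -> int -> R) w p v :
  (forall z, (w_ k z) @[k --> \oo] --> w z) ->
  (sqn p (w_ k) v) @[k --> \oo] --> sqn p w v.
Proof.
move=> hw; apply: cvg_sumr => s; apply: cvg_sumr => s'.
apply: cvg_sumr => t; apply: cvg_sumr => t'.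
apply: cvgM; last exact: cvg_cst.
apply: cvgM; first exact: cvg_cst.
by apply: cvgM; exact: wcoef_cvg.
Qed.

(** A vanishing weight cannot be crossed in either direction. *)
Lemma wcoef_barrier w j m n : w j = 0 -> wcoef w m n != 0 ->
  (n <= j) = (n + wshift m <= j).
Proof.
move=> wj; elim: m => [|b m IH] /=; first by rewrite addr0.
rewrite mulf_eq0 negb_or => /andP[/IH -> hw].
have : (if b then n + wshift m else n + wshift m - 1) != j by apply: contra hw => /eqP ->; rewrite wj.
by case: b {hw}; lia.
Qed.

Lemma gram_barrier p w j s s' : w j = 0 -> (s.2 <= j) != (s'.2 <= j) ->
  gram p w s s' = 0.
Proof.
move=> wj ss'; apply: big1 => t _; apply: big1 => t' _.
have [e|_] := eqVneq; last by rewrite !mul0r.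
have [->|k1] := eqVneq (wcoef w t.2 s.2) 0; first by rewrite mul0r mulr0 mul0r.
have [->|k2] := eqVneq (wcoef w t'.2 s'.2) 0; first by rewrite !mulr0 mul0r.
by move: ss'; rewrite (wcoef_barrier wj k1) (wcoef_barrier wj k2) e eqxx.
Qed.

(** The two sides of a vanishing weight span orthogonal reducing subspaces. *)
Lemma sqn_cut p w j v : w j = 0 ->
  sqn p w v = sqn p w [seq s <- v | s.2 <= j] + sqn p w [seq s <- v | ~~ (s.2 <= j)].
Proof.
move=> wj; rewrite /sqn (bigID (fun s : rat[i] * int => s.2 <= j)) /=.
rewrite !big_filter; congr (_ + _); apply: eq_bigr => s hs;
  rewrite big_filter (bigID (fun s : rat[i] * int => s.2 <= j)) /=.
  rewrite [X in _ + X]big1 ?addr0 // => s' hs'; apply: gram_barrier wj _.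
  by rewrite hs (negbTE hs').
rewrite [X in X + _]big1 ?add0r // => s' hs'; apply: gram_barrier wj _.
by rewrite hs' (negbTE hs).
Qed.

Lemma sqn1_cut j v :
  sqn1 v = sqn1 [seq s <- v | s.2 <= j] + sqn1 [seq s <- v | ~~ (s.2 <= j)].
Proof. exact: sqn_cut. Qed.

(** A word with nonzero coefficient stays between two vanishing weights, hence only
    sees the weights of the block. *)
Lemma wcoef_block w w' lo hi m n : (forall z, lo <= z < hi -> w z = w' z) ->
  w (lo - 1) = 0 -> w' (lo - 1) = 0 -> w hi = 0 -> w' hi = 0 ->
  lo <= n <= hi -> wcoef w m n = wcoef w' m n.
Proof.
move=> ww wl wl' wh wh' hn; elim: m => [|b m IH] //=.
rewrite IH; have [->|k0] := eqVneq (wcoef w' m n) 0; first by rewrite !mul0r.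
congr (_ * _).
have b1 := wcoef_barrier wl' k0; have b2 := wcoef_barrier wh' k0.
set z := if b then _ else _.
have [zh|zh] := eqVneq z hi; first by rewrite zh wh wh'.
have [zl|zl] := eqVneq z (lo - 1); first by rewrite zl wl wl'.
by apply: ww; move: zh zl; rewrite /z; case: (b); lia.
Qed.

Lemma sqn_block p w w' lo hi v : (forall z, lo <= z < hi -> w z = w' z) ->
  w (lo - 1) = 0 -> w' (lo - 1) = 0 -> w hi = 0 -> w' hi = 0 ->
  supported (fun z => lo <= z <= hi) v -> sqn p w v = sqn p w' v.
Proof.
move=> ww wl wl' wh wh' /allP hv.
apply: eq_big_seq => s sv; apply: eq_big_seq => s' sv'.
apply: eq_bigr => t _; apply: eq_bigr => t' _.
by congr (_ * (_ * _) * _); apply: (wcoef_block (lo := lo) (hi := hi)) => //; apply: hv.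
Qed.

End FiniteVectors.

Section Models.
Context {R : realType} {H : hilbertType R}.

Definition vec (g : int -> H) (v : fvec) : H := \sum_(s <- v) gauss s.1 *: g s.2.

(** A common form for unilateral and bilateral shifts: a unilateral shift is
    extended by zero vectors and zero weights to the negative indices, and D
    marks the true indices.  Words, translations and windows can then be written
    in int without boundary cases. *)
Record shift_model (D : pred int) (g : int -> H) (w : int -> R) (A A' : H -> H) : Prop :=
  ShiftModel {
    sm_bounded : bounded_operator A;
    sm_adjoint : is_adjoint A A';
    sm_ortho : forall m n, hdot H (g m) (g n) = ((m == n) && D m)%:R;
    sm_shift : forall n, A (g n) = (w n)%:C *: g (n + 1);
    sm_back : forall n, A' (g n) = (w (n - 1))%:C *: g (n - 1);
    sm_dense : forall x (e : R), 0 < e ->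
      exists2 v, supported D v & nrm (x - vec g v) < e;
    sm_outside : forall n, ~~ (D n && D (n + 1)) -> w n = 0;
    sm_ge0 : forall n, 0 <= w n }.

Variables (D : pred int) (g : int -> H) (w : int -> R) (A A' : H -> H).
Hypothesis M : shift_model D g w A A'.

Lemma wev_basis m n : wev A A' m (g n) = (wcoef w m n)%:C *: g (n + wshift m).
Proof.
elim: m => [|b m IH] /=; first by rewrite addr0 scale1r.
have lA := bop_lin (sm_bounded M).
have lA' := adj_lin (sm_adjoint M).
rewrite IH; case: b; rewrite linZ // ?(sm_shift M) ?(sm_back M) scalerA -rmorphM /=;
  by rewrite addrA.
Qed.

Lemma wcoef_inside m n : D n -> wcoef w m n != 0 -> D (n + wshift m).
Proof.
move=> Dn; elim: m => [|b m IH] /=; first by rewrite addr0.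
rewrite mulf_eq0 negb_or => /andP[/IH Dm hw].
have := contra_neqT (@sm_outside _ _ _ _ _ M _) hw.
by case: b {hw}; rewrite ?subrK => /andP[]; rewrite !addrA.
Qed.

Lemma dot_items (c c' : R[i]) (k k' : R) n n' : (k != 0 -> D n) ->
  complex.Re (hdot H ((c * k%:C) *: g n) ((c' * k'%:C) *: g n')) =
  (n == n')%:R * (k * k') * complex.Re (c * Num.conj c').
Proof.
move=> kD; rewrite dotZl dotZr (sm_ortho M) !rmorphM /=.
have -> : Num.conj (k'%:C) = k'%:C :> R[i].
  by apply: conj_Creal; apply/complex_realP; eexists.
have [->|k0] := eqVneq k 0; first by rewrite !mul0r !mulr0 !mul0r.
rewrite kD // andbT.
have -> : c * k%:C * (Num.conj c' * k'%:C * (n == n')%:R) =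
    ((n == n')%:R * (k * k'))%:C * (c * Num.conj c').
  rewrite !rmorphM /= rmorph_nat; ring.
by case: (c * _) => a b /=; rewrite mul0r subr0.
Qed.

Lemma sqn_vec p v : supported D v -> nrm (ev A A' p (vec g v)) ^+ 2 = sqn p w v.
Proof.
move=> /allP hv.
have E : ev A A' p (vec g v) = \sum_(s <- v) \sum_(t <- p)
    ((gauss s.1 * t.1) * (wcoef w t.2 s.2)%:C) *: g (s.2 + wshift t.2).
  rewrite /vec (lin_sum _ _ (bop_lin (ev_bop (sm_bounded M) (sm_adjoint M) p))).
  apply: eq_bigr => s _; rewrite linZ; last exact: bop_lin (ev_bop (sm_bounded M) (sm_adjoint M) p).
  rewrite /ev scaler_sumr; apply: eq_bigr => t _.
  by rewrite wev_basis !scalerA mulrA.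
have -> : nrm (ev A A' p (vec g v)) ^+ 2 =
    complex.Re (hdot H (ev A A' p (vec g v)) (ev A A' p (vec g v))).
  by rewrite dot_nrm.
have Resum I (r : seq I) (f : I -> R[i]) :
   complex.Re (\sum_(i <- r) f i) = \sum_(i <- r) complex.Re (f i).
  by elim: r => [|i r IH]; rewrite ?big_nil // !big_cons -IH; case: (f i); case: (\sum_(i <- r) f i).
rewrite E dot_suml Resum; apply: eq_big_seq => s /hv Ds.
rewrite dot_sumr Resum; apply: eq_bigr => s' _.
rewrite dot_suml Resum; apply: eq_bigr => t _.
rewrite dot_sumr Resum; apply: eq_bigr => t' _.
by rewrite dot_items // => k0; apply: wcoef_inside.
Qed.

Lemma sqn1_vec v : supported D v -> nrm (vec g v) ^+ 2 = sqn1 v.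
Proof. by move=> hv; rewrite -(sqn_pone w) -sqn_vec // ev_pone. Qed.

(** Finite vectors with Gaussian rational coefficients are dense. *)
Lemma obd_dense (S : H -> H) m : bounded_operator S -> 0 <= m ->
  (forall v, supported D v -> nrm (S (vec g v)) <= m * nrm (vec g v)) -> obd S m.
Proof.
move=> /bopP[lS [C C0 hC]] m0 hv x; apply/ler_addgt0Pr => e e0.
have Cm : 0 < C + m + 1 by rewrite ltr_wpDl // addr_ge0.
have [v sv hx] := sm_dense M x (divr_gt0 e0 Cm).
rewrite ltr_pdivlMr // in hx.
have h1 : nrm (S x) <= C * nrm (x - vec g v) + m * nrm (vec g v).
  rewrite -[x in leLHS](subrK (vec g v)) (linD _ _ lS); apply: le_trans (nrmD _ _) _.
  by apply: lerD; [exact: hC | exact: hv].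
have h2 : nrm (vec g v) <= nrm x + nrm (x - vec g v).
  by rewrite -{1}[vec g v](subrK x) addrC (nrm_distC x); exact: nrmD.
have h3 : m * nrm (vec g v) <= m * (nrm x + nrm (x - vec g v)) by rewrite ler_wpM2l.
have := nrm_ge0 (x - vec g v); lra.
Qed.

(** The norm of a *-polynomial in a shift depends on the weights only, through
    countably many inequalities. *)
Lemma model_obd p m : 0 <= m -> obd (ev A A' p) m <-> bnd p w D (m ^+ 2).
Proof.
move=> m0; split=> [/(sqbd_obd _ m0) h v hv|h].
  by rewrite -sqn_vec // -sqn1_vec //; apply: h.
apply: (obd_dense (ev_bop (sm_bounded M) (sm_adjoint M) p) m0) => v sv.
have := h v sv; rewrite -sqn_vec // -sqn1_vec // -exprMn.
by rewrite ler_pXn2r ?nnegrE ?mulr_ge0 ?nrm_ge0.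
Qed.

End Models.

(** * Existence of weighted shifts and of their adjoints *)

Section Bases.
Context {R : realType} {H : hilbertType R}.

Definition orthonormal_seq (u : nat -> H) := forall j k, hdot H (u j) (u k) = (j == k)%:R.

Lemma nrm_orthonormal_sum (v : nat -> H) (d : nat -> R[i]) n : orthonormal_seq v ->
  nrm (\sum_(k < n) d k *: v k) ^+ 2 = \sum_(k < n) cnorm (d k) ^+ 2.
Proof.
move=> hv; apply: (@complexI R); rewrite -dot_nrm.
elim: n => [|n IH]; first by rewrite !big_ord0 dot0l.
rewrite !big_ord_recr /= dotDl !dotDr IH rmorphD /= -addrA; congr (_ + _).
have o : hdot H (\sum_(i < n) d i *: v i) (v n) = 0.
  rewrite dot_suml big1 // => i _; rewrite dotZl hv.
  by have /ltn_eqF -> := ltn_ord i; rewrite mulr0.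
rewrite dotZr o mulr0 add0r (dotC (\sum_(i < n) _)) dotZr o mulr0 rmorph0 add0r.
by rewrite dotZl dotZr hv eqxx mulr1 -normCK cnormE rmorphXn.
Qed.

Lemma Bessel (u : nat -> H) n x : orthonormal_seq u ->
  \sum_(k < n) cnorm (hdot H x (u k)) ^+ 2 <= nrm x ^+ 2.
Proof.
move=> hu; rewrite -(nrm_orthonormal_sum (fun k => hdot H x (u k)) n hu).
set y := \sum_(k < n) _.
have hxy : hdot H x y = hdot H y y.
  rewrite /y dot_sumr [RHS]dot_sumr; apply: eq_bigr => k _.
  rewrite !dotZr; congr (_ * _); rewrite dot_suml (bigD1 k) //= dotZl hu eqxx mulr1.
  rewrite big1 ?addr0 // => j jk; rewrite dotZl hu.
  by move: jk; rewrite -val_eqE /= => /negbTE ->; rewrite mulr0.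
rewrite ler_pXn2r ?nnegrE ?nrm_ge0 //; apply: nrm_le_dot; first exact: nrm_ge0.
by apply: le_trans (Re_le_cnorm _) _; rewrite -hxy; exact: Cauchy_Schwarz.
Qed.

Lemma cauchy_comb c (p q : nat -> H) : cauchy_nrm p -> cauchy_nrm q ->
  cauchy_nrm (fun n => c *: p n + q n).
Proof.
move=> hp hq e e0.
have c0 : 0 < cnorm c + 1 by rewrite ltr_wpDl ?cnorm_ge0.
have [M hM] := hp (e / 2 / (cnorm c + 1)) ltac:(by rewrite !divr_gt0).
have [N hN] := hq (e / 2) ltac:(by rewrite !divr_gt0).
exists (maxn M N) => m n; rewrite !geq_max => /andP[Mm Nm] /andP[Mn Nn].
have h1 := hM _ _ Mm Mn; have h2 := hN _ _ Nm Nn.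
have -> : c *: p m + q m - (c *: p n + q n) = c *: (p m - p n) + (q m - q n).
  by rewrite scalerBr opprD addrACA.
apply: le_lt_trans (nrmD _ _) _; rewrite nrmZ [e in _ < e](splitr e).
apply: ler_ltD => //.
rewrite ltr_pdivlMr // in h1; apply: le_trans (ltW h1).
by rewrite mulrC ler_wpM2l ?nrm_ge0 // lerDl.
Qed.

Lemma cauchy_const (p : nat -> H) l N : (forall n, (N <= n)%N -> p n = l) -> cauchy_nrm p.
Proof. by move=> h e e0; exists N => m n /h-> /h->; rewrite subrr nrm0. Qed.

Lemma ncvg_const (p : nat -> H) l N : (forall n, (N <= n)%N -> p n = l) -> ncvg p l.
Proof. by move=> h e e0; exists N => n /h->; rewrite subrr nrm0. Qed.

Section SumOperators.
Variables (u v : nat -> H) (c : nat -> R) (M : R).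
Hypotheses (hu : orthonormal_seq u) (hv : orthonormal_seq v).
Hypotheses (M0 : 0 <= M) (cM : forall k, `|c k| <= M).

Definition psum (u v : nat -> H) n x := \sum_(k < n) ((c k)%:C * hdot H x (u k)) *: v k.

Lemma psum_linear n : linear (psum u v n).
Proof.
move=> d x y; rewrite /psum scaler_sumr -big_split; apply: eq_bigr => k _ /=.
by rewrite scalerA -scalerDl dotDl dotZl mulrDr; congr ((_ + _) *: _); rewrite mulrCA.
Qed.

Lemma psum_obd n : obd (psum u v n) M.
Proof.
apply/sqbd_obd => // x.
rewrite (nrm_orthonormal_sum (fun k => (c k)%:C * hdot H x (u k)) n hv).
apply: le_trans (_ : \sum_(k < n) M ^+ 2 * cnorm (hdot H x (u k)) ^+ 2 <= _).
  apply: ler_sum => k _; rewrite cnormM exprMn ler_wpM2r ?sqr_ge0 //.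
  by rewrite cnorm_real ler_pXn2r ?nnegrE.
by rewrite -mulr_sumr ler_wpM2l ?sqr_ge0 // Bessel.
Qed.

Lemma psum_adjoint n : is_adjoint (psum u v n) (psum v u n).
Proof.
move=> x y; rewrite /psum dot_suml dot_sumr; apply: eq_bigr => k _.
rewrite dotZl dotZr rmorphM /= (dotC (v k)) conjCK mulrAC; congr (_ * _ * _).
by rewrite conj_Creal //; apply/complex_realP; eexists.
Qed.

Lemma psum_single n y k0 : (forall k, hdot H y (u k) = (k == k0)%:R) -> (k0 < n)%N ->
  psum u v n y = (c k0)%:C *: v k0.
Proof.
move=> hy kn; rewrite /psum (bigD1 (Ordinal kn)) //= hy eqxx mulr1 big1 ?addr0 //.
move=> k; rewrite -val_eqE /= hy => /negbTE ->.
by rewrite mulr0 scale0r.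
Qed.

Lemma psum_none n y : (forall k, hdot H y (u k) = 0) -> psum u v n y = 0.
Proof. by move=> hy; apply: big1 => k _; rewrite hy mulr0 scale0r. Qed.

End SumOperators.

Context {I : eqType} (f : I -> H).
Hypothesis hf : orthonormal_basis f.

Lemma basis_dense x (e : R) : 0 < e ->
  exists n (s : 'I_n -> I) (c : 'I_n -> R[i]), nrm (x - \sum_(k < n) c k *: f (s k)) < e.
Proof.
move=> e0; have [_ hc] := hf.
have : closure [set x : H | exists n (s : 'I_n -> I) (c : 'I_n -> R[i]),
                         x = \sum_(k < n) c k *: f (s k)] x by rewrite hc.
move=> /(_ (ball x e%:C)) [].
  by apply: nbhsx_ballx; rewrite (@ltcR R 0).
move=> _ [[n [s [c ->]]]]; rewrite -ball_normE /= nrmE ltcR => h.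
by exists n, s, c.
Qed.

Lemma basis_ext (S T : H -> H) : bounded_operator S -> bounded_operator T ->
  (forall i, S (f i) = T (f i)) -> S = T.
Proof.
move=> /bopP[lS [M M0 hM]] /bopP[lT [N N0 hN]] ST; apply/funext => x.
apply/eqP; rewrite -subr_eq0; apply/eqP/nrm_eq0.
apply/le_anti; rewrite nrm_ge0 andbT; apply/ler_addgt0Pr => e e0; rewrite add0r.
have MN : 0 < M + N + 1 by lra.
have [n [s [c hx]]] := basis_dense x (divr_gt0 e0 MN).
set y := \sum_(k < n) _ in hx.
have Sy : S y = T y.
  rewrite /y (lin_sum _ _ lS) (lin_sum _ _ lT).
  by apply: eq_bigr => k _; rewrite (linZ _ _ lS) (linZ _ _ lT) ST.
have -> : S x - T x = S (x - y) - T (x - y) by rewrite (linB x y lS) (linB x y lT) Sy opprB addrA subrK.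
rewrite ltr_pdivlMr // in hx; apply: le_trans (nrmD _ _) _; rewrite nrmN.
have := hM (x - y); have := hN (x - y); have := nrm_ge0 (x - y); lra.
Qed.

Variables (next : I -> I) (b : nat -> I) (a : I -> R) (M : R).
Hypotheses (next_inj : injective next) (b_inj : injective b).
Hypothesis b_surj : forall i, exists k, b k = i.
Hypotheses (M0 : 0 <= M) (aM : forall i, `|a i| <= M).

(** Pointwise limits of finite sums of rank-one operators; the partial sums are
    uniformly bounded by Bessel's inequality, and eventually constant on basis
    vectors.  The enumeration b treats the index types nat and int alike. *)
Lemma shift_operator : exists L L', [/\ bounded_operator L, is_adjoint L L',
  forall i, L (f i) = (a i)%:C *: f (next i),
  forall i, L' (f (next i)) = (a i)%:C *: f i &
  forall j, (forall i, j != next i) -> L' (f j) = 0].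
Proof.
have [of_ _] := hf.
pose u k := f (b k); pose v k := f (next (b k)); pose c k := a (b k).
have hu : orthonormal_seq u by move=> j k; rewrite /u of_ (inj_eq b_inj).
have hv : orthonormal_seq v by move=> j k; rewrite /v of_ (inj_eq next_inj) (inj_eq b_inj).
have cM k : `|c k| <= M by exact: aM.
have ex (p q : nat -> H) : orthonormal_seq p -> orthonormal_seq q ->
    (forall i, (exists k0, forall k, hdot H (f i) (p k) = (k == k0)%:R) \/
               (forall k, hdot H (f i) (p k) = 0)) ->
    exists L, [/\ linear L, obd L M & forall x, ncvg (psum c p q ^~ x) (L x)].
  move=> hp hq hpf; apply: limit_operator.
  - by move=> n; exact: psum_linear.
  - by move=> n; exact: psum_obd.
  have cf i : cauchy_nrm (psum c p q ^~ (f i)).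
    case: (hpf i) => [[k0 hk]|hk].
      apply: (@cauchy_const _ ((c k0)%:C *: q k0) k0.+1) => n kn.
      exact: psum_single.
    by apply: (@cauchy_const _ 0 0%N) => n _; exact: psum_none.
  have cs n (s : 'I_n -> I) (d : 'I_n -> R[i]) :
      cauchy_nrm (psum c p q ^~ (\sum_(k < n) d k *: f (s k))).
    have -> : psum c p q ^~ (\sum_(k < n) d k *: f (s k)) =
        (fun m => \sum_(k < n) d k *: psum c p q m (f (s k))).
      apply/funext => m; have lp : linear (psum c p q m) by exact: psum_linear.
      by rewrite (lin_sum _ _ lp); apply: eq_bigr => k _; rewrite (linZ _ _ lp).
    rewrite unlock; elim: (index_enum _) => [|k r IH] /=.
      by apply: (@cauchy_const _ 0 0%N).
    exact: cauchy_comb.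
  move=> x e e0; have M1 : 0 < 3 * (M + 1) by rewrite mulr_gt0 // ltr_wpDl.
  have [n [s [d hx]]] := basis_dense x (divr_gt0 e0 M1).
  set y := \sum_(k < n) _ in hx.
  have [N hN] := cs _ s d (e / 3) ltac:(by rewrite divr_gt0).
  have hxy m : nrm (psum c p q m x - psum c p q m y) <= M * nrm (x - y).
    have lp : linear (psum c p q m) by exact: psum_linear.
    by rewrite -(linB _ _ lp); exact: psum_obd.
  exists N => m l Nm Nl; have h1 := hN _ _ Nm Nl; rewrite -/y in h1.
  apply: le_lt_trans (nrm_tri (psum c p q m y) _ _) _.
  have h2 : nrm (psum c p q m y - psum c p q l x) <=
      nrm (psum c p q m y - psum c p q l y) + nrm (psum c p q l x - psum c p q l y).
    by rewrite (nrm_distC (psum c p q l x)); exact: nrm_tri.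
  have h3 := hxy m; have h4 := hxy l.
  rewrite ltr_pdivlMr // in hx; have := nrm_ge0 (x - y); lra.
have single (p q : nat -> H) L y k0 : (forall x, ncvg (psum c p q ^~ x) (L x)) ->
    (forall k, hdot H y (p k) = (k == k0)%:R) -> L y = (c k0)%:C *: q k0.
  move=> hL hk; apply: ncvg_unique (hL _) _.
  by apply: (@ncvg_const _ _ k0.+1) => n kn; exact: psum_single.
have uf i : exists k0, b k0 = i /\ forall k, hdot H (f i) (u k) = (k == k0)%:R.
  have [k0 hk] := b_surj i; exists k0; split=> // k.
  by rewrite /u of_ -hk (inj_eq b_inj) eq_sym.
have vf i : exists k0, b k0 = i /\ forall k, hdot H (f (next i)) (v k) = (k == k0)%:R.
  have [k0 hk] := b_surj i; exists k0; split=> // k.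
  by rewrite /v of_ -hk (inj_eq next_inj) (inj_eq b_inj) eq_sym.
have vn j : (forall i, j != next i) -> forall k, hdot H (f j) (v k) = 0.
  by move=> hj k; rewrite /v of_ (negbTE (hj _)).
have [L [lL bL cL]] : exists L, [/\ linear L, obd L M & forall x, ncvg (psum c u v ^~ x) (L x)].
  by apply: ex => // i; left; have [k0 [_ hk]] := uf i; exists k0.
have [L' [lL' bL' cL']] : exists L, [/\ linear L, obd L M & forall x, ncvg (psum c v u ^~ x) (L x)].
  apply: ex => // j; have [[i ->]|hj] := pselect (exists i, j = next i).
    by left; have [k0 [_ hk]] := vf i; exists k0.
  by right; apply: vn => i; apply/eqP => ji; apply: hj; exists i.
exists L, L'; split.
- by apply/bopP; split=> //; exists M.
- by apply: limit_adjoint cL cL' => n; exact: psum_adjoint.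
- by move=> i; have [k0 [hi hk]] := uf i; rewrite (single _ _ _ _ _ cL hk) /c /v hi.
- by move=> i; have [k0 [hi hk]] := vf i; rewrite (single _ _ _ _ _ cL' hk) /c /u hi.
- move=> j hj; apply: ncvg_unique (cL' _) _.
  by apply: (@ncvg_const _ _ 0%N) => n _; apply: psum_none; exact: vn.
Qed.

End Bases.

(** * Unilateral and bilateral shifts as int-indexed shifts *)

Section ShiftModels.
Context {R : realType} {H : hilbertType R}.

Definition nneg : pred int := fun z => 0 <= z.
Definition all_int : pred int := fun=> true.

Definition zext (t : nat -> R) (z : int) : R := if z is Posz n then t n else 0.
Definition gext (f : nat -> H) (z : int) : H := if z is Posz n then f n else 0.

(** Complex coefficients are replaced by Gaussian rational ones, and the basis by
    its int-indexed form. *)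
Lemma rational_span_dense (D : pred int) (g : int -> H) (I : Type) (f : I -> H) (z : I -> int) :
  (forall i, D (z i) /\ f i = g (z i)) -> (forall i, nrm (f i) = 1) ->
  forall n (s : 'I_n -> I) (c : 'I_n -> R[i]) (e : R), 0 < e ->
  exists2 v, supported D v & nrm (\sum_(k < n) c k *: f (s k) - vec g v) < e.
Proof.
move=> fg f1 n s c; rewrite unlock; elim: (index_enum _) => [|k r IH] e e0 /=.
  by exists [::] => //; rewrite /vec big_nil subrr nrm0.
have e2 : 0 < e / 2 by lra.
have [v hv hr] := IH _ e2; have [q hq] := gauss_dense (c k) e2.
have [Dk fk] := fg (s k).
exists ((q, z (s k)) :: v); first by rewrite /= Dk.
rewrite /vec big_cons /= -fk opprD addrACA -scalerBl.
apply: le_lt_trans (nrmD _ _) _; rewrite nrmZ f1 mulr1 [ltRHS](splitr e).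
exact: ler_ltD.
Qed.

Lemma basis_nrm (I : eqType) (f : I -> H) i : orthonormal_basis f -> nrm (f i) = 1.
Proof.
move=> [of_ _]; have := dot_nrm (f i); rewrite of_ eqxx => /(@complexI R 1) h.
by apply/eqP; rewrite -(@eqrXn2 _ 2) ?nrm_ge0 // -h expr1n.
Qed.

Lemma shift_weight_le (I : eqType) (next : I -> I) (f : I -> H) a A :
  weighted_shift next f a A -> exists2 M, 0 <= M & forall i, `|a i| <= M.
Proof.
move=> [hf a0 /bopP[_ [M M0 hM]] hA]; exists M => // i.
have := hM (f i).
by rewrite hA nrmZ (basis_nrm i hf) (basis_nrm (next i) hf) !mulr1 cnorm_real.
Qed.

Lemma nat_shift_exists (f : nat -> H) (t : nat -> R) M : orthonormal_basis f ->
  (forall n, 0 <= t n) -> (forall n, t n <= M) -> exists A, unilateral_shift f t A.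
Proof.
move=> hf t0 tM.
have M0 : 0 <= M by apply: le_trans (tM 0%N).
have [|n|L [L' [bL _ hL _ _]]] := @shift_operator _ _ _ f hf succn id t M succn_inj (@inj_id _) _ M0.
- by move=> i; exists i.
- by rewrite ger0_norm.
by exists L; split.
Qed.

Lemma unilateral_model (f : nat -> H) (t : nat -> R) A : unilateral_shift f t A ->
  exists A', shift_model nneg (gext f) (zext t) A A'.
Proof.
move=> sA; have [M M0 tM] := shift_weight_le sA.
have [hf t0 bA hA] := sA.
have [|L [L' [bL aL hL hL' hL'0]]] := @shift_operator _ _ _ f hf succn id t M succn_inj (@inj_id _) _ M0 tM.
  by move=> i; exists i.
have AL : A = L by apply: basis_ext hf _ _ bA bL _ => i; rewrite hA hL.
exists L'; split => //.
- by rewrite AL.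
- have [of_ _] := hf.
  by move=> [m|m] [n|n] //=; rewrite ?dot0l ?dot0r ?andbF //= of_ andbT.
- move=> [n|n] /=; first by rewrite hA addn1.
  by rewrite scale0r (lin0 (bop_lin bA)).
- have lL' := adj_lin aL.
  move=> [[|n]|n] /=.
  + by rewrite scale0r hL'0.
  + by rewrite hL' subn1.
  + by rewrite lin0 // scaler0.
- move=> x e e0; have e2 : 0 < e / 2 by lra.
  have [n [s [c hx]]] := basis_dense hf x e2.
  have [|i|v hv hc] := @rational_span_dense nneg (gext f) nat f Posz _ _ n s c _ e2.
  + by [].
  + exact: basis_nrm.
  exists v => //; apply: le_lt_trans (nrm_tri _ _ _) _.
  by rewrite (splitr e); apply: ltrD hx hc.
- by move=> [n|n] //=; rewrite /nneg /= lez_nat.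
- by case.
Qed.

Definition zigzag (k : nat) : int := if odd k then Negz k./2 else Posz k./2.

Lemma zigzag_inj : injective zigzag.
Proof.
move=> j k; rewrite /zigzag -[in j = k](odd_double_half j) -[in _ = k](odd_double_half k).
by case: (odd j); case: (odd k) => // -[->].
Qed.

Lemma zigzag_surj i : exists k, zigzag k = i.
Proof.
rewrite /zigzag; case: i => n; first by exists n.*2; rewrite odd_double doubleK.
by exists n.*2.+1; rewrite /= odd_double /= uphalf_double.
Qed.

Lemma next_int_inj : injective next_int. Proof. exact: addIr. Qed.

Lemma bilateral_model (f : int -> H) (a : int -> R) A : bilateral_shift f a A ->
  exists A', shift_model all_int f a A A'.
Proof.
move=> sA; have [M M0 aM] := shift_weight_le sA.
have [hf a0 bA hA] := sA.
have [L [L' [bL aL hL hL' _]]] := @shift_operator _ _ _ f hf next_int zigzag a M next_int_inj zigzag_inj zigzag_surj M0 aM.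
have AL : A = L by apply: basis_ext hf _ _ bA bL _ => i; rewrite hA hL.
exists L'; split => //.
- by rewrite AL.
- by have [of_ _] := hf => m n; rewrite andbT of_.
- by move=> n; rewrite -hL' /next_int subrK.
- move=> x e e0; have e2 : 0 < e / 2 by lra.
  have [n [s [c hx]]] := basis_dense hf x e2.
  have [|i|v hv hc] := @rational_span_dense all_int f int f id _ _ n s c _ e2.
  + by [].
  + exact: basis_nrm.
  exists v => //; apply: le_lt_trans (nrm_tri _ _ _) _.
  by rewrite (splitr e); apply: ltrD hx hc.
Qed.

End ShiftModels.

(** Equivalence of two shifts in terms of their weights alone. *)
Lemma model_equiv (R : realType) (H K : hilbertType R) D g w (A A' : H -> H) E h x (B B' : K -> K) :
  shift_model D g w A A' -> shift_model E h x B B' ->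
  (algebraically_equivalent A B <->
   forall q (r : rat), 0 <= r ->
     bnd (embed q) w D (ratr r ^+ 2) <-> bnd (embed q) x E (ratr r ^+ 2)).
Proof.
move=> mA mB.
rewrite (equiv_rational_norms (sm_bounded mA) (sm_adjoint mA) (sm_bounded mB) (sm_adjoint mB)).
split=> hq q r r0; have r0' : 0 <= ratr r :> R by rewrite ler0q.
  by rewrite -(model_obd mA) // -(model_obd mB) //; exact: hq.
by rewrite (model_obd mA) // (model_obd mB) //; exact: hq.
Qed.

(** * Norms determined by a set of weights *)

Section Universality.
Context {R : realType}.
Implicit Types (G : set R) (p : @spoly R) (M : R) (w : int -> R) (D : pred int).

(** M bounds the squared norm of p for all finitely supported sequences of weights
    in G: the deterministic quantity that governs the random shift when 0 is
    in G. *)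
Definition universal_bound G p M := forall w, (forall z, G (w z)) ->
  (exists lo hi : int, forall z, ~~ (lo <= z < hi) -> w z = 0) ->
  forall v, sqn p w v <= M * sqn1 v.

Definition universal G w D := forall p M, bnd p w D M <-> universal_bound G p M.

Lemma cvg_le_const (u : nat -> R) l c : u k @[k --> \oo] --> l ->
  (exists N, forall k, (N <= k)%N -> u k <= c) -> l <= c.
Proof.
move=> ul [N hN]; rewrite -(cvg_lim (@Rhausdorff R) ul).
by apply: limr_le; [apply/cvg_ex; exists l | exists N => // k /hN].
Qed.

(** Any sequence of weights in G is the pointwise limit of its truncations, which
    have weights in G because 0 is in G. *)
Lemma universal_upper G w D p M : G 0 -> (forall z, G (w z)) ->
  universal_bound G p M -> bnd p w D M.
Proof.
move=> G0 Gw hU v _.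
pose w_ (k : nat) (z : int) := if - k%:Z <= z < k%:Z then w z else 0.
have hw z : w_ k z @[k --> \oo] --> w z.
  apply: cvg_near_cst; exists (absz z).+1 => // k /= hk.
  by rewrite /w_ ifT //; lia.
apply: (cvg_le_const (sqn_cvg hw)); exists 0%N => k _; apply: hU.
  by move=> z; rewrite /w_; case: ifP.
by exists (- k%:Z), k%:Z => z hz; rewrite /w_ ifN.
Qed.

(** The condition on D keeps the window, and the finite vectors supported in it,
    away from the boundary of a unilateral shift. *)
Definition windows_dense G w D := forall w', (forall z, G (w' z)) -> forall k : nat,
  exists i : int, (forall z : int, - k%:Z <= z -> D (z + i)) /\
    forall z : int, `|z| <= k%:Z -> `|w (z + i) - w' z| < k.+1%:R^-1.

Lemma supported_window (v : fvec) : exists k : nat, supported (fun z => `|z| <= k%:Z) v.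
Proof.
elim: v => [|s v [k hk]]; first by exists 0%N.
exists (maxn k (absz s.2)); rewrite /supported /=; apply/andP; split; first by lia.
by apply: sub_all hk => t /= ; lia.
Qed.

Lemma sub_supported (D E : pred int) v : (forall z, D z -> E z) -> supported D v -> supported E v.
Proof. by move=> DE; apply: sub_all => s; exact: DE. Qed.

Lemma supported_translate D j v :
  supported D (translate j v) = supported (fun z => D (z + j)) v.
Proof. by rewrite /supported all_map. Qed.

Lemma cvg_invS (u : nat -> R) l :
  (exists N, forall k, (N <= k)%N -> `|u k - l| < k.+1%:R^-1) -> u k @[k --> \oo] --> l.
Proof.
move=> [N hN]; apply/cvgrPdist_lt => e e0.
have [n hn] := ltr_add_invr e0; rewrite add0r in hn.
exists (maxn N n) => // k /=; rewrite geq_max => /andP[/hN h1 nk].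
rewrite distrC; apply: lt_trans h1 _; apply: le_lt_trans hn.
by rewrite lef_pV2 ?posrE // ler_nat.
Qed.

(** A translate of w converges pointwise to any given sequence over G, and the
    quantity [sqn] is translation invariant and continuous. *)
Lemma windows_lower G w D p M : windows_dense G w D -> bnd p w D M ->
  universal_bound G p M.
Proof.
move=> hW hb w' Gw' _ v.
have /choice[i hi] := hW w' Gw'.
have hw z : w (z + i k) @[k --> \oo] --> w' z.
  apply: cvg_invS; exists (absz z) => k hk; case: (hi k) => _; apply; lia.
have [K hK] := supported_window v.
apply: (cvg_le_const (sqn_cvg hw)); exists K => k Kk.
rewrite sqn_translate -(sqn1_translate (i k)); apply: hb.
rewrite supported_translate; apply: sub_supported hK => z hz.
by apply: (hi k).1; lia.
Qed.

(** The flanking zeros are exact; for i = 0 in a unilateral shift the left one is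
    the zero weight of the extension to int. *)
Definition blocks_dense G1 w D := forall N (c : nat -> R), (forall l, (l < N)%N -> G1 (c l)) ->
  forall e : R, 0 < e -> exists i : int, [/\ D i, w (i - 1) = 0, w (i + N%:Z) = 0 &
    forall l, (l < N)%N -> `|w (i + l%:Z) - c l| < e].

Definition upward D := forall z z', z <= z' -> D z -> D z'.

(** A vector supported in one block only sees the weights of that block, and these
    are approximated by blocks of w. *)
Lemma block_lower G1 w D p M w' lo hi u : upward D -> blocks_dense G1 w D -> bnd p w D M ->
  lo <= hi -> w' (lo - 1) = 0 -> w' hi = 0 -> (forall z, lo <= z < hi -> G1 (w' z)) ->
  supported (fun z => lo <= z <= hi) u -> sqn p w' u <= M * sqn1 u.
Proof.
move=> uD hB hb lh w1 w2 w'G hu.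
pose N := absz (hi - lo).
have hc l : (l < N)%N -> G1 (w' (lo + l%:Z)) by move=> lN; apply: w'G; lia.
have /choice[i hi_] : forall k : nat, exists i : int, [/\ D i, w (i - 1) = 0, w (i + N%:Z) = 0 &
    forall l, (l < N)%N -> `|w (i + l%:Z) - w' (lo + l%:Z)| < k.+1%:R^-1].
  by move=> k; apply: hB => //; rewrite invr_gt0.
pose x (k : nat) (z : int) := if lo <= z < hi then w (z + (i k - lo)) else w' z.
have hx z : x k z @[k --> \oo] --> w' z.
  rewrite /x; case: (boolP (lo <= z < hi)) => hz; last exact: cvg_cst.
  apply: cvg_invS; exists 0%N => k _; have [_ _ _] := hi_ k.
  move=> /(_ (absz (z - lo))); have -> : i k + (absz (z - lo))%:Z = z + (i k - lo) by lia.
  have -> : lo + (absz (z - lo))%:Z = z by lia.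
  by apply; lia.
apply: (cvg_le_const (sqn_cvg hx)); exists 0%N => k _.
have [Di z1 z2 _] := hi_ k.
rewrite (@sqn_block _ p (x k) (fun z => w (z + (i k - lo))) lo hi u) //.
- rewrite sqn_translate -(sqn1_translate (i k - lo)); apply: hb.
  rewrite supported_translate; apply: sub_supported hu => z hz.
  by apply: uD Di; lia.
- by move=> z hz; rewrite /x hz.
- by rewrite /x ifN //; lia.
- by rewrite -z1; congr w; lia.
- by rewrite /x ifN //; lia.
- by rewrite -z2; congr w; lia.
Qed.

(** A finitely supported sequence splits at its zeros into blocks with nonzero
    weights, and the squared norms add up over the blocks. *)
Lemma blocks_lower G w D p M : upward D -> blocks_dense (G `\ 0) w D -> bnd p w D M ->
  universal_bound G p M.
Proof.
move=> uD hB hb w' Gw' [lo0 [hi0 w'0]] v.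
suff key (n : nat) lo hi u : (absz (hi - lo) <= n)%N -> lo <= hi -> w' (lo - 1) = 0 -> w' hi = 0 ->
    supported (fun z => lo <= z <= hi) u -> sqn p w' u <= M * sqn1 u.
  have [k hk] := supported_window v.
  pose a := Num.min lo0 (- k%:Z); pose b := Num.max hi0 k%:Z.
  apply: (key _ a b v (leqnn _)).
  - by rewrite /a /b; lia.
  - by apply: w'0; rewrite /a; lia.
  - by apply: w'0; rewrite /b; lia.
  - by apply: sub_supported hk => z; rewrite /a /b; lia.
elim: n lo hi u => [|n IH] lo hi u hn lh w1 w2 hu;
  have [[j [hj wj]]|nz] := pselect (exists j, lo <= j < hi /\ w' j = 0).
- by lia.
- by apply: (block_lower uD hB hb lh w1 w2) => // z hz; split=> // z0; apply: nz; exists z.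
- rewrite (sqn_cut p u wj) (sqn1_cut j u) mulrDr lerD //.
    apply: (IH lo j) => //; [lia|lia|].
    rewrite /supported all_filter; apply: sub_all hu => s /=.
    by move=> h; apply/implyP; lia.
  apply: (IH (j + 1) hi) => //; [lia|lia|by rewrite addrK|].
  rewrite /supported all_filter; apply: sub_all hu => s /=.
  by move=> h; apply/implyP; lia.
- by apply: (block_lower uD hB hb lh w1 w2) => // z hz; split=> // z0; apply: nz; exists z.
Qed.

End Universality.

(** * Detecting patterns of weights *)

Definition blockprod (R : realType) (w : int -> R) (n : int) (k : nat) : R :=
  \prod_(l < k) w (n + l%:Z).

Section DiagonalOperators.
Context {R : realType} {H : hilbertType R}.

Lemma nrm_uniq_sum (E : pred int) (u : int -> H) (d : int -> R[i]) (r : seq int) :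
  (forall m n, hdot H (u m) (u n) = ((m == n) && E m)%:R) -> uniq r ->
  nrm (\sum_(z <- r) d z *: u z) ^+ 2 = \sum_(z <- r | E z) cnorm (d z) ^+ 2.
Proof.
move=> hu; elim: r => [|z r IH] /=; first by rewrite !big_nil nrm0 expr0n.
move=> /andP[zr ur]; apply: (@complexI R); rewrite -dot_nrm !big_cons.
have o : hdot H (u z) (\sum_(j <- r) d j *: u j) = 0.
  rewrite dot_sumr big_seq big1 // => j jr; rewrite dotZr hu.
  have [zj|_] := eqVneq z j; first by move: zr; rewrite zj jr.
  by rewrite mulr0.
rewrite dotDl !dotDr !dotZl !dotZr o mulr0 addr0 hu eqxx.
rewrite (dotC (u z)) o rmorph0 !mulr0 add0r dot_nrm IH //=.
case: ifP => Ez; last by rewrite !mulr0 add0r.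
by rewrite mulr1 -normCK cnormE -rmorphXn -rmorphD.
Qed.

Variables (D : pred int) (g : int -> H) (w : int -> R) (A A' : H -> H).
Hypothesis M : shift_model D g w A A'.

Lemma vec_uniq v : supported D v -> exists (r : seq int) (d : int -> R[i]),
  [/\ uniq r, all D r & vec g v = \sum_(z <- r) d z *: g z].
Proof.
move=> hv; exists (undup (map snd v)), (fun z => \sum_(s <- v | s.2 == z) gauss s.1).
split; first exact: undup_uniq.
  apply/allP => z; rewrite mem_undup => /mapP[s sv ->].
  by move/allP: hv; apply.
under eq_bigr do rewrite scaler_suml.
rewrite (exchange_big_dep predT) //= /vec; apply: eq_big_seq => s sv.
rewrite (eq_bigl (fun z => z == s.2)); last by move=> z; rewrite eq_sym.
rewrite -big_filter filter_pred1_uniq ?big_seq1 ?undup_uniq // mem_undup.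
by apply/mapP; exists s.
Qed.

(** The vectors g (n + k) are orthogonal and of norm at most 1, so S is bounded by the
    supremum of its coefficients. *)
Lemma weighted_obd (S : H -> H) (s : int -> R) k m : bounded_operator S -> 0 <= m ->
  (forall n, S (g n) = (s n)%:C *: g (n + k)) -> (forall n, D n -> `|s n| <= m) ->
  obd S m.
Proof.
move=> bS m0 hS hs; have lS := bop_lin bS.
apply: (obd_dense M bS m0) => v /vec_uniq[r [d [ur Dr ->]]].
rewrite -(@ler_pXn2r _ 2) ?nnegrE ?mulr_ge0 ?nrm_ge0 // exprMn (lin_sum _ _ lS).
under eq_bigr do rewrite (linZ _ _ lS) hS scalerA.
rewrite (nrm_uniq_sum (E := fun z => D (z + k)) (u := fun z => g (z + k))
  (fun z => d z * (s z)%:C)) //; last first.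
  by move=> i j; rewrite (sm_ortho M) (inj_eq (addIr k)).
rewrite (nrm_uniq_sum d (sm_ortho M)) // mulr_sumr big_mkcond [leRHS]big_mkcond.
rewrite big_seq [leRHS]big_seq; apply: ler_sum => z zr; move/allP: Dr => /(_ _ zr) Dz; rewrite Dz.
case: ifP => _; last by rewrite mulr_ge0 ?sqr_ge0.
rewrite cnormM exprMn mulrC ler_wpM2r ?sqr_ge0 // cnorm_real.
by rewrite ler_pXn2r ?nnegrE //; exact: hs.
Qed.

Lemma sm_nrm n : D n -> nrm (g n) = 1.
Proof.
move=> Dn; have := dot_nrm (g n); rewrite (sm_ortho M) eqxx Dn => /(@complexI R 1) h.
by apply/eqP; rewrite -(@eqrXn2 _ 2) ?nrm_ge0 // -h expr1n.
Qed.

Lemma wev_power k n : wev A A' (nseq k true) (g n) = (blockprod w n k)%:C *: g (n + k%:Z).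
Proof.
have lA := bop_lin (sm_bounded M).
elim: k => [|k IH] /=; first by rewrite /blockprod big_ord0 scale1r addr0.
rewrite IH (linZ _ _ lA) (sm_shift M) scalerA /blockprod big_ord_recr /= rmorphM.
by congr (_ *: g _); lia.
Qed.

Lemma wev_back_power k n : wev A A' (nseq k false) (g (n + k%:Z)) = (blockprod w n k)%:C *: g n.
Proof.
have lA := adj_lin (sm_adjoint M).
elim: k n => [|k IH] n /=; first by rewrite /blockprod big_ord0 scale1r addr0.
have -> : n + k.+1%:Z = (n + 1) + k%:Z by lia.
rewrite IH (linZ _ _ lA) (sm_back M) scalerA addrK /blockprod big_ord_recl /= rmorphM mulrC addr0.
congr (_ * (_ : R)%:C *: _); apply: eq_bigr => l _; congr w; rewrite /bump /=; lia.
Qed.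

Lemma wev_diagonal k n :
  wev A A' (nseq k false ++ nseq k true) (g n) = (blockprod w n k ^+ 2)%:C *: g n.
Proof.
rewrite wev_cat /= wev_power (linZ _ _ (bop_lin (wev_bop (sm_bounded M) (sm_adjoint M) _))).
by rewrite wev_back_power scalerA -rmorphM.
Qed.

End DiagonalOperators.

(** Used to recover nonnegative weights from their squares. *)
Lemma cvg_sqr (R : realType) (u : nat -> R) (l : R) : (forall k, 0 <= u k) -> 0 <= l ->
  u k ^+ 2 @[k --> \oo] --> l ^+ 2 -> u k @[k --> \oo] --> l.
Proof.
move=> u0 l0 h.
have hs : Num.sqrt (u k ^+ 2) @[k --> \oo] --> Num.sqrt (l ^+ 2).
  exact: (cvg_comp _ _ h (@sqrt_continuous R (l ^+ 2))).
rewrite sqrtr_sqr ger0_norm // in hs.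
have E : (fun k => Num.sqrt (u k ^+ 2)) = u.
  by apply/funext => k; rewrite sqrtr_sqr ger0_norm.
by rewrite E in hs.
Qed.

Section PatternTest.
Context {R : realType}.
Variables (flank : bool) (c : nat -> R).

Let target k : R := (\prod_(l < k) c l) ^+ 2.

Definition deviation k : @spoly R :=
  (1, nseq k false ++ nseq k true) :: pscale ((- target k)%:C) pone.

(** The diagonal operator sum_k (A^*k A^k - target k)^2, with A A^* added when the
    weight on the left is to vanish.  Its entry at i is small exactly when the
    weights from i on are close to c, as long as no c l but the last vanishes. *)
Fixpoint test_poly (m : nat) : @spoly R :=
  if m is k.+1 then
    test_poly k ++ pmul (deviation k.+1) (deviation k.+1)
  else if flank then [:: (1, [:: true; false])] else [::].

Fixpoint test_value (w : int -> R) (n : int) (m : nat) : R :=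
  if m is k.+1 then test_value w n k + (blockprod w n k.+1 ^+ 2 - target k.+1) ^+ 2
  else if flank then w (n - 1) ^+ 2 else 0.

Lemma test_value_ge0 w n m : 0 <= test_value w n m.
Proof.
elim: m => [|m IH] /=; first by case: flank => //; exact: sqr_ge0.
by rewrite addr_ge0 // sqr_ge0.
Qed.

Lemma ev_test_poly (H : hilbertType R) (D : pred int) (g : int -> H) (w : int -> R) (A A' : H -> H) m n :
  shift_model D g w A A' -> ev A A' (test_poly m) (g n) = (test_value w n m)%:C *: g n.
Proof.
move=> M; have lA := bop_lin (sm_bounded M).
elim: m => [|k IH].
  rewrite /=; case: flank; last by rewrite ev_nil scale0r.
  rewrite /ev big_seq1 /= scale1r (sm_back M) (linZ _ _ lA) (sm_shift M) subrK scalerA.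
  by rewrite -rmorphM -expr2.
have -> : test_poly k.+1 = test_poly k ++ pmul (deviation k.+1) (deviation k.+1) by [].
rewrite ev_cat IH (ev_pmul (sm_bounded M) (sm_adjoint M)) [X in X + _ = _]/=.
set d := deviation _.
have hd : ev A A' d (g n) = (blockprod w n k.+1 ^+ 2 - target k.+1)%:C *: g n.
  rewrite /d ev_cons ev_pscale ev_pone scale1r (wev_diagonal M) -scalerDl.
  by rewrite -rmorphD.
have ld := bop_lin (ev_bop (sm_bounded M) (sm_adjoint M) d).
by rewrite /= hd (linZ _ _ ld) hd scalerA -scalerDl -rmorphM -rmorphD -expr2.
Qed.

Definition pattern (w : int -> R) (D : pred int) (m : nat) (e : R) (i : int) :=
  [/\ D i, flank -> w (i - 1) < e & forall l, (l < m)%N -> `|w (i + l%:Z) - c l| < e].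

Lemma cvg_blockprod (w_ : nat -> int -> R) (i : nat -> int) k :
  (forall l, (l < k)%N -> (w_ n (i n + l%:Z)) @[n --> \oo] --> c l) ->
  blockprod (w_ n) (i n) k @[n --> \oo] --> \prod_(l < k) c l.
Proof.
rewrite /blockprod; elim: k => [|k IH] h.
  rewrite big_ord0; under eq_fun do rewrite big_ord0; exact: cvg_cst.
rewrite big_ord_recr /=; under eq_fun do rewrite big_ord_recr /=.
by apply: cvgM; [apply: IH => l lk; apply: h; exact: ltnW | exact: h].
Qed.

Lemma pattern_small (w : int -> R) (D : pred int) m : (forall z, 0 <= w z) ->
  (forall e : R, 0 < e -> exists i, pattern w D m e i) ->
  forall e : R, 0 < e -> exists2 i, D i & test_value w i m < e.
Proof.
move=> w0 hp e e0.
have /choice[i hi] : forall k : nat, exists i, pattern w D m k.+1%:R^-1 i.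
  by move=> k; apply: hp; rewrite invr_gt0.
have hw l : (l < m)%N -> w (i k + l%:Z) @[k --> \oo] --> c l.
  by move=> lm; apply: cvg_invS; exists 0%N => k _; case: (hi k) => _ _; exact.
have hl : flank -> w (i k - 1) @[k --> \oo] --> 0.
  move=> fl; apply: cvg_invS; exists 0%N => k _; case: (hi k) => _ /(_ fl) h _.
  by rewrite subr0 ger0_norm.
have ht k : (k <= m)%N -> test_value w (i n) k @[n --> \oo] --> 0.
  elim: k => [_|k IH km] /=.
    case: (flank) hl => hl; last exact: cvg_cst.
    rewrite -[0](mulr0 0); under eq_fun do rewrite expr2.
    exact: cvgM (hl isT) (hl isT).
  rewrite -[0]addr0; apply: cvgD; first by apply: IH; exact: ltnW.
  have hb : blockprod w (i n) k.+1 @[n --> \oo] --> \prod_(l < k.+1) c l.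
    by apply: (@cvg_blockprod (fun=> w)) => l lk; apply: hw; exact: leq_trans lk km.
  have hb2 : blockprod w (i n) k.+1 ^+ 2 - target k.+1 @[n --> \oo] --> 0.
    rewrite -(subrr (target k.+1)); apply: cvgB; last exact: cvg_cst.
    by rewrite /target expr2; under eq_fun do rewrite expr2; exact: cvgM.
  by rewrite -[0](mulr0 0); under eq_fun do rewrite expr2; exact: cvgM.
have /cvgrPdist_lt /(_ e e0)[N _ hN] := ht m (leqnn m).
exists (i N); first by case: (hi N).
by have := hN N (leqnn N); rewrite /= sub0r normrN ger0_norm // test_value_ge0.
Qed.

Hypothesis c_ge0 : forall l, 0 <= c l.

(** The test controls products of consecutive weights; a single weight is a quotient
    of two of them, which requires the limits of the denominators to be nonzero.
    The last weight of the pattern is in no denominator and may vanish. *)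
Lemma small_pattern (w : int -> R) (D : pred int) m : (forall z, 0 <= w z) ->
  (forall l, (l.+1 < m)%N -> c l != 0) ->
  (forall e : R, 0 < e -> exists2 i, D i & test_value w i m < e) ->
  forall e : R, 0 < e -> exists i, pattern w D m e i.
Proof.
move=> w0 c0 hs e e0.
have /choice[i hi] : forall k : nat, exists i, D i /\ test_value w i m < k.+1%:R^-1.
  move=> k; have [|i Di hi] := hs k.+1%:R^-1; first by rewrite invr_gt0.
  by exists i.
have sub k n : (k <= m)%N -> test_value w n k <= test_value w n m.
  move=> /subnK <-; elim: (m - k)%N => //= l IH; apply: le_trans IH _.
  by rewrite lerDl sqr_ge0.
have small0 (u : nat -> R) : (forall k, 0 <= u k) -> (forall k, u k ^+ 2 <= test_value w (i k) m) ->
    u k @[k --> \oo] --> 0.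
  move=> u0 ut; have hu2 : u k ^+ 2 @[k --> \oo] --> 0.
    apply: cvg_invS; exists 0%N => k _; rewrite subr0 ger0_norm ?sqr_ge0 //.
    by apply: le_lt_trans (ut k) _; case: (hi k).
  by apply: cvg_sqr => //; rewrite expr0n.
have hP k : (k <= m)%N -> blockprod w (i n) k @[n --> \oo] --> \prod_(l < k) c l.
  case: k => [_|k km].
    rewrite big_ord0 /blockprod; under eq_fun do rewrite big_ord0; exact: cvg_cst.
  have P0 n : 0 <= blockprod w n k.+1 by apply: prodr_ge0.
  have h2 : `|blockprod w (i n) k.+1 ^+ 2 - target k.+1| @[n --> \oo] --> 0.
    apply: small0 => // n; rewrite real_normK ?num_real //.
    apply: le_trans (sub k.+1 (i n) km) => /=.
    by rewrite lerDr test_value_ge0.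
  have h3 : blockprod w (i n) k.+1 ^+ 2 @[n --> \oo] --> target k.+1.
    by apply/subr_cvg0; apply: norm_cvg0.
  by apply: cvg_sqr h3 => //; apply: prodr_ge0.
have hc l : (l < m)%N -> w (i n + l%:Z) @[n --> \oo] --> c l.
  move=> lm.
  have Pl0 : \prod_(j < l) c j != 0.
    apply/prodf_neq0 => j _; apply: c0; apply: leq_ltn_trans lm; exact: ltn_ord.
  have h1 := hP l (ltnW lm); have h2 := hP l.+1 lm.
  have h3 : blockprod w (i n) l.+1 * (blockprod w (i n) l)^-1 @[n --> \oo] --> c l.
    have := cvgM h2 (cvgV Pl0 h1).
    rewrite big_ord_recr /= mulrAC mulfV // mul1r. exact.
  have /cvgr_neq0 /(_ Pl0) [N1 _ hN1] := h1.
  apply/cvgrPdist_lt => d d0; have /cvgrPdist_lt /(_ d d0) [N2 _ hN2] := h3.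
  exists (maxn N1 N2) => // n /=; rewrite geq_max => /andP[/hN1 n1 /hN2 /=].
  by rewrite /blockprod big_ord_recr /= mulrAC mulfV // mul1r.
have hf : flank -> w (i n - 1) @[n --> \oo] --> 0.
  move=> fl; apply: small0 => // k; apply: le_trans (sub 0%N (i k) (leq0n _)).
  by rewrite /= fl.
have /choice[N hN] : forall l : nat, exists N, (l < m)%N -> forall n, (N <= n)%N ->
    `|w (i n + l%:Z) - c l| < e.
  move=> l; have [lm|ml] := ltnP l m; last by exists 0%N.
  have /cvgrPdist_lt /(_ e e0)[N _ hN] := hc l lm.
  by exists N => _ n Nn; rewrite distrC; exact: hN.
have [N1 hN1] : exists N, flank -> forall n, (N <= n)%N -> w (i n - 1) < e.
  case: (flank) hf => [/(_ isT)|]; last by exists 0%N.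
  move=> /cvgrPdist_lt /(_ e e0)[K _ hK].
  by exists K => _ n Kn; have := hK n Kn; rewrite /= sub0r normrN ger0_norm.
exists (i (maxn N1 (\max_(l < m) N l))); split.
- by case: (hi (maxn N1 (\max_(l < m) N l))).
- by move=> fl; apply: hN1 => //; rewrite leq_maxl.
- move=> l lm; apply: hN => //; rewrite leq_max; apply/orP; right.
  exact: (leq_bigmax (Ordinal lm)).
Qed.

End PatternTest.

(** The infimum of the entries of the test operator is the quantity M1 minus the
    norm of M1 - test_poly for large M1, hence an invariant of algebraic
    equivalence. *)
Theorem pattern_transfer (R : realType) (H K : hilbertType R) D g w (A A' : H -> H)
    E h x (B B' : K -> K) flank (c : nat -> R) m :
  shift_model D g w A A' -> shift_model E h x B B' -> algebraically_equivalent A B ->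
  (forall l, 0 <= c l) -> (forall l, (l.+1 < m)%N -> c l != 0) ->
  (forall e : R, 0 < e -> exists i, pattern flank c x E m e i) ->
  forall e : R, 0 < e -> exists i, pattern flank c w D m e i.
Proof.
move=> mA mB eqv c0 cn0 hB; apply: (small_pattern c0 (sm_ge0 mA) cn0) => e e0.
apply: contrapT => nsmall.
have big n : D n -> e <= test_value flank c w n m.
  by move=> Dn; rewrite leNgt; apply/negP => lt; apply: nsmall; exists n.
have bA := sm_bounded mA; have aA := sm_adjoint mA.
have bB := sm_bounded mB; have aB := sm_adjoint mB.
have /bopP[_ [M M0 hM]] := ev_bop bA aA (test_poly flank c m).
have testM n : D n -> test_value flank c w n m <= M.
  move=> Dn; have := hM (g n); rewrite (ev_test_poly _ _ _ _ mA) nrmZ (sm_nrm mA Dn) !mulr1.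
  by rewrite cnorm_real ger0_norm // test_value_ge0.
(* the entries of M1 - test_poly are then between 0 and M on A *)
pose M1 := M + e.
pose p := pscale M1%:C pone ++ pscale (-1) (test_poly flank c m).
have hp (L : hilbertType R) (F : pred int) (k : int -> L) (y : int -> R) C C' n :
    shift_model F k y C C' -> ev C C' p (k n) = (M1 - test_value flank c y n m)%:C *: k n.
  move=> mC; rewrite ev_cat !ev_pscale ev_pone (ev_test_poly _ _ _ _ mC) scaleN1r -scalerBl.
  by rewrite -rmorphB.
have oA : obd (ev A A' p) M.
  apply: (weighted_obd mA (k := 0) (ev_bop bA aA p) M0 (s := fun n => M1 - test_value flank c w n m)).
    by move=> n; rewrite (hp _ _ _ _ _ _ _ mA) addr0.
  move=> n Dn; have h1 := big n Dn; have h2 := testM n Dn.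
  by rewrite /M1 ger0_norm; lra.
have /(equiv_isometric bA aA bB aB eqv p M0) oB := oA.
have [j Ej hj] := pattern_small (sm_ge0 mB) hB e0.
have := oB (h j); rewrite (hp _ _ _ _ _ _ _ mB) nrmZ (sm_nrm mB Ej) !mulr1 cnorm_real.
move=> /(le_trans (ler_norm _)); rewrite /M1; lra.
Qed.

(** * Patterns in independent sequences *)

Section IndependentEvents.
Local Open Scope ereal_scope.
Context (d : measure_display) (Omega : measurableType d) (R : realType)
  (P : probability Omega R).

Lemma negligible_countable (I : countType) (F : I -> set Omega) :
  (forall i, P.-negligible (F i)) -> P.-negligible (\bigcup_i F i).
Proof.
move=> hF; apply: (@negligibleS _ _ _ P
  (\bigcup_n (if unpickle n is Some i then F i else set0))).
  by move=> x [i _ Fx]; exists (pickle i) => //; rewrite pickleK.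
apply: negligible_bigcup => n; case: (unpickle n) => [i|]; first exact: hF.
exact: negligible_set0.
Qed.

Variables (E : nat -> set Omega) (q : R).
Hypothesis mE : forall b, measurable (E b).
Hypothesis indE : forall S : seq nat, uniq S ->
  P (\bigcap_(b in [set` S]) E b) = (q ^+ size S)%:E.

Lemma measurable_bigcap_seq (S : seq nat) : measurable (\bigcap_(b in [set` S]) E b).
Proof. by apply: bigcap_measurableType => b _; exact: mE. Qed.

(** The events E b are used together with their complements, so the product formula
    has to be extended from intersections to these mixed intersections. *)
Lemma independent_none k (S : seq nat) : uniq S -> (forall b, b \in S -> (k <= b)%N) ->
  P ((\bigcap_(b in `I_k) ~` E b) `&` \bigcap_(b in [set` S]) E b) =
  ((1 - q) ^+ k * q ^+ size S)%:E.
Proof.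
elim: k S => [|k IH] S uS kS.
  have -> : \bigcap_(b in `I_0) ~` E b = setT by apply/seteqP; split=> // x _ b.
  by rewrite setTI indE // expr0 mul1r.
have kS' : k \notin S by apply/negP => /kS; rewrite ltnn.
pose Z := \bigcap_(b in `I_k) ~` E b; pose I_ := \bigcap_(b in [set` S]) E b.
have mZ : measurable Z.
  by apply: bigcap_measurableType => b _; exact: measurableC.
have -> : (\bigcap_(b in `I_k.+1) ~` E b) `&` I_ =
    (Z `&` I_) `\` (Z `&` \bigcap_(b in [set` k :: S]) E b).
  apply/seteqP; split => x.
    move=> [h1 h2]; split; first by split=> // b bk; apply: h1; exact: ltnW.
    by move=> [_ h]; apply: (h1 k (ltnSn k)); apply: h; rewrite /= inE eqxx.
  move=> [[h1 h2] h3]; split=> // b; rewrite /= ltnS leq_eqVlt => /predU1P[->|/h1//].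
  move=> Ek; apply: h3; split=> // c; rewrite /= inE => /predU1P[->//|cS].
  exact: h2.
have mI (T : seq nat) : measurable (Z `&` \bigcap_(b in [set` T]) E b).
  by apply: measurableI => //; exact: measurable_bigcap_seq.
rewrite measureD; [|exact: mI|exact: (mI (k :: S))|]; last first.
  by rewrite ltey_eq fin_num_measure //; exact: mI.
have -> : Z `&` I_ `&` (Z `&` \bigcap_(b in [set` k :: S]) E b) =
    Z `&` \bigcap_(b in [set` k :: S]) E b.
  apply: setIidr => x [Zx h]; split=> // b bS; apply: h.
  by rewrite /= inE; apply/orP; right.
have h1 := IH S uS (fun b bS => ltnW (kS b bS)).
have h2 : P (Z `&` \bigcap_(b in [set` k :: S]) E b) =
    ((1 - q) ^+ k * q ^+ (size S).+1)%:E.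
  apply: (IH (k :: S)); first by rewrite /= kS'.
  by move=> b; rewrite inE => /predU1P[->//|/kS/ltnW].
transitivity (((1 - q) ^+ k * q ^+ size S)%:E - ((1 - q) ^+ k * q ^+ (size S).+1)%:E).
  by congr (_ - _); [exact: h1 | exact: h2].
by rewrite -EFinB; congr EFin; rewrite !exprS; ring.
Qed.

(** The probability (1 - q)^N that none of N independent events occurs tends to 0. *)
Lemma independent_some : (0 < q)%R -> P.-negligible (\bigcap_b ~` E b).
Proof.
move=> q0.
have mZ (A : set nat) : measurable (\bigcap_(b in A) ~` E b).
  by apply: bigcap_measurableType => b _; exact: measurableC.
have q1 : (q <= 1)%R.
  have := @probability_le1 _ _ _ P _ (mE 0).
  have := @indE [:: 0%N] isT; rewrite expr1.
  have -> : \bigcap_(b in [set` [:: 0%N]]) E b = E 0%N.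
    apply/seteqP; split=> x; first by apply; rewrite /= inE.
    by move=> Ex b; rewrite /= inE => /eqP ->.
  by move=> ->; rewrite lee_fin.
apply/negligibleP => //; apply/eqP; rewrite eq_le measure_ge0 andbT.
apply/lee_addgt0Pr => e e0; rewrite add0e.
have /cvgrPdist_lt /(_ e e0) [N _ hN] := @cvg_expr R (1 - q)%R ltac:(rewrite ger0_norm; lra).
apply: le_trans (_ : P (\bigcap_(b in `I_N) ~` E b) <= _).
  by apply: le_measure; rewrite ?inE // => x h b _; exact: h.
have := @independent_none N [::] isT ltac:(by []).
have -> : \bigcap_(b in [set` [::]]) E b = setT by apply/seteqP; split=> // x _ b.
rewrite setIT expr0 mulr1 => ->; rewrite lee_fin.
have := hN N (leqnn N); rewrite /= sub0r normrN => h.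
by apply: le_trans (ltW h); exact: ler_norm.
Qed.

End IndependentEvents.

Section IID.
Context (R : realType) (d : measure_display) (Omega : measurableType d)
  (P : probability Omega R) (X : nat -> {RV P >-> R}).
Hypothesis Xindep : mutually_independent X.
Hypothesis Xid : identically_distributed X.

Lemma measurable_preimage_RV n (B : set R) : measurable B -> measurable (X n @^-1` B).
Proof. by move=> mB; rewrite -[X in measurable X]setTI; exact: measurable_funPT. Qed.

Lemma same_law n (B : set R) : measurable B -> P (X n @^-1` B) = P (X 0%N @^-1` B).
Proof. by move=> mB; exact: Xid. Qed.

Definition block_event (N : nat) (B : nat -> set R) (b : nat) : set Omega :=
  \bigcap_(l in `I_N) X (b * N + l)%N @^-1` B l.

Lemma measurable_block_event N B b : (forall l, measurable (B l)) ->
  measurable (block_event N B b).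
Proof.
by move=> mB; apply: bigcap_measurableType => l _; exact: measurable_preimage_RV.
Qed.

(** Disjoint blocks of indices define independent events. *)
Lemma block_events_independent N (B : nat -> set R) (S : seq nat) : (0 < N)%N ->
  (forall l, measurable (B l)) -> uniq S ->
  P (\bigcap_(b in [set` S]) block_event N B b) =
  ((\prod_(l < N) fine (P (X 0%N @^-1` B l))) ^+ size S)%:E.
Proof.
move=> N0 mB uS.
pose J := [seq (b * N + l)%N | b <- S, l <- iota 0 N].
have dm (b l : nat) : (l < N)%N -> ((b * N + l) %/ N = b /\ (b * N + l) %% N = l)%N.
  by move=> lN; rewrite divnMDl // divn_small // addn0 modnMDl modn_small.
have uJ : uniq J.
  apply: allpairs_uniq => //; first exact: iota_uniq.
  move=> [b l] [b' l'] /allpairsPdep[x [y [_ yN [-> ->]]]] /allpairsPdep[x' [y' [_ yN' [-> ->]]]] /=.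
  move: yN yN'; rewrite !mem_iota !add0n /= => yN yN' e.
  have [h1 h2] := dm x y yN; have [h3 h4] := dm x' y' yN'.
  have ex : x = x' by rewrite -h1 e.
  have ey : y = y' by rewrite -h2 e.
  by rewrite ex ey.
have := Xindep (B := fun j => B (j %% N)%N) uJ (fun j => mB _).
have -> : \bigcap_(j in [set` J]) X j @^-1` B (j %% N)%N =
    \bigcap_(b in [set` S]) block_event N B b.
  apply/seteqP; split => x h.
    move=> b bS l lN; have [_ h2] := dm b l lN.
    have := h (b * N + l)%N; rewrite h2; apply.
    by apply/allpairsPdep; exists b, l; rewrite mem_iota add0n.
  move=> j /allpairsPdep[b [l [bS lN ->]]].
  rewrite mem_iota add0n /= in lN; have [_ ->] := dm b l lN.
  exact: h.
move=> ->; rewrite big_allpairs_dep /=.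
transitivity (\prod_(b <- S) (\prod_(l < N) fine (P (X 0%N @^-1` B l)))%:E)%E.
  apply: eq_bigr => b _.
  have -> : iota 0 N = index_iota 0 N by rewrite /index_iota subn0.
  rewrite big_mkord.
  rewrite -prodEFin; apply: eq_bigr => l _.
  have [_ ->] := dm b l (ltn_ord l).
  rewrite same_law // fineK //; apply: fin_num_measure; exact: measurable_preimage_RV.
by rewrite prodEFin big_const_seq count_predT iter_mulr_1.
Qed.

(** The events on disjoint blocks are independent with a common positive
    probability. *)
Lemma pattern_occurs N (B : nat -> set R) : (0 < N)%N -> (forall l, measurable (B l)) ->
  (forall l, (l < N)%N -> (0 < P (X 0%N @^-1` B l))%E) ->
  P.-negligible [set w | ~ exists b, block_event N B b w].
Proof.
move=> N0 mB pB.
have := @independent_some _ _ _ P (block_event N B) (\prod_(l < N) fine (P (X 0%N @^-1` B l)))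
  (fun b => @measurable_block_event N B b mB)
  (fun S => @block_events_independent N B S N0 mB).
have q0 : 0 < \prod_(l < N) fine (P (X 0%N @^-1` B l)).
  apply: prodr_gt0 => l _; apply: fine_gt0; rewrite pB //=.
  by rewrite ltey_eq fin_num_measure //; exact: measurable_preimage_RV.
move=> /(_ q0); apply: negligibleS => w h b _ hb; apply: h; by exists b.
Qed.

Let G := essran (X 0%N).

Lemma essran_closed : closed G.
Proof.
move=> x hx U oU Ux; have [y [Gy Uy]] := hx U ltac:(exact: open_nbhs_nbhs).
exact: Gy.
Qed.

(** The complement of the essential range is a countable union of rational balls of
    measure zero. *)
Lemma ae_in_essran : P.-negligible [set w | ~ forall n, G (X n w)].
Proof.
pose F (i : nat * (rat * rat)) : set Omega :=
  let I := ball (ratr i.2.1 : R) (ratr i.2.2) in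
  if `[< P (X 0%N @^-1` I) = 0%E >] then X i.1 @^-1` I else set0.
apply: (@negligibleS _ _ _ P (\bigcup_i F i)); last first.
  apply: negligible_countable => -[n [p q]]; rewrite /F /=.
  case: asboolP => h; last exact: negligible_set0.
  have mB : measurable (ball (ratr p : R) (ratr q) : set R) by apply: open_measurable; exact: ball_open.
  apply/negligibleP; first exact: measurable_preimage_RV.
  exact: etrans (same_law n mB) h.
move=> w /existsNP[n] /existsNP[U] /not_implyP[oU /not_implyP[Ux PU]].
have [c [r /= [xB BU]]] := open_subball_rat oU (mem_set Ux).
exists (n, (c, r)) => //; rewrite /F /= ifT; first exact: set_mem.
apply/asboolP; apply/eqP; rewrite eq_le measure_ge0 andbT leNgt; apply/negP => p0.
apply: PU; apply: lt_le_trans p0 _; apply: le_measure.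
- by rewrite inE; apply: measurable_preimage_RV; apply: open_measurable; exact: ball_open.
- by rewrite inE; apply: measurable_preimage_RV; exact: open_measurable.
- by move=> v /=; exact: BU.
Qed.

Lemma essran_pos (x : R) (U : set R) : G x -> open U -> U x -> (0 < P (X 0%N @^-1` U))%E.
Proof. by move=> Gx oU Ux; exact: Gx. Qed.

(** Rational words and tolerances 1 / k form a countable family from which all words
    over the essential range and all tolerances are recovered. *)
Lemma ae_windows : P.-negligible [set w | ~ forall (N : nat) (c : nat -> R),
  (forall l, (l < N)%N -> G (c l)) -> forall e : R, 0 < e ->
  exists i : nat, forall l, (l < N)%N -> `|X (i + l)%N w - c l| < e].
Proof.
pose B (s : seq rat) (k l : nat) : set R := ball (ratr (nth 0 s l) : R) k.+1%:R^-1.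
pose F (i : seq rat * nat) : set Omega :=
  if (0 < size i.1)%N && `[< forall l, (l < size i.1)%N -> (0 < P (X 0%N @^-1` B i.1 i.2 l))%E >]
  then [set w | ~ exists b, block_event (size i.1) (B i.1 i.2) b w] else set0.
apply: (@negligibleS _ _ _ P (\bigcup_i F i)); last first.
  apply: negligible_countable => -[s k]; rewrite /F /=.
  case: ifP => [/andP[s0 /asboolP h]|_]; last exact: negligible_set0.
  by apply: pattern_occurs => // l; apply: open_measurable; exact: ball_open.
move=> w /= nh; apply: contrapT => hF; apply: nh => N c Gc e e0.
have [->|N0] := posnP N; first by exists 0%N.
have e2 : 0 < e / 2 by rewrite divr_gt0.
have [k] := ltr_add_invr e2; rewrite add0r => hk.
have k0 : 0 < k.+1%:R^-1 :> R by rewrite invr_gt0.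
have /choice[q hq] : forall l, exists q : rat, `|ratr q - c l| < k.+1%:R^-1.
  by move=> l; exact: rat_dense.
pose s := mkseq q N.
have ns l : (l < N)%N -> nth 0 s l = q l by move=> lN; rewrite nth_mkseq.
have [b hb] : exists b, block_event (size s) (B s k) b w.
  apply: contrapT => nb; apply: hF; exists (s, k) => //; rewrite /F /= ifT //.
  rewrite size_mkseq N0 /=; apply/asboolP => l lN.
  apply: (essran_pos (Gc l lN)); first exact: ball_open.
  by rewrite /B -ball_normE /= ns //; exact: hq.
exists (b * N)%N => l lN; rewrite size_mkseq in hb.
have := hb l lN; rewrite /B -ball_normE /= ns // => h1; have h2 := hq l.
have -> : X (b * N + l)%N w - c l = - (ratr (q l) - X (b * N + l)%N w) + (ratr (q l) - c l) by ring.
apply: le_lt_trans (ler_normD _ _) _; rewrite normrN.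
by rewrite (splitr e); apply: ltrD; [exact: lt_trans h1 hk | exact: lt_trans h2 hk].
Qed.

End IID.

(** * Measurability of the equivalence events *)

Section Measurability.
Context {R : realType} (d : measure_display) (Omega : measurableType d).

Lemma measurable_forall (I : countType) (Q : I -> set Omega) :
  (forall i, measurable (Q i)) -> measurable [set w | forall i, Q i w].
Proof.
move=> mQ.
have -> : [set w | forall i, Q i w] =
    \bigcap_n (if unpickle n is Some i then Q i else setT).
  apply/seteqP; split => w /=; first by move=> h n _; case: (unpickle n).
  by move=> h i; have := h (pickle i) Logic.I; rewrite pickleK.
by apply: bigcap_measurableType => n _; case: (unpickle n).
Qed.

Lemma measurable_iff (Q S : set Omega) : measurable Q -> measurable S ->
  measurable [set w | Q w <-> S w].
Proof.
move=> mQ mS.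
have -> : [set w | Q w <-> S w] = (Q `&` S) `|` (~` Q `&` ~` S).
  apply/seteqP; split => w /=.
    move=> h; have [Qw|nQ] := pselect (Q w); first by left; split=> //; apply/h.
    by right; split=> // /h.
  by case=> -[h1 h2]; split.
by apply: measurableU; apply: measurableI => //; exact: measurableC.
Qed.

Lemma measurable_cond (b : bool) (Q : set Omega) : measurable Q ->
  measurable [set w | b -> Q w].
Proof.
case: b => mQ.
  have -> // : [set w | true -> Q w] = Q.
  by apply/seteqP; split=> w /=; [apply | move=> ? _].
have -> // : [set w | false -> Q w] = setT by apply/seteqP; split.
Qed.

Variable Y : nat -> Omega -> R.
Hypothesis mY : forall n, measurable_fun setT (Y n).

Lemma measurable_zext z : measurable_fun setT (fun w => zext (Y ^~ w) z).
Proof. by case: z => n /=; [exact: mY | exact: measurable_cst]. Qed.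

Lemma measurable_wcoef m n : measurable_fun setT (fun w => wcoef (zext (Y ^~ w)) m n).
Proof.
elim: m => [|b m IH]; first exact: measurable_cst.
by apply: measurable_funM => //; exact: measurable_zext.
Qed.

Lemma measurable_sqn p v : measurable_fun setT (fun w => sqn p (zext (Y ^~ w)) v).
Proof.
apply: measurable_sum => s; apply: measurable_sum => s'.
apply: measurable_sum => t; apply: measurable_sum => t'.
apply: measurable_funM; last exact: measurable_cst.
apply: measurable_funM; first exact: measurable_cst.
by apply: measurable_funM; exact: measurable_wcoef.
Qed.

Lemma measurable_bnd p D M : measurable [set w | bnd p (zext (Y ^~ w)) D M].
Proof.
apply: (measurable_forall (Q := fun v => [set w | supported D v -> sqn p (zext (Y ^~ w)) v <= M * sqn1 v])) => v.
apply: measurable_cond.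
have := measurable_sqn p v => mf.
rewrite -[X in measurable X]setTI.
have := mf measurableT `]-oo, (M * sqn1 v)]%classic ltac:(exact: measurable_itv).
by congr measurable; apply/seteqP; split => w /= [_]; rewrite in_itv.
Qed.

Lemma measurable_bounded_weights : measurable [set w | exists M : R, forall n, Y n w <= M].
Proof.
have -> : [set w | exists M : R, forall n, Y n w <= M] =
    \bigcup_k [set w | forall n, Y n w <= k%:R].
  apply/seteqP; split => w /=; last by move=> [k _ h]; exists k%:R.
  move=> [M hM]; exists (Num.bound `|M|) => // n.
  apply: le_trans (hM n) _; apply: le_trans (ler_norm M) _; apply: ltW; exact: archi_boundP.
apply: bigcup_measurable => k _; apply: (measurable_forall (Q := fun n => [set w | Y n w <= k%:R])) => n.
rewrite -[X in measurable X]setTI.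
have := @mY n measurableT `]-oo, k%:R]%classic ltac:(exact: measurable_itv).
by congr measurable; apply/seteqP; split => w /= [_]; rewrite in_itv.
Qed.

End Measurability.

Section EquivalenceEvents.
Context {R : realType} (H : hilbertType R) (e : nat -> H).
Hypothesis he : orthonormal_basis e.

Lemma shiftableP (t : nat -> R) : (forall n, 0 <= t n) ->
  (exists M : R, forall n, t n <= M) <-> (exists T, unilateral_shift e t T).
Proof.
move=> t0; split=> [[M hM]|[T hT]]; first exact: nat_shift_exists hM.
have [M M0 hM] := shift_weight_le hT; exists M => n; exact: le_trans (ler_norm _) (hM n).
Qed.

Lemma equiv_adjoint (K : hilbertType R) (T T' : H -> H) (A : K -> K) :
  bounded_operator T -> is_adjoint T T' -> algebraically_equivalent T A ->
  exists A', is_adjoint A A'.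
Proof.
move=> bT aT [phi [_ _ _ hadj <-]]; exists (phi T'); apply: hadj aT.
by move=> B [_]; apply.
Qed.

Variables (d : measure_display) (Omega : measurableType d) (Y : nat -> Omega -> R).
Hypothesis mY : forall n, measurable_fun setT (Y n).
Hypothesis Y0 : forall n w, 0 <= Y n w.

(** If A had no adjoint then the event would be empty; otherwise equivalence amounts
    to countably many comparisons of norms. *)
Lemma measurable_equiv_event (K : hilbertType R) (A : K -> K) : bounded_operator A ->
  measurable (equiv_event e Y A).
Proof.
move=> bA; have [[A' aA]|nA] := pselect (exists A', is_adjoint A A'); last first.
  have -> : equiv_event e Y A = set0; last exact: measurable0.
  apply/seteqP; split => // w [T sT eqv]; apply: nA.
  have [T' mT] := unilateral_model sT.
  exact: equiv_adjoint (sm_bounded mT) (sm_adjoint mT) eqv.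
have -> : equiv_event e Y A = [set w | exists M : R, forall n, Y n w <= M] `&`
   [set w | forall i : seq (rat[i] * seq bool) * rat, 0 <= i.2 ->
     (bnd (embed i.1) (zext (Y ^~ w)) nneg (ratr i.2 ^+ 2) <->
      obd (ev A A' (embed i.1)) (ratr i.2))].
  apply/seteqP; split => w.
    move=> [T sT eqv]; split; first by apply/(shiftableP (Y0 ^~ w)); exists T.
    have [T' mT] := unilateral_model sT.
    move=> [q r] /= r0; rewrite -(model_obd mT) ?ler0q //.
    by move: eqv; rewrite (equiv_rational_norms (sm_bounded mT) (sm_adjoint mT) bA aA); apply.
  move=> [/(shiftableP (Y0 ^~ w))[T sT] h]; exists T => //.
  have [T' mT] := unilateral_model sT.
  rewrite (equiv_rational_norms (sm_bounded mT) (sm_adjoint mT) bA aA) => q r r0.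
  by rewrite (model_obd mT) ?ler0q //; exact: (h (q, r)).
apply: measurableI; first exact: measurable_bounded_weights.
apply: measurable_forall => -[q r] /=; apply: measurable_cond.
apply: (measurable_iff (S := [set w | obd (ev A A' (embed q)) (ratr r)])).
  exact: measurable_bnd.
have [h|h] := pselect (obd (ev A A' (embed q)) (ratr r)).
  have -> // : [set _ : Omega | obd (ev A A' (embed q)) (ratr r)] = setT.
  by apply/seteqP; split.
have -> // : [set _ : Omega | obd (ev A A' (embed q)) (ratr r)] = set0.
by apply/seteqP; split.
Qed.

Lemma measurable_equiv_event2 : measurable (equiv_event2 e Y).
Proof.
pose Y1 n (w : Omega * Omega) := Y n w.1; pose Y2 n (w : Omega * Omega) := Y n w.2.
have mY1 n : measurable_fun setT (Y1 n) by apply: measurableT_comp => //; exact: measurable_fst.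
have mY2 n : measurable_fun setT (Y2 n) by apply: measurableT_comp => //; exact: measurable_snd.
have -> : equiv_event2 e Y =
   [set w | exists M : R, forall n, Y1 n w <= M] `&` [set w | exists M : R, forall n, Y2 n w <= M] `&`
   [set w | forall i : seq (rat[i] * seq bool) * rat, 0 <= i.2 ->
     (bnd (embed i.1) (zext (Y1 ^~ w)) nneg (ratr i.2 ^+ 2) <->
      bnd (embed i.1) (zext (Y2 ^~ w)) nneg (ratr i.2 ^+ 2))].
  apply/seteqP; split => w.
    move=> [T1 [T2 [s1 s2 eqv]]]; split; first split.
    - by apply/(shiftableP (Y0 ^~ w.1)); exists T1.
    - by apply/(shiftableP (Y0 ^~ w.2)); exists T2.
    have [T1' m1] := unilateral_model s1; have [T2' m2] := unilateral_model s2.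
    by move=> [q r] /= r0; move: eqv; rewrite (model_equiv m1 m2); apply.
  move=> [[/(shiftableP (Y0 ^~ w.1))[T1 s1] /(shiftableP (Y0 ^~ w.2))[T2 s2]] h].
  exists T1, T2; split=> //.
  have [T1' m1] := unilateral_model s1; have [T2' m2] := unilateral_model s2.
  by rewrite (model_equiv m1 m2) => q r r0; exact: (h (q, r)).
apply: measurableI.
  by apply: measurableI; exact: measurable_bounded_weights.
apply: measurable_forall => -[q r] /=; apply: measurable_cond.
by apply: measurable_iff; exact: measurable_bnd.
Qed.

End EquivalenceEvents.

(** * Weights bounded below *)

Section Rigidity.
Context {R : realType}.

Fixpoint ppow (p : @spoly R) k := if k is k'.+1 then pmul p (ppow p k') else pone.

(** For weights at most W that are bounded below, but for the zero at the left end, the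
    powers of 1 - W^-2 A A^* converge to the projection on the first basis vector;
    after multiplication by A^n the norm tends to the product of the first n
    weights. *)
Definition corner (W : R) (n k : nat) : @spoly R :=
  pmul [:: (1, nseq n true)]
    (ppow (pone ++ pscale ((- (W ^+ 2)^-1)%:C) [:: (1, [:: true; false])]) k).

Lemma ev_corner (H : hilbertType R) D g w (A A' : H -> H) W n k i :
  shift_model D g w A A' ->
  ev A A' (corner W n k) (g i) =
    ((1 - w (i - 1) ^+ 2 / W ^+ 2) ^+ k * blockprod w i n)%:C *: g (i + n%:Z).
Proof.
move=> M; have bA := sm_bounded M; have aA := sm_adjoint M.
have lA := bop_lin bA.
pose b : @spoly R := pone ++ pscale ((- (W ^+ 2)^-1)%:C) [:: (1, [:: true; false])].
have hb : ev A A' b (g i) = (1 - w (i - 1) ^+ 2 / W ^+ 2)%:C *: g i.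
  rewrite ev_cat ev_pone ev_pscale /ev big_seq1 /= scale1r.
  rewrite (sm_back M) (linZ _ _ lA) (sm_shift M) subrK !scalerA.
  rewrite -{1}[g i]scale1r -scalerDl; congr (_ *: _).
  by rewrite -!rmorphM -rmorphD; congr (_%:C); ring.
have hk : ev A A' (ppow b k) (g i) = ((1 - w (i - 1) ^+ 2 / W ^+ 2) ^+ k)%:C *: g i.
  elim: (k) => [|j IH]; first by rewrite ev_pone expr0 scale1r.
  have lb := bop_lin (ev_bop bA aA b).
  by rewrite [ppow _ _]/= (ev_pmul bA aA) /comp IH (linZ _ _ lb) hb scalerA -rmorphM [in RHS](exprSr _ j).
have lw := bop_lin (ev_bop bA aA [:: (1, nseq n true)]).
rewrite /corner (ev_pmul bA aA) /comp -/b hk (linZ _ _ lw) /ev big_seq1 scale1r.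
by rewrite (wev_power M) scalerA -rmorphM.
Qed.

Lemma blockprod_gt0 (w : int -> R) n k : (forall l, (l < k)%N -> 0 < w (n + l%:Z)) ->
  0 < blockprod w n k.
Proof. by move=> h; apply: prodr_gt0 => l _; exact: h. Qed.

Lemma blockprod_le_exp (w : int -> R) n k W : (forall l, 0 <= w l <= W) ->
  blockprod w n k <= W ^+ k.
Proof.
move=> h; rewrite /blockprod -[k in W ^+ k]card_ord -prodr_const.
by apply: ler_prod.
Qed.

(** For large k the norm of [corner] in A is the product of the first n weights of A,
    while its value on the first basis vector of B bounds from below its norm
    in B. *)
Lemma rigid_le (H K : hilbertType R) (g : int -> H) (h : int -> K) (t s : nat -> R)
    (A A' : H -> H) (B B' : K -> K) (delta W : R) :
  shift_model nneg g (zext t) A A' -> shift_model nneg h (zext s) B B' ->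
  0 < delta -> (forall n, delta <= t n <= W) ->
  (forall p m, 0 <= m -> obd (ev A A' p) m -> obd (ev B B' p) m) ->
  forall n, blockprod (zext s) 0 n <= blockprod (zext t) 0 n.
Proof.
move=> mA mB d0 ht iso n; set pi := blockprod (zext t) 0 n.
have t0 l : 0 < t l by case/andP: (ht l) => + _; exact: lt_le_trans.
have W0 : 0 < W by case/andP: (ht 0%N) => h1 h2; apply: lt_le_trans h2; exact: lt_le_trans h1.
have pi0 : 0 < pi by apply: blockprod_gt0 => l _; rewrite add0r; exact: t0.
have zW l : 0 <= zext t l <= W.
  case: l => l /=; last by rewrite lexx ltW.
  by case/andP: (ht l) => h1 ->; rewrite ltW.
pose rho := 1 - delta ^+ 2 / W ^+ 2.
have W2 : 0 < W ^+ 2 by exact: exprn_gt0.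
have dW : delta <= W by case/andP: (ht 0%N); exact: le_trans.
have rho0 : 0 <= rho.
  by rewrite subr_ge0 ler_pdivrMr // mul1r ler_pXn2r ?nnegrE // ltW.
have rho1 : rho < 1 by rewrite ltrBlDr ltrDl divr_gt0 // exprn_gt0.
have [k hk] : exists k, rho ^+ k * W ^+ n <= pi.
  have Wn : 0 < W ^+ n by exact: exprn_gt0.
  have /cvgrPdist_lt /(_ _ (divr_gt0 pi0 Wn)) [N _ hN] :=
    @cvg_expr R rho ltac:(by rewrite ger0_norm).
  exists N; have := hN N (leqnn N); rewrite /= sub0r normrN ger0_norm ?exprn_ge0 //.
  by rewrite ltr_pdivlMr // => /ltW.
have oA : obd (ev A A' (corner W n k)) pi.
  apply: (weighted_obd mA (k := n%:Z) (ev_bop (sm_bounded mA) (sm_adjoint mA) _) (ltW pi0)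
    (s := fun i => (1 - zext t (i - 1) ^+ 2 / W ^+ 2) ^+ k * blockprod (zext t) i n)).
    by move=> i; exact: ev_corner mA.
  move=> [[|i]|i] // _.
    rewrite [zext t (0 - 1)]/= expr0n mul0r subr0 expr1n mul1r ger0_norm //; exact: ltW.
  have -> : i.+1%:Z - 1 = i%:Z by lia.
  rewrite [zext t i%:Z]/=.
  have b0 : 0 <= blockprod (zext t) i.+1 n.
    by apply: ltW; apply: blockprod_gt0 => l _; rewrite -PoszD; exact: t0.
  have x0 : 0 <= 1 - t i ^+ 2 / W ^+ 2.
    rewrite subr_ge0 ler_pdivrMr // mul1r ler_pXn2r ?nnegrE ?(ltW W0) ?(ltW (t0 i)) //.
    by case/andP: (ht i).
  rewrite ger0_norm; last by rewrite mulr_ge0 ?exprn_ge0.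
  apply: le_trans hk; apply: ler_pM => //; rewrite ?exprn_ge0 //; last exact: blockprod_le_exp.
  rewrite lerXn2r ?nnegrE // /rho lerD2l lerN2 ler_pM2r ?invr_gt0 //.
  rewrite ler_pXn2r ?nnegrE ?(ltW d0) ?(ltW (t0 i)) //.
  by case/andP: (ht i).
have := iso _ _ (ltW pi0) oA (h 0).
rewrite (ev_corner _ _ _ _ mB) [zext s (0 - 1)]/= expr0n mul0r subr0 expr1n mul1r.
rewrite nrmZ add0r (sm_nrm mB (n := n%:Z)) // (sm_nrm mB (n := 0)) // !mulr1 cnorm_real.
exact: le_trans (ler_norm _).
Qed.

Lemma blockprod_inj (t s : nat -> R) : (forall n, 0 < t n) ->
  (forall n, blockprod (zext s) 0 n = blockprod (zext t) 0 n) -> s = t.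
Proof.
move=> t0 h; apply/funext => n; have := h n.+1.
have E (w : int -> R) : blockprod w 0 n.+1 = blockprod w 0 n * w n%:Z.
  by rewrite /blockprod big_ord_recr /= add0r.
rewrite !E h /= => /mulfI; apply; rewrite gt_eqF //.
by apply: blockprod_gt0 => l _; rewrite add0r; exact: t0.
Qed.

(** The norms of the *-polynomials in A are those in T and those in S, and they
    determine the weights. *)
Theorem equiv_rigid (H H' K : hilbertType R) (f : nat -> H) (f' : nat -> H') (t s : nat -> R)
    (T : H -> H) (S : H' -> H') (A : K -> K) (delta W : R) :
  unilateral_shift f t T -> unilateral_shift f' s S -> bounded_operator A ->
  algebraically_equivalent T A -> algebraically_equivalent S A ->
  0 < delta -> (forall n, delta <= t n <= W) -> (forall n, delta <= s n <= W) -> s = t.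
Proof.
move=> uT uS bA TA SA d0 ht hs.
have [T' mT] := unilateral_model uT; have [S' mS] := unilateral_model uS.
have [A' aA] := equiv_adjoint (sm_bounded mT) (sm_adjoint mT) TA.
have iT := equiv_isometric (sm_bounded mT) (sm_adjoint mT) bA aA TA.
have iS := equiv_isometric (sm_bounded mS) (sm_adjoint mS) bA aA SA.
apply: blockprod_inj => [n|n]; first by case/andP: (ht n) => + _; exact: lt_le_trans.
apply/le_anti/andP; split.
  by apply: (rigid_le mT mS d0 ht) => p m m0 hm; apply/(iS p m m0); apply/(iT p m m0).
by apply: (rigid_le mS mT d0 hs) => p m m0 hm; apply/(iT p m m0); apply/(iS p m m0).
Qed.

End Rigidity.

(** * Sequences of values have probability zero *)

Section NullSequences.
Context (R : realType) (d : measure_display) (Omega : measurableType d)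
  (P : probability Omega R) (X : nat -> {RV P >-> R}).
Hypothesis Xindep : mutually_independent X.
Hypothesis Xid : identically_distributed X.

(** With two points in the support, no value is taken with probability more than
    some rho < 1, so N prescribed values have probability at most rho^N. *)
Lemma sequence_null (x y : R) (c : nat -> R) : x != y ->
  essran (X 0%N) x -> essran (X 0%N) y -> P.-negligible [set w | forall n, X n w = c n].
Proof.
move=> xy Gx Gy.
pose r := `|x - y| / 2.
have r0 : 0 < r by rewrite divr_gt0 // normr_gt0 subr_eq0.
pose p z := fine (P (X 0%N @^-1` ball z r)).
have mB z : measurable (ball z r : set R) by apply: open_measurable; exact: ball_open.
have mX n B : measurable B -> measurable (X n @^-1` B) by exact: measurable_preimage_RV.
have pE z : P (X 0%N @^-1` ball z r) = (p z)%:E.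
  by rewrite fineK // fin_num_measure //; exact: mX.
have p0 z : essran (X 0%N) z -> 0 < p z.
  move=> Gz; rewrite -lte_fin -pE.
  by apply: (essran_pos Gz); [exact: ball_open | exact: ballxx].
pose rho := 1 - Num.min (p x) (p y).
have m0 : 0 < Num.min (p x) (p y) by rewrite lt_min !p0.
have hz z n : ~ ball z r (c n) -> (P (X n @^-1` [set c n]) <= (1 - p z)%:E)%E.
  move=> hc; rewrite (same_law Xid) //.
  apply: (@le_trans _ _ (P (~` (X 0%N @^-1` ball z r)))).
    apply: le_measure; rewrite ?inE; [exact: mX | by apply: measurableC; exact: mX |].
    by move=> w /= ->.
  by rewrite probability_setC ?pE //; exact: mX.
have hrho n : (P (X n @^-1` [set c n]) <= rho%:E)%E.
  have [hx|hx] := pselect (ball x r (c n)); last first.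
    apply: le_trans (hz x n hx) _; rewrite lee_fin lerD2l lerN2 ge_min lexx //.
  have hy : ~ ball y r (c n).
    move: hx; rewrite -ball_normE /= => hx; rewrite /= => hy.
    have : `|x - y| <= `|x - c n| + `|y - c n|.
      by rewrite (distrC y); apply: le_trans (ler_normD _ _); rewrite addrA subrK.
    by move: hx hy; rewrite /r; lra.
  by apply: le_trans (hz y n hy) _; rewrite lee_fin lerD2l lerN2 ge_min lexx orbT.
have mC : measurable (\bigcap_n (X n @^-1` [set c n])).
  by apply: bigcap_measurableType => n _; exact: mX.
apply: (@negligibleS _ _ _ P (\bigcap_n (X n @^-1` [set c n]))); first by move=> w h n _; exact: h.
apply/negligibleP => //; apply/eqP; rewrite eq_le measure_ge0 andbT.
have rho0 : 0 <= rho.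
  by rewrite -lee_fin; apply: le_trans (hrho 0%N); exact: measure_ge0.
have rho1 : rho < 1 by rewrite ltrBlDr ltrDl.
have hN N : (P (\bigcap_n (X n @^-1` [set c n])) <= (rho ^+ N)%:E)%E.
  apply: (@le_trans _ _ (P (\bigcap_(j in [set` iota 0 N]) (X j @^-1` [set c j])))).
    apply: le_measure; rewrite ?inE //; last by move=> w h n _; exact: h.
    by apply: bigcap_measurableType => n _; exact: mX.
  rewrite (Xindep (iota_uniq 0 N) (fun j => measurable_set1 (c j))).
  rewrite -[N in (rho ^+ N)%:E](size_iota 0 N); elim: (iota 0 N) => [|j s IH] /=.
    by rewrite big_nil expr0.
  by rewrite big_cons exprS EFinM; apply: lee_pmul => //; apply: prode_ge0.
apply/lee_addgt0Pr => eps e0; rewrite add0e.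
have /cvgrPdist_lt /(_ eps e0) [N _ hN'] := @cvg_expr R rho ltac:(by rewrite ger0_norm).
apply: le_trans (hN N) _; rewrite lee_fin.
have := hN' N (leqnn N); rewrite /= sub0r normrN => h.
by apply: le_trans (ltW h); exact: ler_norm.
Qed.

End NullSequences.

(** * Shifts equivalent to a generic one *)

Section GenericWeights.
Context {R : realType}.
Variable G : set R.
Hypotheses (Gclosed : closed G) (Gge0 : forall x, G x -> 0 <= x).

(** The almost sure properties of the weights of the random shift; everything about
    equivalence with it is deduced from them. *)
Definition generic (t : nat -> R) := (forall n, G (t n)) /\
  forall (N : nat) (c : nat -> R), (forall l, (l < N)%N -> G (c l)) ->
  forall e : R, 0 < e -> exists i : nat, forall l, (l < N)%N -> `|t (i + l)%N - c l| < e.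

Lemma generic_windows t : generic t -> windows_dense G (zext t) nneg.
Proof.
move=> [_ ht] w Gw k.
have [||i hi] := ht (k + k).+1 (fun l => w (l%:Z - k%:Z)) _ k.+1%:R^-1.
- by move=> l _; exact: Gw.
- by rewrite invr_gt0.
exists (i + k)%:Z; split; first by move=> z hz; rewrite /nneg; lia.
move=> z hz; pose n := absz (z + k%:Z); have := hi n.
have -> : n%:Z - k%:Z = z by lia.
have -> : z + (i + k)%:Z = (i + n)%N%:Z by lia.
by apply; lia.
Qed.

Lemma zext_in t : G 0 -> (forall n, G (t n)) -> forall z, G (zext t z).
Proof. by move=> G0 ht [n|n] /=. Qed.

(** The norms of *-polynomials in a generic shift depend on G only. *)
Lemma generic_universal t : G 0 -> generic t -> universal G (zext t) nneg.
Proof.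
move=> G0 ht p M; split; first exact: windows_lower (generic_windows ht).
by apply: universal_upper => //; apply: zext_in => //; case: ht.
Qed.

Lemma universal_equiv (H K : hilbertType R) D g w (A A' : H -> H) E h x (B B' : K -> K) :
  shift_model D g w A A' -> shift_model E h x B B' ->
  universal G w D -> universal G x E -> algebraically_equivalent A B.
Proof.
move=> mA mB uA uB; apply/(model_equiv mA mB) => q r _.
by rewrite (uA (embed q)) (uB (embed q)).
Qed.

Lemma closed_approx x : (forall e : R, 0 < e -> exists2 y, G y & `|x - y| < e) -> G x.
Proof.
move=> h; apply: Gclosed => B /nbhs_ballP[e e0 hB].
have [y Gy xy] := h e e0; exists y; split=> //; apply: hB.
by rewrite -ball_normE.
Qed.

Section Comparison.
Variables (H K : hilbertType R) (gT : int -> H) (t : nat -> R) (T T' : H -> H).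
Variables (D : pred int) (g : int -> K) (a : int -> R) (A A' : K -> K).
Hypotheses (mT : shift_model nneg gT (zext t) T T') (mA : shift_model D g a A A').
Hypothesis ht : generic t.

Lemma generic_pattern (flank : bool) c m : (forall l, (l < m)%N -> G (c l)) -> (flank -> G 0) ->
  forall e : R, 0 < e -> exists i, pattern flank c (zext t) nneg m e i.
Proof.
move=> Gc G0 e e0; case: flank G0 => G0.
  have [|i hi] := ht.2 m.+1 (fun l => if l is k.+1 then c k else 0) _ e e0.
    by case=> [|l] lm; [exact: G0 | exact: Gc].
  exists i.+1%:Z; split=> // [_|l lm].
    have -> : i.+1%:Z - 1 = i%:Z by lia.
    have := hi 0%N isT; rewrite addn0 subr0; exact: le_lt_trans (ler_norm _).
  by have := hi l.+1 lm; rewrite -PoszD addSnnS.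
have [|i hi] := ht.2 m c _ e e0; first exact: Gc.
by exists i%:Z; split=> // l lm; rewrite -PoszD; exact: hi.
Qed.

(** A weight of A is a pattern of length one, so it is a limit of weights of T. *)
Lemma equiv_weights_in : G 0 -> algebraically_equivalent T A -> forall z, G (a z).
Proof.
move=> G0 eqv z; have [Dz|nDz] := boolP (D z); last first.
  by rewrite (sm_outside mA) // (negbTE nDz).
apply: closed_approx => e e0.
have hA (e1 : R) : 0 < e1 -> exists i, pattern false (fun=> a z) a D 1 e1 i.
  by move=> e10; exists z; split=> // -[|l] // _; rewrite addr0 subrr normr0.
have cn (l : nat) : (l.+1 < 1)%N -> a z != 0 by [].
have [i [Di _ hi]] := pattern_transfer mT mA eqv (fun=> sm_ge0 mA z) cn hA e0.
case: i Di hi => // i _ hi; exists (t i); first by case: ht.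
by have := hi 0%N isT; rewrite addr0 distrC.
Qed.

Lemma equiv_pattern (flank : bool) c m : algebraically_equivalent T A ->
  (forall l, (l < m)%N -> G (c l)) -> (forall l, 0 <= c l) -> (flank -> G 0) ->
  (forall l, (l.+1 < m)%N -> c l != 0) ->
  forall e : R, 0 < e -> exists i, pattern flank c a D m e i.
Proof.
move=> eqv Gc c0 G0 cn0 e e0.
have eqv' : algebraically_equivalent A T.
  by apply/(model_equiv mA mT) => q r r0; rewrite ((model_equiv mT mA).1 eqv q r r0).
exact: (pattern_transfer mA mT eqv' c0 cn0 (generic_pattern Gc G0) e0).
Qed.

Definition isolated_zero (delta : R) := 0 < delta /\ forall x, G x -> `|x| < delta -> x = 0.

(** A block between two zeros is a pattern with a zero at its end and a zero on its
    left; since 0 is isolated in G, weights of A close to 0 are equal to 0. *)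
Lemma equiv_blocks_dense delta : G 0 -> isolated_zero delta -> algebraically_equivalent T A ->
  blocks_dense (G `\ 0) a D.
Proof.
move=> G0 [d0 hd] eqv N c Gc e e0.
have aG := equiv_weights_in G0 eqv.
pose c' l := if (l < N)%N then c l else 0.
have m0 : 0 < Num.min e delta by rewrite lt_min e0.
have [|l|_|l|i [Di hl hi]] := equiv_pattern (flank := true) (c := c') (m := N.+1) eqv _ _ _ _ m0.
- by move=> l _; rewrite /c'; case: ifP => // lN; case: (Gc l lN).
- by rewrite /c'; case: ifP => // lN; apply: Gge0; case: (Gc l lN).
- by [].
- by rewrite ltnS => lN; rewrite /c' lN; apply/eqP; case: (Gc l lN).
exists i; split=> //.
- apply: hd => //; rewrite ger0_norm ?(sm_ge0 mA) //.
  by have := hl isT; rewrite lt_min => /andP[].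
- apply: hd => //; have := hi N (ltnSn N); rewrite /c' ltnn subr0.
  by rewrite lt_min => /andP[].
- move=> l lN; have := hi l (ltnW lN); rewrite /c' lN.
  by rewrite lt_min => /andP[].
Qed.

Lemma equiv_isolatedP delta : G 0 -> isolated_zero delta -> upward D ->
  algebraically_equivalent T A <-> (forall z, G (a z)) /\ blocks_dense (G `\ 0) a D.
Proof.
move=> G0 hd uD; split=> [eqv|[aG aB]].
  by split; [exact: equiv_weights_in | exact: equiv_blocks_dense hd eqv].
apply: (universal_equiv mT mA (generic_universal G0 ht)) => p M; split.
  exact: blocks_lower.
exact: universal_upper.
Qed.

(** Common form of the unilateral and of the bilateral n-spectra. *)
Definition int_spectrum n (v : nat -> R) := forall e : R, 0 < e ->
  exists2 z : int, D z & forall j, (j < n)%N -> `|a (z + j%:Z) - v j| < e.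

(** When 0 is an accumulation point of G, words over G can be approximated by words
    without zeros, to which the transfer of patterns applies. *)
Lemma equiv_accumulationP : G 0 -> (forall e : R, 0 < e -> exists2 y, G y & 0 < y < e) -> upward D ->
  algebraically_equivalent T A <->
  forall n, (1 <= n)%N -> forall v, int_spectrum n v <-> (forall j, (j < n)%N -> G (v j)).
Proof.
move=> G0 hacc uD; split=> [eqv n n1 v|hS].
  have aG := equiv_weights_in G0 eqv.
  split=> [hv j jn|Gv e e0].
    apply: closed_approx => e e0; have [z Dz hz] := hv e e0.
    by exists (a (z + j%:Z)) => //; rewrite distrC; exact: hz.
  have e2 : 0 < e / 2 by rewrite divr_gt0.
  have [y Gy /andP[y0 ye]] := hacc _ e2.
  (* the zeros of v are moved to a small element y of G *)
  pose c j := if (j < n)%N && (v j != 0) then v j else y.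
  have Gc l : G (c l) by rewrite /c; case: ifP => // /andP[ln _]; exact: Gv.
  have [||//||i [Di _ hi]] := equiv_pattern (flank := false) (c := c) (m := n) eqv _ _ _ _ e2.
  - by move=> l _.
  - by move=> l; exact: Gge0.
  - by move=> l _; rewrite /c; case: ifP => [/andP[]//|_]; rewrite gt_eqF.
  exists i => // j jn; have := hi j jn; rewrite /c jn /=.
  case: eqP => [-> /= h|_ /= h]; last by apply: lt_trans h _; lra.
  rewrite subr0 -[a _](subrK y); apply: le_lt_trans (ler_normD _ _) _.
  by rewrite (gtr0_norm y0); lra.
have aG z : G (a z).
  have [Dz|nDz] := boolP (D z); last by rewrite (sm_outside mA) // (negbTE nDz).
  have /(hS 1%N isT (fun=> a z)) : int_spectrum 1 (fun=> a z).
    by move=> e e0; exists z => // -[|j] // _; rewrite addr0 subrr normr0.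
  by move=> /(_ 0%N isT).
apply: (universal_equiv mT mA (generic_universal G0 ht)) => p M; split; last exact: universal_upper.
apply: windows_lower => w Gw k.
have [||z Dz hz] := (hS (k + k).+1 isT (fun l => w (l%:Z - k%:Z))).2 _ k.+1%:R^-1.
- by move=> l _; exact: Gw.
- by rewrite invr_gt0.
exists (z + k%:Z); split.
  by move=> x hx; apply: uD Dz; lia.
move=> x hx; pose n := absz (x + k%:Z); have := hz n.
have -> : n%:Z - k%:Z = x by lia.
have -> : z + n%:Z = x + (z + k%:Z) by lia.
by apply; lia.
Qed.

Definition flanked (c : nat -> R) n (j : nat) : R :=
  if (0 < j <= n)%N then c j.-1 else 0.

(** Points of the spectrum flanked by zeros correspond to blocks between exact zeros
    because 0 is isolated in G. *)
Lemma flanked_spectrumP c n delta : isolated_zero delta -> (forall z, G (a z)) ->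
  int_spectrum n.+2 (flanked c n) <->
  forall e : R, 0 < e -> exists z : int, [/\ D z, a z = 0, a (z + 1 + n%:Z) = 0 &
    forall l, (l < n)%N -> `|a (z + 1 + l%:Z) - c l| < e].
Proof.
move=> [d0 hd] aG; split=> h e e0.
  have m0 : 0 < Num.min e delta by rewrite lt_min e0.
  have [z Dz hz] := h _ m0; exists z; split=> //.
  - apply: hd => //; have := hz 0%N isT; rewrite addr0 subr0.
    by rewrite lt_min => /andP[].
  - apply: hd => //; have := hz n.+1 (ltnSn _); rewrite /flanked ltnn andbF subr0.
    have -> : z + n.+1%:Z = z + 1 + n%:Z by lia.
    by rewrite lt_min => /andP[].
  - move=> l ln; have := hz l.+1 (leqW ln); rewrite /flanked /= ln.
    have -> : z + l.+1%:Z = z + 1 + l%:Z by lia.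
    by rewrite lt_min => /andP[].
have [z [Dz z0 zn hz]] := h e e0; exists z => // -[|j] jn.
  by rewrite addr0 z0 subrr normr0.
have -> : z + j.+1%:Z = z + 1 + j%:Z by lia.
rewrite /flanked /=; case: ltnP => jn'; first exact: hz.
have -> : j = n by apply/eqP; rewrite eqn_leq jn' andbT.
by rewrite zn subrr normr0.
Qed.

End Comparison.
End GenericWeights.

(** * n-Spectra *)

Section Spectra.
Context {R : realType}.

Lemma n_spectrumP (I : Type) (next : I -> I) (a : I -> R) n (v : nat -> R) :
  n_spectrum next a n (\row_(j < n) v j) <->
  forall e : R, 0 < e -> exists i, forall j, (j < n)%N -> `| `|a (iter j next i)| - v j| < e.
Proof.
split=> [h e e0|h B /nbhs_ballP[e e0 hB]].
  have [_ [[i _ <-] hi]] := h (ball (\row_(j < n) v j) e) (nbhsx_ballx _ _ e0).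
  exists i => j jn; have := hi.2 0 (Ordinal jn); rewrite !mxE /= -ball_normE /=.
  by rewrite distrC.
have [i hi] := h e e0.
exists (\row_(j < n) `|a (iter j next i)|); split; first by exists i.
apply: hB; split=> // k j; rewrite !mxE -ball_normE /= distrC; exact: hi.
Qed.

Lemma row_fun n (V : 'rV[R]_n) : exists v : nat -> R, V = \row_(j < n) v j.
Proof.
exists (fun k => if insub k is Some j then V 0 j else 0); apply/rowP => j.
by rewrite mxE valK.
Qed.

Lemma set_powerP (G : set R) n (v : nat -> R) :
  set_power G n (\row_(j < n) v j) <-> forall j, (j < n)%N -> G (v j).
Proof.
split=> h j; first by move=> jn; have := h (Ordinal jn); rewrite mxE.
by rewrite mxE; exact: h.
Qed.

Lemma spectrum_unilateral (t : nat -> R) n (v : nat -> R) : (forall k, 0 <= t k) ->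
  n_spectrum succn t n (\row_(j < n) v j) <-> int_spectrum nneg (zext t) n v.
Proof.
move=> t0; have E (i j : nat) : `|t (iter j succn i)| = zext t (i%:Z + j%:Z).
  by rewrite ger0_norm // -PoszD iter_succn addnC.
rewrite n_spectrumP; split=> h e e0.
  by have [i hi] := h e e0; exists i%:Z => // j jn; rewrite -E; exact: hi.
by have [[i|i] // _ hi] := h e e0; exists i => j jn; rewrite E; exact: hi.
Qed.

Lemma spectrum_bilateral (a : int -> R) n (v : nat -> R) : (forall k, 0 <= a k) ->
  n_spectrum next_int a n (\row_(j < n) v j) <-> int_spectrum all_int a n v.
Proof.
move=> a0; have E (i : int) (j : nat) : `|a (iter j next_int i)| = a (i + j%:Z).
  rewrite ger0_norm //; congr a; elim: j => [|j IH] /=; first by rewrite addr0.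
  by rewrite IH /next_int; lia.
rewrite n_spectrumP; split=> h e e0.
  by have [i hi] := h e e0; exists i => // j jn; rewrite -E; exact: hi.
by have [i _ hi] := h e e0; exists i => j jn; rewrite E; exact: hi.
Qed.

Lemma eq_row (n : nat) (u v : nat -> R) : (forall j, (j < n)%N -> u j = v j) ->
  \row_(j < n) u j = \row_(j < n) v j :> 'rV_n.
Proof. by move=> h; apply/rowP => j; rewrite !mxE; exact: h. Qed.

Lemma zero_flankedP n (E : set 'rV[R]_n) (S : set 'rV[R]_n.+2) :
  zero_flanked E `<=` S <->
  forall c : nat -> R, E (\row_(j < n) c j) -> S (\row_(j < n.+2) flanked c n j).
Proof.
split=> [h c Ec|h V].
  apply: h; split.
  - by rewrite mxE.
  - congr E: Ec; apply/rowP => j; rewrite !mxE /flanked /= /bump leq0n add1n /=.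
    by rewrite ltn_ord.
  - by rewrite mxE /flanked /= ltnn.
have [v ->] := row_fun V; rewrite /zero_flanked /= => -[v0 Ev vn].
have -> : \row_(j < n.+2) v j = \row_(j < n.+2) flanked (fun k => v k.+1) n j.
  apply: eq_row => -[|j] jn; rewrite /flanked /=; first by rewrite mxE in v0.
  case: ltnP => // nj; have -> : j = n by apply/eqP; rewrite eqn_leq nj andbT.
  by rewrite mxE in vn.
apply: h; congr E: Ev; apply/rowP => j.
by rewrite !mxE /= /bump leq0n add1n.
Qed.

Lemma card_gt1 (G : set R) : (`I_2 #<= G)%card -> exists x y, [/\ x != y, G x & G y].
Proof.
move=> /pcard_leP[f]; exists (f 0%N), (f 1%N); split.
- by apply/eqP => /(@inj _ _ _ f) h; have := h (mem_set isT) (mem_set isT).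
- exact: funS.
- exact: funS.
Qed.

End Spectra.

(** * Blocks of a unilateral shift *)

Section UnilateralBlocks.
Context {R : realType}.
Variables (G : set R) (delta : R) (a : nat -> R).
Hypotheses (hd : isolated_zero G delta) (aG : forall n, G (a n)) (G0 : G 0).
Let G1 := G `\ 0.

(** Both flanking zeros are weights of the shift, as opposed to the left zero of the
    initial segment. *)
Definition inner_block (c : nat -> R) n := forall e : R, 0 < e ->
  exists z : int, [/\ nneg z, zext a z = 0, zext a (z + 1 + n%:Z) = 0 &
    forall l, (l < n)%N -> `|zext a (z + 1 + l%:Z) - c l| < e].

Lemma zero_flanked_inner n (E : set 'rV[R]_n) : (forall k, 0 <= a k) ->
  zero_flanked E `<=` n_spectrum succn a n.+2 <->
  forall c : nat -> R, E (\row_(j < n) c j) -> inner_block c n.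
Proof.
move=> a0; rewrite zero_flankedP; split=> h c Ec.
  by rewrite /inner_block; apply/(flanked_spectrumP _ _ _ hd (zext_in G0 aG)); apply/spectrum_unilateral => //; exact: h.
apply/spectrum_unilateral => //.
by apply/(flanked_spectrumP _ _ _ hd (zext_in G0 aG)); exact: h.
Qed.

(** An occurrence of the block c closer than e0 cannot be the initial segment. *)
Lemma inner_of_blocks c n e0 : blocks_dense G1 (zext a) nneg ->
  (forall l, (l < n)%N -> G1 (c l)) -> 0 < e0 ->
  ~ (a n = 0 /\ forall l, (l < n)%N -> `|a l - c l| < e0) -> inner_block c n.
Proof.
move=> hB hc e00 nfirst e e1.
have m0 : 0 < Num.min e e0 by rewrite lt_min e1.
(* an occurrence at i = 0 is the initial segment *)
have [[[|i]|i] [Di z1 z2 hi]] // := hB n c hc _ m0.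
  exfalso; apply: nfirst; split; first by rewrite add0r in z2.
  by move=> l ln; have := hi l ln; rewrite add0r lt_min => /andP[].
have E (x : int) : i.+1%:Z + x = i%:Z + 1 + x by lia.
exists i%:Z; split => //.
- by rewrite -z1; congr zext; lia.
- by rewrite -E.
- by move=> l ln; have := hi l ln; rewrite -E lt_min => /andP[].
Qed.

Lemma block_of_inner c n : inner_block c n -> forall e : R, 0 < e ->
  exists i : int, [/\ nneg i, zext a (i - 1) = 0, zext a (i + n%:Z) = 0 &
    forall l, (l < n)%N -> `|zext a (i + l%:Z) - c l| < e].
Proof.
move=> h e e0; have [z [Dz z1 z2 hz]] := h e e0; exists (z + 1); split=> //.
  by move: Dz; rewrite /nneg; lia.
by rewrite addrK.
Qed.

(** The only block that is not inner is the initial segment of a.  It helps to realize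
    the blocks equal to it, which have its length m: for a 0 = 0 this is the empty
    block, and for a without zeros there is no initial block. *)
Lemma unilateral_blocksP : blocks_dense G1 (zext a) nneg <->
  [\/ a 0%N = 0 /\ (forall n, (1 <= n)%N -> forall c,
        (forall l, (l < n)%N -> G1 (c l)) -> inner_block c n),
      a 0%N <> 0 /\ (forall n c, (forall l, (l < n)%N -> G1 (c l)) -> inner_block c n) |
      exists m, (1 <= m)%N /\ [/\ forall l, (l < m)%N -> G1 (a l), a m = 0,
        forall c, (forall l, (l < m)%N -> G1 (c l)) ->
          \row_(j < m) c j <> \row_(j < m) a j -> inner_block c m &
        forall n, n <> m -> forall c, (forall l, (l < n)%N -> G1 (c l)) -> inner_block c n]].
Proof.
split=> [hB|].
  have pos x : G1 x -> 0 < `|x| by case=> _ /eqP; rewrite normr_gt0.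
  have [a00|a00] := pselect (a 0%N = 0).
    constructor 1; split=> // n n1 c hc.
    apply: (inner_of_blocks hB hc (pos _ (hc 0%N n1))) => -[_ /(_ 0%N n1)].
    by rewrite a00 sub0r normrN ltxx.
  have [hz|nz] := pselect (exists n, a n == 0); last first.
    constructor 2; split=> // n c hc.
    apply: (inner_of_blocks hB hc ltr01) => -[an _]; apply: nz; exists n; exact/eqP.
  constructor 3; case: (ex_minnP hz) => m /eqP am mmin.
  have aG1 l : (l < m)%N -> G1 (a l).
    by move=> lm; split=> // /= al; have := mmin l; rewrite al eqxx leqNgt lm => /(_ isT).
  exists m; split; first by case: (m) am => // /a00.
  split=> // [c hc hne|n nm c hc].
    have [l [lm cl]] : exists l, (l < m)%N /\ c l != a l.
      apply: contrapT => nex; apply: hne; apply: eq_row => j jm; apply/eqP.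
      by apply: contrapT => /negP cj; apply: nex; exists j.
    have e0 : 0 < `|a l - c l| by rewrite normr_gt0 subr_eq0 eq_sym.
    by apply: (inner_of_blocks hB hc e0) => -[_ /(_ l lm)]; rewrite ltxx.
  have [mn|nm'] := ltnP m n.
    apply: (inner_of_blocks hB hc (pos _ (hc m mn))) => -[_ /(_ m mn)].
    by rewrite am sub0r normrN ltxx.
  apply: (inner_of_blocks hB hc ltr01) => -[/eqP/mmin mn _].
  by apply: nm; apply/eqP; rewrite eqn_leq nm' mn.
case=> [[a00 h]|[_ h]|[m [m1 [am1 am h1 h2]]]] n c hc.
- case: n hc => [_ e e0|n hc]; last by apply: block_of_inner; exact: h.
  by exists 0; split.
- by apply: block_of_inner; exact: h.
have [nm|nm] := eqVneq n m; last by apply: block_of_inner; apply: h2 => //; exact/eqP.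
rewrite nm in hc *.
have [rr|rr] := pselect (\row_(j < m) c j = \row_(j < m) a j); last first.
  by apply: block_of_inner; exact: h1.
move=> r r0; exists 0; split=> //.
move=> l lm; rewrite add0r /=.
have := congr1 (fun V : 'rV[R]_m => V 0 (Ordinal lm)) rr; rewrite !mxE /= => ->.
by rewrite subrr normr0.
Qed.

Lemma unilateral_spectraP : (forall k, 0 <= a k) ->
  blocks_dense G1 (zext a) nneg <->
    [\/ a 0%N = 0 /\
         (forall n, (1 <= n)%N ->
            zero_flanked (set_power G1 n) `<=` n_spectrum succn a n.+2),
         a 0%N <> 0 /\
         (forall n,
            zero_flanked (set_power G1 n) `<=` n_spectrum succn a n.+2) |
         exists m, (1 <= m)%N /\
           [/\ set_power G1 m (\row_(j < m) a j), a m = 0,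
               zero_flanked (set_power G1 m `\ \row_(j < m) a j)
                 `<=` n_spectrum succn a m.+2 &
               forall n, n <> m ->
                 zero_flanked (set_power G1 n)
                   `<=` n_spectrum succn a n.+2]].
Proof.
move=> a0.
have Z n : zero_flanked (set_power G1 n) `<=` n_spectrum succn a n.+2 <->
    (forall c, (forall l, (l < n)%N -> G1 (c l)) -> inner_block c n).
  by rewrite (zero_flanked_inner _ a0); split=> k c hc; apply: k; exact/set_powerP.
have Y m : zero_flanked (set_power G1 m `\ \row_(j < m) a j) `<=` n_spectrum succn a m.+2 <->
    (forall c, (forall l, (l < m)%N -> G1 (c l)) ->
       \row_(j < m) c j <> \row_(j < m) a j -> inner_block c m).
  rewrite (zero_flanked_inner _ a0); split=> k c.
    by move=> hc ne; apply: k; split=> //; exact/set_powerP.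
  by move=> [hc ne]; apply: k => //; exact/set_powerP.
rewrite unilateral_blocksP; split=> -[[a00 h]|[a00 h]|[m [m1 [am1 am h1 h2]]]].
- by constructor 1; split=> // n n1; apply/Z; exact: h.
- by constructor 2; split=> // n; apply/Z; exact: h.
- constructor 3; exists m; split=> //; split=> //; [exact/set_powerP | exact/Y |].
  by move=> n nm; apply/Z; exact: h2.
- by constructor 1; split=> // n n1; apply/Z; exact: h.
- by constructor 2; split=> // n; apply/Z; exact: h.
- constructor 3; exists m; split=> //; split=> //; [exact/set_powerP | exact/Y |].
  by move=> n nm; apply/Z; exact: h2.
Qed.

End UnilateralBlocks.

(** * The random weighted shift *)

Section RandomShift.
Context (R : realType) (H : hilbertType R) (e : nat -> H).
Hypothesis he : orthonormal_basis e.
Context (d : measure_display) (Omega : measurableType d) (P : probability Omega R).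
Variable X : nat -> {RV P >-> R}.
Hypothesis Xge0 : forall n w, 0 <= X n w.
Hypothesis Xbounded : forall n, exists M : R, forall w, X n w <= M.
Hypothesis Xindep : mutually_independent X.
Hypothesis Xid : identically_distributed X.

Let G := essran (X 0%N).

(** An open set missed by the first weight carries no mass, so the bounds of that
    weight bound the essential range. *)
Lemma essran_itv : exists2 W : R, 0 < W & forall x, G x -> 0 <= x <= W.
Proof.
have [M hM] := Xbounded 0%N.
have M1 : 0 < `|M| + 1 by rewrite ltr_wpDl.
have null (U : set R) : (forall w, ~ U (X 0%N w)) -> open U -> forall x, G x -> ~ U x.
  move=> hU oU x Gx Ux; have := essran_pos Gx oU Ux.
  have -> : X 0%N @^-1` U = set0 by apply/seteqP; split=> // w; exact: hU.
  by rewrite measure0 ltxx.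
exists (`|M| + 1) => // x Gx; apply/andP; split; rewrite leNgt; apply/negP => hx.
  apply: (null [set y | y < 0] _ _ x Gx hx); last exact: open_lt.
  by move=> w /=; rewrite ltNge Xge0.
apply: (null [set y | `|M| + 1 < y] _ _ x Gx hx); last exact: open_gt.
move=> w /=; apply/negP; rewrite -leNgt.
by apply: le_trans (hM w) _; apply: le_trans (ler_norm M) _; rewrite lerDl.
Qed.

Lemma essran_ge0 x : G x -> 0 <= x.
Proof. by have [W _ h] := essran_itv => /h/andP[]. Qed.

Let Gclosed : closed G := @essran_closed _ _ _ _ X.

Lemma ae_generic : P.-negligible (~` [set w | generic G (fun n => X n w)]).
Proof.
apply: (negligibleS _ (negligibleU (ae_in_essran Xid) (ae_windows Xindep Xid))).
move=> w nw; have [h1|] := pselect (forall n, G (X n w)); last by left.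
by right=> h2; apply: nw; split.
Qed.

Lemma generic_shift w : generic G (fun n => X n w) ->
  exists T, unilateral_shift e (fun n => X n w) T.
Proof.
move=> [h _]; have [W _ hW] := essran_itv.
by apply: (nat_shift_exists (M := W) he) => n //; case/andP: (hW _ (h n)).
Qed.

Lemma exists_generic (Q : Omega -> Prop) : P.-negligible (~` [set w | Q w]) ->
  exists w, generic G (fun n => X n w) /\ Q w.
Proof.
move=> nQ; apply: contrapT => h.
have : P.-negligible [set: Omega].
  apply: (negligibleS _ (negligibleU ae_generic nQ)) => w _.
  have [g|ng] := pselect (generic G (fun n => X n w)); last by left.
  by right=> q; apply: h; exists w.
move/(negligibleP _ measurableT) => P0.
have /(congr1 fine)/= /eqP := etrans (esym P0) (@probability_setT _ _ _ P).
by rewrite eq_sym oner_eq0.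
Qed.

Lemma ae_equivP (K : hilbertType R) (A : K -> K) (C : Prop) :
  (forall w T, generic G (fun n => X n w) -> unilateral_shift e (fun n => X n w) T ->
     algebraically_equivalent T A <-> C) ->
  {ae P, forall w, equiv_event e (fun n => X n) A w} <-> C.
Proof.
move=> h; split=> [/exists_generic[w [gw [T uT eqv]]]|hC].
  exact/(h w T gw uT).
apply: (negligibleS _ ae_generic) => w nw gw; apply: nw.
have [T uT] := generic_shift gw; exists T => //; exact/(h w T gw uT).
Qed.

Let mX n : measurable_fun setT (X n). Proof. exact: measurable_funPT. Qed.

Let TT := equiv_event2 e (fun n => X n).
Let T_equiv (K : hilbertType R) (A : K -> K) := equiv_event e (fun n => X n) A.

(** Almost surely the weights are bounded below, so by rigidity the event is contained,
    up to a null set, in the set where the weights equal one fixed sequence. *)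
Lemma not_equiv_ae (K : hilbertType R) (A : K -> K) : ~ G 0 -> (`I_2 #<= G)%card ->
  bounded_operator A -> P.-negligible (T_equiv A).
Proof.
move=> nG0 cG bA; have [x [y [xy Gx Gy]]] := card_gt1 cG.
have [delta d0 hdelta] : exists2 delta : R, 0 < delta & forall z, G z -> delta <= z.
  have oG : open (~` G) by exact: closed_openC.
  have /nbhs_ballP[r r0 hr] : nbhs (0 : R) (~` G) by exact: open_nbhs_nbhs.
  exists r => // z Gz; rewrite leNgt; apply/negP => zr; apply: (hr z _ Gz).
  by rewrite -ball_normE /= sub0r normrN ger0_norm //; exact: essran_ge0.
have [W _ hW] := essran_itv.
have bounds w : generic G (fun n => X n w) -> forall n, delta <= X n w <= W.
  by move=> [h _] n; have /andP[_ ->] := hW _ (h n); rewrite andbT; exact: hdelta.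
have [[w0 [g0 [T0 u0 e0]]]|none] :=
    pselect (exists w, generic G (fun n => X n w) /\ T_equiv A w).
  apply: (negligibleS _ (negligibleU ae_generic (sequence_null Xindep Xid (fun n => X n w0) xy Gx Gy))).
  move=> w [T uT eqv]; have [g|] := pselect (generic G (fun n => X n w)); last by left.
  right=> n; have := equiv_rigid u0 uT bA e0 eqv d0 (bounds _ g0) (bounds _ g).
  by move=> /(congr1 (fun f => f n)).
apply: (negligibleS _ ae_generic) => w Tw gw; apply: none; by exists w.
Qed.

(** The sections of the event for pairs are null by the statement for a single
    operator. *)
Lemma part_i : ~ G 0 -> (`I_2 #<= G)%card ->
  (measurable TT /\ (P \x P)%E TT = 0%E) /\
  (forall (K : hilbertType R) (A : K -> K), bounded_operator A ->
     measurable (T_equiv A) /\ P (T_equiv A) = 0%E).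
Proof.
move=> nG0 cG.
have hA (K : hilbertType R) (A : K -> K) : bounded_operator A ->
    measurable (T_equiv A) /\ P (T_equiv A) = 0%E.
  move=> bA; have mT : measurable (T_equiv A) by exact: measurable_equiv_event.
  by split=> //; apply/(negligibleP _ mT); exact: not_equiv_ae.
split=> //; have mTT : measurable TT by exact: measurable_equiv_event2.
split=> //; rewrite /product_measure1 /= integral0_eq // => w _ /=.
have mS : measurable (xsection TT w) by exact: measurable_xsection.
have [[T uT]|nT] := pselect (exists T, unilateral_shift e (fun n => X n w) T); last first.
  have -> : xsection TT w = set0; last by rewrite measure0.
  apply/seteqP; split => // w'; rewrite /xsection /= inE => -[T1 [T2 [u1 _ _]]].
  by apply: nT; exists T1.
have bT : bounded_operator T by case: uT.
have [mE PE] := hA H T bT.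
apply/eqP; rewrite eq_le measure_ge0 andbT -PE; apply: le_measure; rewrite ?inE //.
move=> w'; rewrite /xsection /= inE => -[T1 [T2 [/= u1 u2 eqv]]]; exists T2 => //.
have [T1' m1] := unilateral_model u1; have [T2' m2] := unilateral_model u2.
have -> : T = T1.
  case: uT => _ _ _ hT; case: u1 => _ _ b1 h1.
  by apply: (basis_ext he bT b1) => i; rewrite hT h1.
by apply/(model_equiv m2 m1) => q r r0; rewrite ((model_equiv m1 m2).1 eqv q r r0).
Qed.

Lemma generic_equiv w w' T T' : G 0 -> generic G (fun n => X n w) -> generic G (fun n => X n w') ->
  unilateral_shift e (fun n => X n w) T -> unilateral_shift e (fun n => X n w') T' ->
  algebraically_equivalent T T'.
Proof.
move=> G0 gw gw' uT uT'.
have [S mS] := unilateral_model uT; have [S' mS'] := unilateral_model uT'.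
exact: universal_equiv mS mS' (generic_universal G0 gw) (generic_universal G0 gw').
Qed.

Lemma part_ii : G 0 ->
  (measurable TT /\ (P \x P)%E TT = 1%E) /\
  (exists (K : hilbertType R) (A : K -> K), bounded_operator A /\
     {ae P, forall w, T_equiv A w}).
Proof.
move=> G0; have mTT : measurable TT by exact: measurable_equiv_event2.
split; last first.
  have nT : P.-negligible (~` [set _ : Omega | True]).
    by rewrite (_ : ~` _ = set0); [exact: negligible_set0 | apply/seteqP; split=> w //=; apply].
  have [w [gw _]] := exists_generic nT; have [T uT] := generic_shift gw.
  exists H, T; split; first by case: uT.
  apply: (negligibleS _ ae_generic) => w' nw' gw'; apply: nw'.
  have [T' uT'] := generic_shift gw'; exists T' => //.
  exact: (generic_equiv G0 gw' gw uT' uT).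
split=> //; have [N [mN N0 hN]] := ae_generic.
have mC : measurable (~` N) by exact: measurableC.
have PC : P (~` N) = 1%E by rewrite probability_setC // N0 sube0.
have sub : (~` N) `*` (~` N) `<=` TT.
  move=> [w w'] /= [nw nw'].
  have gw : generic G (fun n => X n w) by apply: contrapT => h; apply: nw; exact: hN.
  have gw' : generic G (fun n => X n w') by apply: contrapT => h; apply: nw'; exact: hN.
  have [T uT] := generic_shift gw; have [T' uT'] := generic_shift gw'.
  by exists T, T'; split=> //; exact: (generic_equiv G0 gw gw' uT uT').
apply/eqP; rewrite eq_le; apply/andP; split.
  apply: (@le_trans _ _ ((P \x P)%E (setT `*` setT))).
    by apply: le_measure; rewrite ?inE //; exact: measurableX.
  rewrite product_measure1E // -[leRHS]mule1 le_eqVlt; apply/orP; left; apply/eqP.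
  by congr (_ * _)%E; exact: probability_setT.
apply: (@le_trans _ _ ((P \x P)%E (~` N `*` ~` N))).
  rewrite product_measure1E // -[leLHS]mule1 le_eqVlt; apply/orP; left; apply/eqP.
  by congr (_ * _)%E; exact/esym.
by apply: le_measure; rewrite ?inE //; exact: measurableX.
Qed.

Lemma limit_point_zero : limit_point G 0 ->
  G 0 /\ forall r : R, 0 < r -> exists2 y, G y & 0 < y < r.
Proof.
move=> hl.
have hacc (r : R) : 0 < r -> exists2 y, G y & 0 < y < r.
  move=> r0; have [y [y0 Gy]] := hl _ (nbhsx_ballx 0 r r0).
  rewrite -ball_normE /= sub0r normrN => yr; exists y => //.
  by rewrite lt_def y0 essran_ge0 //=; apply: le_lt_trans (ler_norm y) yr.
split=> //; apply: (closed_approx Gclosed) => r r0; have [y Gy /andP[y0 yr]] := hacc r r0.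
by exists y => //; rewrite sub0r normrN gtr0_norm.
Qed.

Lemma isolated_zeroP : isolated G 0 -> G 0 /\ exists delta, isolated_zero G delta.
Proof.
move=> [/set_mem G0 [V /nbhs_ballP[r r0 hr] hV]]; split=> //; exists r; split=> // x Gx xr.
have : (V `&` G) x by split=> //; apply: hr; rewrite -ball_normE /= sub0r normrN.
by rewrite hV.
Qed.

Lemma nneg_upward : upward nneg.
Proof. by move=> z z'; rewrite /nneg; lia. Qed.

Lemma spectrum_set_powerP (I : Type) (next : I -> I) (a : I -> R) (D : pred int) (w : int -> R) n :
  (forall v : nat -> R, n_spectrum next a n (\row_(j < n) v j) <-> int_spectrum D w n v) ->
  n_spectrum next a n = set_power G n <->
  forall v : nat -> R, int_spectrum D w n v <-> (forall j, (j < n)%N -> G (v j)).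
Proof.
move=> hS; split=> [E v|h]; first by rewrite -hS E; exact: set_powerP.
by apply/seteqP; split=> V; have [v ->] := row_fun V; rewrite set_powerP -h; move/hS.
Qed.

Lemma part_iii : limit_point G 0 ->
  (forall (K : hilbertType R) (f : nat -> K) (a : nat -> R) (A : K -> K),
     unilateral_shift f a A ->
     ({ae P, forall w, T_equiv A w} <->
      forall n, (1 <= n)%N -> n_spectrum succn a n = set_power G n)) /\
  (forall (K : hilbertType R) (f : int -> K) (a : int -> R) (A : K -> K),
     bilateral_shift f a A ->
     ({ae P, forall w, T_equiv A w} <->
      forall n, (1 <= n)%N -> n_spectrum next_int a n = set_power G n)).
Proof.
move=> /limit_point_zero[G0 hacc]; split=> K f a A uA.
  have [A' mA] := unilateral_model uA; have [_ a0 _ _] := uA.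
  apply: ae_equivP => w T gw uT; have [T' mT] := unilateral_model uT.
  rewrite (equiv_accumulationP Gclosed essran_ge0 mT mA gw G0 hacc nneg_upward).
  by split=> h n n1; apply/(spectrum_set_powerP (fun v => spectrum_unilateral n v a0)); exact: h.
have [A' mA] := bilateral_model uA; have [_ a0 _ _] := uA.
apply: ae_equivP => w T gw uT; have [T' mT] := unilateral_model uT.
have ua : upward all_int by [].
rewrite (equiv_accumulationP Gclosed essran_ge0 mT mA gw G0 hacc ua).
by split=> h n n1; apply/(spectrum_set_powerP (fun v => spectrum_bilateral n v a0)); exact: h.
Qed.

Lemma spectrum1P (I : Type) (next : I -> I) (a : I -> R) : (forall i, 0 <= a i) ->
  n_spectrum next a 1 `<=` set_power G 1 <-> forall i, G (a i).
Proof.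
move=> a0; split=> [h i|h V].
  have : set_power G 1 (\row_(j < 1) a i).
    apply: h; apply/(n_spectrumP next a 1 (fun=> a i)) => r r0; exists i => -[|j] // _.
    by rewrite /= (ger0_norm (a0 i)) subrr normr0.
  by move=> /(set_powerP G 1 (fun=> a i)) /(_ 0%N isT).
have [v ->] := row_fun V; rewrite n_spectrumP set_powerP => hv [|j] // _.
apply: (closed_approx Gclosed) => r r0; have [i hi] := hv r r0.
by exists (a i) => //; have := hi 0%N isT; rewrite /= (ger0_norm (a0 i)) distrC.
Qed.

Lemma part_iv : isolated G 0 ->
  forall (K : hilbertType R) (f : nat -> K) (a : nat -> R) (A : K -> K),
    unilateral_shift f a A ->
    ({ae P, forall w, T_equiv A w} <->
     n_spectrum succn a 1 `<=` set_power G 1 /\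
     [\/ a 0%N = 0 /\
         (forall n, (1 <= n)%N ->
            zero_flanked (set_power (G `\ 0) n) `<=` n_spectrum succn a n.+2),
         a 0%N <> 0 /\
         (forall n,
            zero_flanked (set_power (G `\ 0) n) `<=` n_spectrum succn a n.+2) |
         exists m, (1 <= m)%N /\
           [/\ set_power (G `\ 0) m (\row_(j < m) a j), a m = 0,
               zero_flanked (set_power (G `\ 0) m `\ \row_(j < m) a j)
                 `<=` n_spectrum succn a m.+2 &
               forall n, n <> m ->
                 zero_flanked (set_power (G `\ 0) n)
                   `<=` n_spectrum succn a n.+2]]).
Proof.
move=> /isolated_zeroP[G0 [delta hd]] K f a A uA.
have [A' mA] := unilateral_model uA; have [_ a0 _ _] := uA.
apply: ae_equivP => w T gw uT; have [T' mT] := unilateral_model uT.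
rewrite (equiv_isolatedP Gclosed essran_ge0 mT mA gw G0 hd nneg_upward).
rewrite (spectrum1P succn a0).
have zG : (forall z, G (zext a z)) <-> forall n, G (a n).
  by split=> [h n|]; [exact: (h n%:Z) | exact: zext_in].
by rewrite zG; split=> -[aG h]; split=> //; apply/(unilateral_spectraP hd aG G0 a0).
Qed.

Lemma part_v : isolated G 0 ->
  forall (K : hilbertType R) (f : int -> K) (a : int -> R) (A : K -> K),
    bilateral_shift f a A ->
    ({ae P, forall w, T_equiv A w} <->
     n_spectrum next_int a 1 `<=` set_power G 1 /\
     forall n,
       zero_flanked (set_power (G `\ 0) n) `<=` n_spectrum next_int a n.+2).
Proof.
move=> /isolated_zeroP[G0 [delta hd]] K f a A uA.
have [A' mA] := bilateral_model uA; have [_ a0 _ _] := uA.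
apply: ae_equivP => w T gw uT; have [T' mT] := unilateral_model uT.
have ua : upward all_int by [].
rewrite (equiv_isolatedP Gclosed essran_ge0 mT mA gw G0 hd ua).
rewrite (spectrum1P next_int a0); split=> -[aG h]; split=> // n.
  apply/zero_flankedP => c /set_powerP hc; apply/spectrum_bilateral => //.
  apply/(flanked_spectrumP _ _ _ hd aG) => r r0.
  have [i [_ i1 i2 hi]] := h n c hc r r0.
  by exists (i - 1); split; rewrite ?subrK.
move=> c hc r r0.
have := (zero_flankedP _ _).1 (h n) c ((set_powerP _ _ _).2 hc).
move=> /spectrum_bilateral - /(_ a0) /(flanked_spectrumP _ _ _ hd aG) /(_ r r0).
move=> [z [_ z1 z2 hz]]; exists (z + 1); split=> //.
by rewrite addrK.
Qed.

End RandomShift.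

Theorem theorem6p32 (R : realType) (H : hilbertType R) (e : nat -> H)
    (he : orthonormal_basis e)
    (d : measure_display) (Omega : measurableType d) (P : probability Omega R)
    (X : nat -> {RV P >-> R})
    (Xge0 : forall n w, 0 <= X n w)
    (Xbounded : forall n, exists M : R, forall w, X n w <= M)
    (Xindep : mutually_independent X)
    (Xid : identically_distributed X) :
  let G := essran (X 0%N) in
  let G1 := G `\ 0 in
  let TT := equiv_event2 e (fun n => X n) in
  let T_equiv := fun (K : hilbertType R) (A : K -> K) =>
    equiv_event e (fun n => X n) A in
  [/\ (* (i) *)
      ~ G 0 -> (`I_2 #<= G)%card ->
        (measurable TT /\ (P \x P)%E TT = 0%E) /\
        (forall (K : hilbertType R) (A : K -> K), bounded_operator A ->
           measurable (T_equiv K A) /\ P (T_equiv K A) = 0%E),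
      (* (ii) *)
      G 0 ->
        (measurable TT /\ (P \x P)%E TT = 1%E) /\
        (exists (K : hilbertType R) (A : K -> K), bounded_operator A /\
           {ae P, forall w, T_equiv K A w}),
      (* (iii) *)
      limit_point G 0 ->
        (forall (K : hilbertType R) (f : nat -> K) (a : nat -> R) (A : K -> K),
           unilateral_shift f a A ->
           ({ae P, forall w, T_equiv K A w} <->
            forall n, (1 <= n)%N -> n_spectrum succn a n = set_power G n)) /\
        (forall (K : hilbertType R) (f : int -> K) (a : int -> R) (A : K -> K),
           bilateral_shift f a A ->
           ({ae P, forall w, T_equiv K A w} <->
            forall n, (1 <= n)%N -> n_spectrum next_int a n = set_power G n)),
      (* (iv) *)
      isolated G 0 ->
        forall (K : hilbertType R) (f : nat -> K) (a : nat -> R) (A : K -> K),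
          unilateral_shift f a A ->
          ({ae P, forall w, T_equiv K A w} <->
           n_spectrum succn a 1 `<=` set_power G 1 /\
           [\/ a 0%N = 0 /\
               (forall n, (1 <= n)%N ->
                  zero_flanked (set_power G1 n) `<=` n_spectrum succn a n.+2),
               a 0%N <> 0 /\
               (forall n,
                  zero_flanked (set_power G1 n) `<=` n_spectrum succn a n.+2) |
               exists m, (1 <= m)%N /\
                 [/\ set_power G1 m (\row_(j < m) a j), a m = 0,
                     zero_flanked (set_power G1 m `\ \row_(j < m) a j)
                       `<=` n_spectrum succn a m.+2 &
                     forall n, n <> m ->
                       zero_flanked (set_power G1 n)
                         `<=` n_spectrum succn a n.+2]]) &
      (* (v) *)
      isolated G 0 ->
        forall (K : hilbertType R) (f : int -> K) (a : int -> R) (A : K -> K),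
          bilateral_shift f a A ->
          ({ae P, forall w, T_equiv K A w} <->
           n_spectrum next_int a 1 `<=` set_power G 1 /\
           forall n,
             zero_flanked (set_power G1 n) `<=` n_spectrum next_int a n.+2)].
Proof.
move=> G G1 TT T_equiv; split.
- exact: part_i.
- exact: part_ii.
- exact: part_iii.
- exact: part_iv.
- exact: part_v.
Qed.
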